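(* Let $h : (\mathbb{R}^n,0) \to (\mathbb{R}^n,0)$ be a bi-Lipschitz homeomorphism (germ). If $A$ and $h(A)$ are subanalytic set-germs at $0 \in \mathbb{R}^n$ (with $0\in\overline{A}$), then $\dim D(h(A)) = \dim D(A)$.
   Context: A bi-Lipschitz homeomorphism germ $h:(\mathbb{R}^n,0)\to(\mathbb{R}^n,0)$ is a homeomorphism between neighbourhoods of $0$ with $h(0)=0$ and constants $0<K_1\le K_2$ with $K_1|x-y|\le |h(x)-h(y)|\le K_2|x-y|$ near $0$. For a set-germ $A$ at $0$ with $0\in\overline{A}$, the direction set is $D(A)=\{a\in S^{n-1} : \exists\, \{x_i\}\subset A\setminus\{0\},\ x_i\to 0,\ x_i/\|x_i\|\to a\}$. Dimensions are those of subanalytic sets, with $\dim\emptyset=-1$. *)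

(* Defs.v *)
From HB Require Import structures.
From mathcomp Require Import all_boot all_order all_algebra.
From mathcomp Require Import boolp classical_sets reals.
Set Implicit Arguments. Unset Strict Implicit. Unset Printing Implicit Defensive.
Import Order.TTheory GRing.Theory Num.Theory.
Local Open Scope ring_scope.
Local Open Scope classical_set_scope.

Section Defs.
Variable R : realType.

Definition enorm N (x : 'rV[R]_N) : R := Num.sqrt (\sum_(i < N) x ord0 i ^+ 2).

Definition eball N (c : 'rV[R]_N) (r : R) : set 'rV[R]_N :=
  [set y | enorm (y - c) < r].

Definition eopen N (U : set 'rV[R]_N) : Prop :=
  forall x, U x -> exists2 r : R, 0 < r & eball x r `<=` U.

Definition seq_cvg N (u : nat -> 'rV[R]_N) (l : 'rV[R]_N) : Prop :=
  forall e : R, 0 < e -> exists M : nat, forall i, (M <= i)%N -> enorm (u i - l) < e.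

Definition monom N (alpha : N.-tuple nat) (y : 'rV[R]_N) : R :=
  \prod_(i < N) y ord0 i ^+ tnth alpha i.

(** f is real analytic on U: near every point of U, f is the sum of a
    (unconditionally) convergent power series centred at that point. *)
Definition analytic_on N (U : set 'rV[R]_N) (f : 'rV[R]_N -> R) : Prop :=
  forall x, U x -> exists2 r : R, 0 < r &
    exists c : N.-tuple nat -> R, forall y, eball x r y ->
      forall e : R, 0 < e -> exists s0 : seq (N.-tuple nat),
        forall s : seq (N.-tuple nat), uniq s -> {subset s0 <= s} ->
          `| \sum_(a <- s) c a * monom a (y - x) - f y | < e.

Definition semianalytic N (S : set 'rV[R]_N) : Prop :=
  forall x, exists2 r : R, 0 < r &
    exists (I : nat) (J : nat -> nat) (f : nat -> nat -> 'rV[R]_N -> R)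
           (eq0 : nat -> nat -> bool),
      (forall i j, (i < I)%N -> (j < J i)%N -> analytic_on (eball x r) (f i j)) /\
      S `&` eball x r =
        [set y | eball x r y /\ exists2 i, (i < I)%N &
                   forall j, (j < J i)%N ->
                     if eq0 i j then f i j y = 0 else 0 < f i j y].

Definition bounded_set N (S : set 'rV[R]_N) : Prop :=
  exists M : R, forall y, S y -> enorm y <= M.

Definition proj_first n m (S : set 'rV[R]_(n + m)) : set 'rV[R]_n :=
  (@lsubmx R 1 n m) @` S.

Definition subanalytic_germ n (A : set 'rV[R]_n) : Prop :=
  exists2 r : R, 0 < r &
    exists (m : nat) (S : set 'rV[R]_(n + m)),
      [/\ semianalytic S, bounded_set S & A `&` eball 0 r = proj_first S `&` eball 0 r].

(** X contains a k-dimensional analytic submanifold: the graph, over a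
    nonempty open subset of a coordinate k-plane (coordinates given by the
    injection c), of an analytic map. *)
Definition has_analytic_piece n (X : set 'rV[R]_n) (k : nat) : Prop :=
  exists (c : 'I_k -> 'I_n) (W : set 'rV[R]_k) (phi : 'rV[R]_k -> 'rV[R]_n),
    [/\ injective c, eopen W /\ W !=set0,
        (forall j : 'I_n, analytic_on W (fun u => phi u ord0 j)),
        (forall u i, W u -> phi u ord0 (c i) = u ord0 i) &
        forall u, W u -> X (phi u)].

(** Dimension of a (subanalytic) set: the maximal dimension of an analytic
    submanifold contained in it, and -1 for the empty set. *)
Definition sdim n (X : set 'rV[R]_n) : int :=
  \big[Num.max/(-1)%:~R]_(k < n.+1 | `[< has_analytic_piece X k >]) (k%:Z).

Definition dirset n (A : set 'rV[R]_n) : set 'rV[R]_n :=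
  [set a | enorm a = 1 /\ exists u : nat -> 'rV[R]_n,
     [/\ (forall i, A (u i) /\ u i != 0), seq_cvg u 0 &
         seq_cvg (fun i => (enorm (u i))^-1 *: u i) a]].

Definition adherent0 n (A : set 'rV[R]_n) : Prop :=
  forall e : R, 0 < e -> exists2 x, A x & enorm x < e.

(** h is a bi-Lipschitz homeomorphism germ at 0, realised on the ball
    U = eball 0 r onto the open neighbourhood h(U) of 0. *)
Definition bilipschitz_germ n (h : 'rV[R]_n -> 'rV[R]_n) (r K1 K2 : R) : Prop :=
  [/\ 0 < r /\ 0 < K1, K1 <= K2, h 0 = 0,
      eopen (h @` eball 0 r) &
      forall x y, eball 0 r x -> eball 0 r y ->
        K1 * enorm (x - y) <= enorm (h x - h y) /\
        enorm (h x - h y) <= K2 * enorm (x - y)].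

End Defs.

(* Main.v *)
(** By symmetry it is enough to show that D(h(A)) has an analytic piece of
    dimension at least k as soon as D(A) has one of dimension k.

    Write A near 0, in polar coordinates, as the projection of a semianalytic
    set T of points (rho, omega, y) with rho > 0; D(A) is the projection of the
    part rho = 0 of the closure of T.  After division by powers of rho,
    Weierstrass preparation describes T near a point of rho = 0 by the signs of
    monic polynomials in the last coordinate, which quantifier elimination over
    real closed fields then removes.  Induction on the number of coordinates
    gives two facts.  First, a direction a of A is not only a limit along a
    sequence: A comes within eps * rho of rho * a for every small rho.  Second,
    D(A) is a countable union of graphs of analytic maps over open subsets of
    coordinate planes.

    By the first fact, a limit g(v) of h(t v) / t along an ultrafilter of t -> 0
    maps the cone over D(A) into the cone over D(h(A)), and g is bi-Lipschitz.
    If D(A) contains a k-dimensional graph while all the graphs in D(h(A)) have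
    dimension < k, then, by the second fact, a box of R^(k+1) is covered by
    countably many sets with a Lipschitz parametrisation by a bounded subset of
    R^k.  Counting the cells of a fine grid shows that each of these sets misses
    a smaller box, so nested boxes yield a point which is not covered. *)

(* Countable unions are the right level of precision because the final contradiction is a Baire
   argument: the graphs in D(h(A)) may accumulate. Near a point, a semianalytic set is remembered
   only through finitely many analytic functions whose signs decide membership; this is the
   information that survives the elimination of a variable. Dividing by a power of rho keeps the
   sign where rho > 0 and leaves a factor that is not identically zero on rho = 0, so Weierstrass
   form is reached by a shear that fixes rho, and the induction stays on the same side.

   The first fact is what makes the blow-up useful: the limit g sees only the times t selected by
   the ultrafilter, while the definition of D(A) provides points at radii of its own choice. The
   dimension k + 1 comes from the cones: a direction of h(A) has fewer than k Lipschitz coordinates,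
   its norm is one more, and these at most k numbers would determine a point of a (k +
   1)-dimensional box in a Lipschitz way. For this the pieces of D(h(A)) must be graphs and not just
   analytic images: over its base coordinates a graph is locally Lipschitz. *)
Require Import Defs.
From HB Require Import structures.
From mathcomp Require Import all_boot all_order all_algebra.
From mathcomp Require Import boolp classical_sets reals filter.
From mathcomp Require qe_rcf qe_rcf_th.
From mathcomp Require Import ring lra zify.
Import Order.TTheory GRing.Theory Num.Theory.
Set Implicit Arguments. Unset Strict Implicit. Unset Printing Implicit Defensive.
Local Open Scope ring_scope.
Local Open Scope classical_set_scope.

(** * Unconditional sums *)

Section UnconditionalSums.
Context {R : realType}.

(** The mode of convergence that [analytic_on] spells out, for an arbitrary index type, so that
    double series are sums over pairs. *)
Definition usum (I : choiceType) (v : I -> R) (l : R) :=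
  forall e : R, 0 < e -> exists s0 : seq I,
    forall s, uniq s -> {subset s0 <= s} -> `|\sum_(i <- s) v i - l| < e.

Definition abdd (I : choiceType) (v : I -> R) (M : R) :=
  forall s, uniq s -> \sum_(i <- s) `|v i| <= M.

Lemma lt_eps_eq0 (x : R) : (forall e : R, 0 < e -> `|x| < e) -> x = 0.
Proof.
move=> h; apply/eqP; rewrite -normr_eq0; apply/negPn/negP => x0.
have /h : 0 < `|x| by rewrite lt_def x0 normr_ge0.
by rewrite ltxx.
Qed.

Lemma half_lt (x : R) : 0 < x -> x / 2 < x.
Proof. lra. Qed.

Lemma le_eps (x y : R) : (forall e : R, 0 < e -> x < y + e) -> x <= y.
Proof.
move=> h; rewrite leNgt; apply/negP => yx.
have /h : 0 < x - y by lra.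
lra.
Qed.

Lemma seq_big_cover (I : choiceType) (s : seq (seq I)) :
  exists u : seq I, uniq u /\ forall t, t \in s -> {subset t <= u}.
Proof.
exists (undup (flatten s)); split=> [|t ts i it]; first exact: undup_uniq.
by rewrite mem_undup; apply/flattenP; exists t.
Qed.

Section OneIndex.
Variable I : choiceType.
Implicit Types (v w : I -> R) (l M : R).

Lemma usum_ext v w l : v =1 w -> usum v l -> usum w l.
Proof. by move=> /funext ->. Qed.

Lemma usum_unique v l l' : usum v l -> usum v l' -> l = l'.
Proof.
move=> h h'; apply/eqP; rewrite -subr_eq0; apply/eqP.
apply: lt_eps_eq0 => e e0.
have [s0 H] := h _ (divr_gt0 e0 (ltr0Sn R 1)); have [s1 H'] := h' _ (divr_gt0 e0 (ltr0Sn R 1)).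
set s := undup (s0 ++ s1).
have us : uniq s by exact: undup_uniq.
have {}H := H s us; have {}H' := H' s us.
have a : {subset s0 <= s} by move=> i hi; rewrite mem_undup mem_cat hi.
have b : {subset s1 <= s} by move=> i hi; rewrite mem_undup mem_cat hi orbT.
have := H a; have := H' b; rewrite !ltr_norml => /andP[? ?] /andP[? ?].
by apply/andP; split; lra.
Qed.

Lemma usumD v w l l' : usum v l -> usum w l' -> usum (fun i => v i + w i) (l + l').
Proof.
move=> h h' e e0.
have [s0 H] := h _ (divr_gt0 e0 (ltr0Sn R 1)); have [s1 H'] := h' _ (divr_gt0 e0 (ltr0Sn R 1)).
exists (s0 ++ s1) => s us ss.
rewrite big_split /=.
have a : `|\sum_(i <- s) v i - l| < e / 2.
  by apply: H => // i hi; apply: ss; rewrite mem_cat hi.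
have b : `|\sum_(i <- s) w i - l'| < e / 2.
  by apply: H' => // i hi; apply: ss; rewrite mem_cat hi orbT.
move: a b; rewrite !ltr_norml => /andP[? ?] /andP[? ?].
by apply/andP; split; lra.
Qed.

Lemma usumZ v l c : usum v l -> usum (fun i => c * v i) (c * l).
Proof.
move=> h e e0; have c0 : 0 < `|c| + 1 by have := normr_ge0 c; lra.
have [s0 H] := h _ (divr_gt0 e0 c0); exists s0 => s us ss.
rewrite -mulr_sumr -mulrBr normrM.
have := H s us ss; rewrite ltr_pdivlMr // => h1.
apply: le_lt_trans h1; rewrite mulrC ler_wpM2l //; lra.
Qed.

Lemma usum0 : usum (fun _ : I => 0) 0.
Proof. by move=> e e0; exists [::] => s _ _; rewrite big1 // subrr normr0. Qed.

Lemma usum1 v i0 : (forall i, i != i0 -> v i = 0) -> usum v (v i0).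
Proof.
move=> h e e0; exists [:: i0] => s us ss.
rewrite (bigD1_seq i0) //=; last by apply: ss; rewrite inE.
by rewrite big1 // addr0 subrr normr0.
Qed.

Lemma abdd_usum_le v M l : abdd v M -> usum v l -> `|l| <= M.
Proof.
move=> h u; apply: le_eps => e e0.
have [s0 H] := u e e0.
have := H (undup s0) (undup_uniq _) (fun i hi => etrans (mem_undup _ _) hi).
have := h _ (undup_uniq s0).
have := ler_norm_sum (undup s0) v xpredT.
set S := \sum_(_ <- _) _; set T := \sum_(_ <- _) _ => a b c.
have -> : l = S - (S - l) by lra.
apply: le_lt_trans (ler_normB _ _) _; lra.
Qed.

Lemma abdd_ge0 v M : abdd v M -> 0 <= M.
Proof. by move/(_ [::] isT); rewrite big_nil. Qed.

Lemma abdd_le v w M : (forall i, `|v i| <= `|w i|) -> abdd w M -> abdd v M.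
Proof. by move=> h H s us; apply: le_trans (H s us); apply: ler_sum => i _. Qed.

Lemma ler_sum_subset v (s t : seq I) : (forall i, 0 <= v i) -> uniq s -> uniq t ->
  {subset s <= t} -> \sum_(i <- s) v i <= \sum_(i <- t) v i.
Proof.
move=> v0 us ut st; rewrite [X in _ <= X](bigID (mem s)) /=.
have -> : \sum_(i <- s) v i = \sum_(i <- t | i \in s) v i.
  rewrite -[RHS]big_filter; apply: perm_big; apply: uniq_perm => //.
    exact: filter_uniq.
  by move=> i; rewrite mem_filter; apply/idP/andP => [h|[]//]; split=> //; exact: st.
by rewrite lerDl sumr_ge0.
Qed.

Lemma usum_exists_ge0 v M : (forall i, 0 <= v i) -> abdd v M -> exists l, usum v l.
Proof.
move=> v0 h.
pose E := [set x : R | exists2 s, uniq s & x = \sum_(i <- s) v i].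
have E0 : E !=set0 by exists 0; exists [::] => //; rewrite big_nil.
have supE : has_sup E.
  split=> //; exists M => x [s us ->]; apply: le_trans (h s us).
  by apply: ler_sum => i _; exact: ler_norm.
exists (sup E) => e e0.
have [x [s0 us0 ->] hx] := sup_adherent e0 supE.
exists s0 => s us ss.
have a : \sum_(i <- s) v i <= sup E by apply: ub_le_sup; [case: supE|exists s].
have := ler_sum_subset v0 us0 us ss.
by rewrite ltr_norml => b; apply/andP; split; lra.
Qed.

Lemma usum_exists v M : abdd v M -> exists2 l, usum v l & `|l| <= M.
Proof.
move=> h.
(* [v] is the difference of the nonnegative families [|v| + v] and [|v|], whose finite sums are
   bounded by [2 * M] and [M]. *)
have [l1 h1] : exists l, usum (fun i => `|v i| + v i) l.
  apply: (@usum_exists_ge0 _ (2 * M)) => [i|s us].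
    by have := ler_norm (- v i); rewrite normrN; lra.
  have := h s us; rewrite -(ler_pM2l (@ltr0Sn R 1)); apply: le_trans.
  rewrite mulr_sumr; apply: ler_sum => i _.
  by apply: le_trans (ler_normD _ _) _; rewrite normr_id; lra.
have [l2 h2] : exists l, usum (fun i => `|v i|) l.
  by apply: (@usum_exists_ge0 _ M) => // s us; under eq_bigr do rewrite normr_id; exact: h.
have hv : usum v (l1 + (-1) * l2).
  apply: usum_ext (usumD h1 (usumZ (-1) h2)) => i /=; lra.
by exists (l1 + (-1) * l2) => //; exact: abdd_usum_le hv.
Qed.

(* A finite sum avoiding s0 is at most 2; split such a sum by the sign of its terms. *)
Lemma usum_abdd v l : usum v l -> exists M, abdd v M.
Proof.
move=> h; have [s0 H] := h _ (@ltr01 R).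
set t0 := undup s0.
exists (\sum_(i <- t0) `|v i| + 4) => s us.
have tail t : uniq t -> (forall i, i \in t -> i \notin s0) -> `|\sum_(i <- t) v i| <= 2.
  move=> ut dt.
  have u0 : uniq t0 by exact: undup_uniq.
  have a := H t0 u0 (fun i hi => etrans (mem_undup _ _) hi).
  have u1 : uniq (t0 ++ t).
    rewrite cat_uniq u0 ut andbT /=; apply/hasPn => i /dt.
    by rewrite /= mem_undup.
  have b := H (t0 ++ t) u1 _.
  have {}b : `|\sum_(i <- t0 ++ t) v i - l| < 1.
    by apply: b => i hi; rewrite mem_cat mem_undup hi.
  move: a b; rewrite big_cat /= !ltr_norml ler_norml => /andP[? ?] /andP[? ?].
  by apply/andP; split; lra.
rewrite (bigID (mem s0)) /=; apply: lerD.
  rewrite -big_filter; apply: ler_sum_subset => //.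
  - exact: filter_uniq.
  - exact: undup_uniq.
  - by move=> i; rewrite mem_filter mem_undup => /andP[].
rewrite (bigID (fun i => 0 <= v i)) /=.
have -> : (4 : R) = 2 + 2 by lra.
apply: lerD.
- have -> : \sum_(i <- s | (i \notin s0) && (0 <= v i)) `|v i| =
      \sum_(i <- [seq i <- s | (i \notin s0) && (0 <= v i)]) v i.
    by rewrite big_filter; apply: eq_bigr => i /andP[_ /ger0_norm].
  apply: le_trans (ler_norm _) (tail _ (filter_uniq _ us) _).
  by move=> i; rewrite mem_filter => /andP[/andP[]].
- have -> : \sum_(i <- s | (i \notin s0) && ~~ (0 <= v i)) `|v i| =
      - \sum_(i <- [seq i <- s | (i \notin s0) && ~~ (0 <= v i)]) v i.
    rewrite -sumrN big_filter; apply: eq_bigr => i /andP[_].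
    by rewrite -ltNge => /ltr0_norm.
  apply: le_trans (ler_norm _) _; rewrite normrN.
  apply: (tail _ (filter_uniq _ us)).
  by move=> i; rewrite mem_filter => /andP[/andP[]].
Qed.

Lemma usum_abdd_ge0 v l : (forall i, 0 <= v i) -> usum v l -> abdd v l.
Proof.
move=> v0 h s us; apply: le_eps => e e0; have [s0 H] := h e e0.
under eq_bigr do rewrite ger0_norm //.
have := ler_sum_subset v0 us (undup_uniq (s0 ++ s))
  (fun i hi => etrans (mem_undup _ _) (etrans (mem_cat _ _ _) (introT orP (or_intror hi)))).
have := H (undup (s0 ++ s)) (undup_uniq _)
  (fun i hi => etrans (mem_undup _ _) (etrans (mem_cat _ _ _) (introT orP (or_introl hi)))).
by rewrite ltr_norml => /andP[? ?] ?; lra.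
Qed.

End OneIndex.

(** The partial inverse [g] has the shape of [pickle_inv], which is how families over a countable
    type become families over [nat]. *)
Lemma usum_reindex (I J : choiceType) (f : I -> J) (g : J -> option I) (w : J -> R) l :
  pcancel f g -> ocancel g f -> (forall j, g j = None -> w j = 0) ->
  usum (w \o f) l -> usum w l.
Proof.
move=> fK gK w0 h e e0; have [s0 H] := h e e0.
exists (map f s0) => t ut st.
have -> : \sum_(j <- t) w j = \sum_(i <- pmap g t) (w \o f) i.
  elim: t {ut st} => [|j t IH]; first by rewrite !big_nil.
  rewrite big_cons /= IH; case E: (g j) => [i|] /=; last by rewrite w0 // add0r.
  by rewrite big_cons; congr (w _ + _); have := gK j; rewrite E.
apply: H; first exact: (pmap_uniq gK ut).
move=> i hi; rewrite mem_pmap; apply/mapP; exists (f i); last by rewrite fK.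
by apply: st; apply: map_f.
Qed.

Lemma abdd_reindex (I J : choiceType) (f : I -> J) (g : J -> option I) (w : J -> R) M :
  pcancel f g -> ocancel g f -> (forall j, g j = None -> w j = 0) ->
  abdd (w \o f) M -> abdd w M.
Proof.
move=> fK gK w0 h t ut.
have -> : \sum_(j <- t) `|w j| = \sum_(i <- pmap g t) `|(w \o f) i|.
  elim: t {ut} => [|j t IH]; first by rewrite !big_nil.
  rewrite big_cons /= IH; case E: (g j) => [i|] /=; last by rewrite w0 // normr0 add0r.
  by rewrite big_cons; congr (`|w _| + _); have := gK j; rewrite E.
by apply: h; exact: (pmap_uniq gK ut).
Qed.

Definition swap_pair (I J : Type) (p : I * J) := (p.2, p.1).

Lemma usum_swap (I J : choiceType) (v : I * J -> R) l :
  usum v l -> usum (fun p : J * I => v (p.2, p.1)) l.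
Proof.
move=> h; apply: (@usum_reindex _ _ (@swap_pair I J) (fun p => Some (swap_pair p))) => //.
- by case.
- by case.
- by apply: usum_ext h; case.
Qed.

Lemma usum_fubini (I J : choiceType) (v : I * J -> R) (L : I -> R) T :
  usum v T -> (forall i, usum (fun j => v (i, j)) (L i)) -> usum L T.
Proof.
move=> h hL e e0; have [s0 H] := h _ (divr_gt0 e0 (ltr0Sn R 1)).
exists (map fst s0) => t ut st.
(* Each of the [size t] inner sums is approximated within [d], for a total error of at most [e / 2];
   the added 1 covers an empty [t]. *)
pose d := e / 2 / ((size t)%:R + 1).
have d0 : 0 < d by rewrite !divr_gt0 // ltr_wpDl.
have [u0 hu0] := choice (fun i => hL i d d0).
have [u [uu hu]] := seq_big_cover (map snd s0 :: map u0 t).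
have a : `|\sum_(p <- [seq (i, j) | i <- t, j <- u]) v p - T| < e / 2.
  apply: H; first by apply: allpairs_uniq => // -[] ? ? [].
  move=> [i j] hp; apply/allpairsP; exists (i, j); split=> //=.
    by apply: st; apply/mapP; exists (i, j).
  by apply: (hu (map snd s0)); rewrite ?inE ?eqxx //; apply/mapP; exists (i, j).
have b : `|\sum_(i <- t) L i - \sum_(p <- [seq (i, j) | i <- t, j <- u]) v p|
    <= \sum_(i <- t) d.
  rewrite big_allpairs -sumrB; apply: le_trans (ler_norm_sum _ _ _) _.
  rewrite big_seq [X in _ <= X]big_seq; apply: ler_sum => i it.
  rewrite distrC ltW //; apply: hu0 => //.
  by apply: hu; rewrite inE map_f ?orbT.
have c : \sum_(i <- t) d <= e / 2.
  rewrite big_const_seq count_predT iter_addr_0 -[d *+ _]mulr_natr.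
  have <- : d * ((size t)%:R + 1) = e / 2 by rewrite divfK // gt_eqF // ltr_wpDl.
  by rewrite ler_pM2l // lerDl.
have -> : \sum_(i <- t) L i - T = (\sum_(i <- t) L i -
  \sum_(p <- [seq (i, j) | i <- t, j <- u]) v p) +
  (\sum_(p <- [seq (i, j) | i <- t, j <- u]) v p - T) by lra.
apply: le_lt_trans (ler_normD _ _) _; lra.
Qed.

Lemma abdd_pair (I J : choiceType) (v : I * J -> R) (m : I -> R) M :
  (forall i, abdd (fun j => v (i, j)) (m i)) -> abdd m M -> abdd v M.
Proof.
move=> h hm s us.
pose t := undup (map fst s); pose u := undup (map snd s).
apply: (@le_trans _ _ (\sum_(p <- [seq (i, j) | i <- t, j <- u]) `|v p|)).
  apply: ler_sum_subset => //.
    by apply: allpairs_uniq; rewrite ?undup_uniq // => -[] ? ? [].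
  move=> [i j] hp; apply/allpairsP; exists (i, j); split=> //=.
    by rewrite mem_undup; apply/mapP; exists (i, j).
  by rewrite mem_undup; apply/mapP; exists (i, j).
rewrite big_allpairs; apply: le_trans (hm t (undup_uniq _)); apply: ler_sum => i _.
apply: le_trans (h i u (undup_uniq _)) (ler_norm _).
Qed.

(** Absolute summability provides some sum of the double family, and [usum_fubini] identifies it
    with the iterated one. *)
Lemma usum_pair (I J : choiceType) (v : I * J -> R) (L m : I -> R) T M :
  (forall i, abdd (fun j => v (i, j)) (m i)) -> abdd m M ->
  (forall i, usum (fun j => v (i, j)) (L i)) -> usum L T -> usum v T.
Proof.
move=> h hm hL hT; have [T' hT' _] := usum_exists (abdd_pair h hm).
by rewrite (usum_unique hT (usum_fubini hT' hL)).
Qed.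

End UnconditionalSums.

(** * Power series and Weierstrass preparation *)

Section PowerSeries.
Context {R : realType}.
Implicit Types (d l : nat) (r x y : nat -> R) (M : R) (f g : (nat -> R) -> R).

Definition mon d (a : nat -> nat) x : R := \prod_(i < d) x i ^+ a i.

Definition inbox d r x := forall i, (i < d)%N -> `|x i| <= r i.

(* Points of R^d are streams nat -> R of which only the first d terms matter.
   M bounds the absolute sum of the power series at the corner r of the box. *)
Definition An d r M f := exists (c : nat -> R) (a : nat -> nat -> nat),
  abdd (fun k => c k * mon d (a k) r) M /\
  forall x, inbox d r x -> usum (fun k => c k * mon d (a k) x) (f x).

Definition upd (T : Type) (x : nat -> T) (l : nat) (v : T) : nat -> T :=
  fun i => if i == l then v else x i.

Definition nng r := forall i, 0 <= r i.

Lemma mon_ge0 d a r : nng r -> 0 <= mon d a r.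
Proof. by move=> h; apply: prodr_ge0 => i _; apply: exprn_ge0. Qed.

Lemma mon_le d a r x : inbox d r x -> `|mon d a x| <= mon d a r.
Proof.
move=> h; rewrite normr_prod; apply: ler_prod => i _.
by rewrite normr_ge0 normrX lerXn2r ?qualifE //= ?h // (le_trans _ (h i _)).
Qed.

Lemma monD d a b x : mon d (fun i => a i + b i)%N x = mon d a x * mon d b x.
Proof. by rewrite /mon -big_split; apply: eq_bigr => i _; rewrite exprD. Qed.

Lemma mon_upd d a l x : (l < d)%N -> mon d a x = x l ^+ a l * mon d (upd a l 0%N) x.
Proof.
move=> ld; rewrite /mon (bigD1 (Ordinal ld)) //=; congr (_ * _).
rewrite [RHS](bigD1 (Ordinal ld)) //= /upd eqxx expr0 mul1r.
by apply: eq_bigr => i il; rewrite -[_ == l]/(i == Ordinal ld) (negPf il).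
Qed.

Lemma mon_upd0 d a l x v : mon d (upd a l 0%N) (upd x l v) = mon d (upd a l 0%N) x.
Proof.
apply: eq_bigr => i _; rewrite /upd; case: ifP => // _; by rewrite !expr0.
Qed.

(** [An] indexes its series by [nat]; through [pickle] any countable type serves, missing indices
    receiving the coefficient 0. As a monomial may occur several times in the series, products and
    compositions are double series whose coefficients are never collected. *)
Lemma An_count d r M f (K : countType) (c : K -> R) (a : K -> nat -> nat) :
  abdd (fun k => c k * mon d (a k) r) M ->
  (forall x, inbox d r x -> usum (fun k => c k * mon d (a k) x) (f x)) ->
  An d r M f.
Proof.
move=> hM hf.
exists (fun n => if pickle_inv n is Some k then c k else 0).
exists (fun n => if pickle_inv n is Some k then a k else fun _ => 0%N).
split=> [|x /hf hx].
  apply: (abdd_reindex (@pickleK_inv K) (@pickle_invK K)) => [j ->|]; first by rewrite mul0r.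
  move=> s us; under eq_bigr do rewrite /= pickleK_inv; exact: hM.
apply: (usum_reindex (@pickleK_inv K) (@pickle_invK K)) => [j ->|]; first by rewrite mul0r.
by apply: usum_ext hx => k /=; rewrite pickleK_inv.
Qed.

Lemma abdd_mon_box d r x M (K : choiceType) (c : K -> R) a :
  inbox d r x -> abdd (fun k => c k * mon d (a k) r) M ->
  abdd (fun k => c k * mon d (a k) x) M.
Proof.
move=> xr; apply: abdd_le => k; rewrite !normrM ler_wpM2l // (le_trans (mon_le _ xr)) //.
exact: ler_norm.
Qed.

Lemma An_le d r M f x : An d r M f -> inbox d r x -> `|f x| <= M.
Proof.
move=> [c [a [hM hf]]] xr; apply: abdd_usum_le (hf x xr).
exact: abdd_mon_box hM.
Qed.

Lemma An_ge0 d r M f : An d r M f -> 0 <= M.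
Proof. by move=> [c [a [/abdd_ge0 ? _]]]. Qed.

Lemma An_ext d r M f g : (forall x, inbox d r x -> f x = g x) -> An d r M f -> An d r M g.
Proof.
move=> fg [c [a [hM hf]]]; exists c, a; split=> // x xr; rewrite -fg //; exact: hf.
Qed.

Lemma An_monoM d r M M' f : M <= M' -> An d r M f -> An d r M' f.
Proof.
move=> MM [c [a [hM hf]]]; exists c, a; split=> // s us; exact: le_trans (hM s us) _.
Qed.

Lemma An_shrink d r r' M f : nng r' -> (forall i, (i < d)%N -> r' i <= r i) ->
  An d r M f -> An d r' M f.
Proof.
move=> r0 rr [c [a [hM hf]]]; exists c, a; split=> [|x xr].
  by apply: abdd_mon_box hM => i id; rewrite ger0_norm // rr.
apply: hf => i id; apply: le_trans (xr i id) (rr i id).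
Qed.

Lemma An_sum d r M f (F : nat -> (nat -> R) -> R) m : nng r ->
  (forall k, An d r (m k) (F k)) -> abdd m M ->
  (forall x, inbox d r x -> usum (fun k => F k x) (f x)) -> An d r M f.
Proof.
move=> r0 hF hm hf.
have [c hc] := choice hF; have [a ha] := choice hc.
apply: (@An_count _ _ _ _ (nat * nat)%type (fun p => c p.1 p.2) (fun p => a p.1 p.2)).
  by apply: abdd_pair hm => i; case: (ha i).
move=> x xr; apply: (usum_pair _ hm _ (hf x xr)) => i /=; have [h1 h2] := ha i.
  exact: abdd_mon_box h1.
exact: h2.
Qed.

Lemma An_mk d r M (K : countType) (c : K -> R) (a : K -> nat -> nat) : nng r ->
  abdd (fun k => c k * mon d (a k) r) M ->
  exists f, An d r M f /\
    forall x, inbox d r x -> usum (fun k => c k * mon d (a k) x) (f x).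
Proof.
move=> r0 hM.
have /choice[f hf] : forall x, exists v : R, inbox d r x -> usum (fun k => c k * mon d (a k) x) v.
  move=> x; case: (pselect (inbox d r x)) => xr; last by exists 0.
  by have [v hv _] := usum_exists (abdd_mon_box xr hM); exists v.
by exists f; split=> //; apply: An_count hM hf.
Qed.

Lemma An_mul d r M M' f g : nng r -> An d r M f -> An d r M' g ->
  An d r (M * M') (fun x => f x * g x).
Proof.
move=> r0 [c [a [hM hf]]] [c' [a' [hM' hg]]].
pose t x (p : nat * nat) := (c p.1 * mon d (a p.1) x) * (c' p.2 * mon d (a' p.2) x).
have tE x p : c p.1 * c' p.2 * mon d (fun i => a p.1 i + a' p.2 i)%N x = t x p.
  by rewrite monD /t; ring.
have bt x i : inbox d r x -> abdd (fun j => t x (i, j)) (`|c i * mon d (a i) x| * M').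
  move=> xr s us; rewrite (eq_bigr (fun j => `|c i * mon d (a i) x| *
    `|c' j * mon d (a' j) x|)) => [|j _]; last by rewrite /t /= normrM.
  rewrite -mulr_sumr ler_wpM2l //; exact: (abdd_mon_box xr hM' us).
have bb x : inbox d r x -> abdd (fun i => `|c i * mon d (a i) x| * M') (M * M').
  move=> xr s us; rewrite (eq_bigr (fun j => `|c j * mon d (a j) x| * M')) => [|j _].
    rewrite -mulr_suml ler_wpM2r ?(abdd_ge0 hM') //; exact: (abdd_mon_box xr hM us).
  by rewrite normrM normr_id (ger0_norm (abdd_ge0 hM')).
have rr : inbox d r r by move=> i _; rewrite ger0_norm.
apply: (@An_count _ _ _ _ (nat * nat)%type (fun p => c p.1 * c' p.2)
   (fun p i => a p.1 i + a' p.2 i)%N) => [|x xr].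
  move=> s us; under eq_bigr do rewrite tE.
  exact: (abdd_pair (bt r ^~ rr) (bb r rr)).
apply: (@usum_ext _ _ (t x)) => [p|]; first by rewrite tE.
apply: (usum_pair (L := fun i => c i * mon d (a i) x * g x) (bt x ^~ xr) (bb x xr)).
  by move=> i; exact: (usumZ (c i * mon d (a i) x) (hg x xr)).
have := usumZ (g x) (hf x xr); rewrite mulrC => h; apply: usum_ext h => i /=; exact: mulrC.
Qed.

Lemma abdd_unit (v : R) : abdd (fun _ : unit => v) `|v|.
Proof.
move=> s us; rewrite (big_nth tt) big_mkord sumr_const card_ord.
have : (size s <= 1)%N by have := max_card (mem s); rewrite card_unit (card_uniqP us).
by case: (size s) => [|[|//]] _; rewrite ?mulr0n ?mulr1n.
Qed.

Lemma usum_unit (v : R) : usum (fun _ : unit => v) v.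
Proof. by apply: (usum1 (v := fun=> v) (i0 := tt)) => -[]. Qed.

Lemma An_const d r c : An d r `|c| (fun _ => c).
Proof.
have m1 x : c * mon d (fun=> 0%N) x = c by rewrite /mon big1 ?mulr1.
apply: (@An_count _ _ _ _ unit (fun=> c) (fun _ _ => 0%N)) => [|x _].
  by under [X in abdd X]funext do rewrite m1; exact: abdd_unit.
by under [X in usum X]funext do rewrite m1; exact: usum_unit.
Qed.

Lemma An_coord d r l : (l < d)%N -> nng r -> An d r (r l) (fun x => x l).
Proof.
move=> ld r0.
have mE x : 1 * mon d (fun i => i == l : nat) x = x l.
  rewrite mul1r (mon_upd _ _ ld) eqxx expr1 /mon big1 ?mulr1 // => i _.
  by rewrite /upd; case: eqP.
apply: (@An_count _ _ _ _ unit (fun=> 1) (fun _ i => i == l : nat)) => [|x _].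
  under [X in abdd X]funext do rewrite mE.
  by rewrite -{2}(ger0_norm (r0 l)); exact: abdd_unit.
by under [X in usum X]funext do rewrite mE; exact: usum_unit.
Qed.

Lemma An_scale d r M f c : nng r -> An d r M f -> An d r (`|c| * M) (fun x => c * f x).
Proof. by move=> r0; apply: An_mul => //; exact: An_const. Qed.

Lemma usum_two (u v : R) : usum (fun k : nat => if k is 0 then u else if k is 1 then v else 0)
  (u + v).
Proof.
have a := @usum1 R nat (fun k => if k is 0 then u else 0) 0%N.
have b := @usum1 R nat (fun k => if k is 1 then v else 0) 1%N.
apply: usum_ext (usumD (a _) (b _)).
- by case=> [|[|k]] /=; rewrite ?addr0 ?add0r.
- by case.
- by case=> [|[|]].
Qed.

Lemma An_add d r M M' f g : nng r -> An d r M f -> An d r M' g ->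
  An d r (M + M') (fun x => f x + g x).
Proof.
move=> r0 hf hg.
apply: (@An_sum _ _ _ _ (fun k => if k is 0 then f else if k is 1 then g else fun=> 0)
   (fun k => if k is 0 then M else if k is 1 then M' else 0)) => // [k||x _].
- case: k => [|[|k]] //=; by have := An_const d r 0; rewrite normr0.
- have M0 := An_ge0 hf; have M0' := An_ge0 hg.
  by apply: usum_abdd_ge0 (usum_two M M') => -[|[|k]].
- by apply: usum_ext (usum_two (f x) (g x)) => -[|[|k]].
Qed.

Lemma An_sub d r M M' f g : nng r -> An d r M f -> An d r M' g ->
  An d r (M + M') (fun x => f x - g x).
Proof.
move=> r0 hf hg; have := An_add r0 hf (An_scale (-1) r0 hg).
rewrite normrN1 mul1r; apply: An_ext => x _; by rewrite mulN1r.
Qed.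

Lemma An_exp d r M f k : nng r -> An d r M f -> An d r (M ^+ k) (fun x => f x ^+ k).
Proof.
move=> r0 hf; elim: k => [|k IH].
  by have := An_const d r 1; rewrite normr1.
have := An_mul r0 hf IH; rewrite -exprS; apply: An_ext => x _; by rewrite exprS.
Qed.

Lemma mon_recr d a x : mon d.+1 a x = mon d a x * x d ^+ a d.
Proof. by rewrite /mon big_ord_recr. Qed.

Lemma mon_0 a x : mon 0 a x = 1.
Proof. by rewrite /mon big_ord0. Qed.

Lemma An_mon d r d' r' a (g : nat -> (nat -> R) -> R) : nng r' ->
  (forall i, (i < d)%N -> An d' r' (r i) (g i)) ->
  An d' r' (mon d a r) (fun x => mon d a (fun i => g i x)).
Proof.
move=> r0; elim: d => [|d IH] hg.
  have := An_const d' r' 1; rewrite normr1 mon_0.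
  by apply: An_ext => x _; rewrite mon_0.
have := An_mul r0 (IH (fun i id => hg i (ltnW id))) (An_exp (a d) r0 (hg d (ltnSn d))).
by rewrite mon_recr; apply: An_ext => x _; rewrite mon_recr.
Qed.

(** A monomial in the [g i] is majorised by the same monomial at the corner [r], so the majorant [M]
    of [f] passes to the composite. *)
Lemma An_comp d r M f d' r' (g : nat -> (nat -> R) -> R) : nng r -> nng r' -> An d r M f ->
  (forall i, (i < d)%N -> An d' r' (r i) (g i)) ->
  An d' r' M (fun x => f (fun i => g i x)).
Proof.
move=> r0 r0' [c [a [hM hf]]] hg.
apply: (@An_sum _ _ _ _ (fun k x => c k * mon d (a k) (fun i => g i x))
  (fun k => `|c k| * mon d (a k) r)) => //.
- by move=> k; apply: An_scale => //; exact: An_mon.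
- by apply: abdd_le hM => k; rewrite !normrM normr_id.
- by move=> x xr; apply: hf => i id; apply: An_le (hg i id) xr.
Qed.

(** The terms without [x l] add up to the value at [x l = 0]. Every other term gives up one factor
    [x l], hence a factor [r l] at the corner, which is where [M / r l] comes from. *)
Lemma An_peel d r M f l : nng r -> (l < d)%N -> 0 < r l -> An d r M f ->
  exists2 h, An d r (M / r l) h &
    forall x, inbox d r x -> f x = f (upd x l 0) + x l * h x.
Proof.
move=> r0 ld rl [c [a [hM hf]]].
pose c' k := if a k l == 0%N then 0 else c k.
pose a' k := upd (a k) l (a k l).-1.
have tE x k : x l * (c' k * mon d (a' k) x) = if a k l == 0%N then 0 else c k * mon d (a k) x.
  rewrite /c'; case: eqP => [_|/eqP ak]; first by rewrite mul0r mulr0.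
  rewrite (mon_upd (a' k) x ld) (mon_upd (a k) x ld) /a' /upd eqxx.
  have -> : (fun i => if i == l then 0%N else if i == l then (a k l).-1 else a k i) =
    upd (a k) l 0%N by apply/funext => i; rewrite /upd; case: eqP.
  by rewrite -[in RHS](prednK (n := a k l)) ?lt0n // exprS /upd; ring.
have hM' : abdd (fun k => c' k * mon d (a' k) r) (M / r l).
  move=> s us; rewrite ler_pdivlMr // mulrC mulr_sumr.
  apply: le_trans (hM s us); apply: ler_sum => k _.
  rewrite -{1}(gtr0_norm rl) -normrM tE; case: ifP => // _; by rewrite normr0.
have [h [hA hh]] := An_mk r0 hM'; exists h => // x xr.
have h1 := usumZ (x l) (hh x xr).
have xr0 : inbox d r (upd x l 0).
  by move=> i id; rewrite /upd; case: eqP => _; [rewrite normr0|exact: xr].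
have h2 := usumD (hf _ xr0) h1.
apply: usum_unique (hf x xr) _; apply: usum_ext h2 => k /=.
rewrite tE; case: eqP => [ak|/eqP ak].
  by rewrite addr0 (mon_upd _ (upd x l 0) ld) (mon_upd _ x ld) ak !expr0 mon_upd0.
by rewrite (mon_upd _ (upd x l 0) ld) {1}/upd eqxx expr0n (negPf ak) mul0r mulr0 add0r.
Qed.

(** A Schwarz lemma for majorants: the constant terms add up to [f 0 = 0] and are dropped together,
    and every remaining monomial has positive degree, so shrinking the box by [s] gains at least a
    factor [s]. *)
Lemma An_small d r M f s : nng r -> 0 <= s <= 1 -> An d r M f -> f (fun=> 0) = 0 ->
  An d (fun i => s * r i) (s * M) f.
Proof.
move=> r0 /andP[s0 s1] [c [a [hM hf]]] f0.
pose z k := [forall i : 'I_d, a k i == 0%N].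
pose c' k := if z k then 0 else c k.
have sr0 : nng (fun i => s * r i) by move=> i; rewrite mulr_ge0.
have zr : inbox d r (fun=> 0) by move=> i _; rewrite normr0.
have hz x : inbox d r x -> usum (fun k => c' k * mon d (a k) x) (f x).
  move=> xr; rewrite -[f x]subr0 -f0 -mulN1r.
  apply: usum_ext (usumD (hf x xr) (usumZ (-1) (hf _ zr))) => k /=.
  rewrite /c'; case: ifPn => [/forallP zk|].
    have m1 y : mon d (a k) y = 1 by rewrite /mon big1 // => i _; rewrite (eqP (zk i)).
    by rewrite !m1; lra.
  rewrite negb_forall => /existsP[i ai].
  have m0 : mon d (a k) (fun=> 0) = 0.
    by rewrite (mon_upd _ (fun=> 0) (ltn_ord i)) expr0n (negPf ai) mul0r.
  by rewrite m0; lra.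
exists c', a; split=> [|x xr]; last first.
  by apply: hz => i id; apply: le_trans (xr i id) _; rewrite ler_piMl // r0.
move=> t ut; apply: le_trans (ler_wpM2l s0 (hM t ut)); rewrite mulr_sumr.
apply: ler_sum => k _; rewrite /c'; case: ifPn => [_|].
  by rewrite mul0r normr0 mulr_ge0.
rewrite negb_forall => /existsP[i ai].
rewrite !normrM mulrCA ler_wpM2l // !ger0_norm ?mon_ge0 //.
have -> : mon d (a k) (fun i => s * r i) = mon d (a k) (fun=> s) * mon d (a k) r.
  by rewrite /mon -big_split; apply: eq_bigr => j _ /=; rewrite exprMn.
apply: ler_wpM2r; first exact: mon_ge0.
rewrite (mon_upd (a k) (fun=> s) (ltn_ord i)) -(prednK (n := a k i)) ?lt0n // exprS -mulrA.
rewrite ler_piMr // mulr_ile1 ?exprn_ge0 ?mon_ge0 ?exprn_ile1 //.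
by apply: prodr_ile1 => j _; rewrite exprn_ge0 ?exprn_ile1.
Qed.

End PowerSeries.

Section Weierstrass.
Context {R : realType}.
Implicit Types (d p : nat) (r x y : nat -> R) (M : R) (f g h : (nat -> R) -> R).

Lemma half_pow_le (n : nat) : (2^-1 : R) ^+ n * (n%:R + 1) <= 1.
Proof.
elim: n => [|n IH]; first by rewrite expr0; lra.
apply: le_trans IH; rewrite exprS -mulrA mulrCA ler_pM2l ?exprn_gt0 ?invr_gt0 //.
by have := ler0n R n; rewrite -(natr1 n); lra.
Qed.

Lemma half_pow_lt (e : R) : 0 < e -> exists N, forall n, (N <= n)%N -> 2^-1 ^+ n < e.
Proof.
move=> e0; exists (Num.bound e^-1) => n Nn.
have h : e^-1 < n%:R.
  have ei : 0 <= e^-1 by rewrite invr_ge0 ltW.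
  by apply: lt_le_trans (archi_boundP ei) _; rewrite ler_nat.
have := half_pow_le n; set q := _ ^+ n => hq.
have q0 : 0 < q by rewrite exprn_gt0 ?invr_gt0.
have : q * n%:R <= 1 by apply: le_trans hq; rewrite ler_pM2l //; lra.
have n0 : 0 < n%:R :> R by apply: lt_trans h; rewrite invr_gt0.
rewrite -ler_pdivlMr // div1r => h'; apply: le_lt_trans h' _.
by rewrite -[e]invrK ltf_pV2 ?posrE ?invr_gt0.
Qed.

Lemma expr_lt_eps (q e : R) : 0 <= q -> q < 1 -> 0 < e -> exists N, q ^+ N < e.
Proof.
rewrite le_eqVlt => /predU1P[<-|q0] q1 e0; first by exists 1%N; rewrite expr1.
pose de := q^-1 - 1; have de0 : 0 < de by rewrite subr_gt0 invf_gt1.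
have bern n : q ^+ n * (n%:R * de) <= 1.
  suff H : n%:R * de <= q^-1 ^+ n.
    by rewrite exprVn in H; rewrite mulrC -ler_pdivlMr ?exprn_gt0 // div1r.
  elim: n => [|n IH]; first by rewrite mul0r expr0.
  have h1 : 1 <= q^-1 ^+ n by rewrite exprn_ege1 // invf_ge1 // ltW.
  rewrite exprS (_ : q^-1 = 1 + de); last by rewrite /de addrC subrK.
  rewrite -(_ : q^-1 = 1 + de); last by rewrite /de addrC subrK.
  rewrite -(natr1 n) mulrDl mul1r (_ : q^-1 = 1 + de); last by rewrite /de addrC subrK.
  rewrite mulrDl mul1r -(_ : q^-1 = 1 + de); last by rewrite /de addrC subrK.
  by apply: lerD => //; rewrite ler_peMr // ltW.
pose n := Num.bound (e * de)^-1; exists n.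
have ed : 0 < e * de by exact: mulr_gt0.
have hn : (e * de)^-1 < n%:R by apply: archi_boundP; rewrite invr_ge0 ltW.
have n0 : 0 < n%:R :> R by apply: lt_trans hn; rewrite invr_gt0.
have h : 1 < e * (n%:R * de).
  by rewrite mulrCA -ltr_pdivrMr // div1r.
have := bern n => h2; have := le_lt_trans h2 h; rewrite ltr_pM2r //; exact: mulr_gt0.
Qed.

Lemma abdd_nat (v : nat -> R) M : (forall N, \sum_(k < N) `|v k| <= M) -> abdd v M.
Proof.
move=> h s us; pose N := (\max_(k <- s) k).+1.
apply: le_trans (h N); rewrite -(big_mkord xpredT (fun k => `|v k|)).
apply: ler_sum_subset => //; first exact: iota_uniq.
by move=> k ks; rewrite mem_index_iota /= ltnS; exact: leq_bigmax_seq.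
Qed.

Lemma usum_nat (v : nat -> R) M (l : R) : abdd v M ->
  (forall e : R, 0 < e -> exists N, forall n, (N <= n)%N -> `|\sum_(k < n) v k - l| < e) ->
  usum v l.
Proof.
move=> hv hl; have [l' hl' _] := usum_exists hv.
suff -> : l = l' by [].
apply/eqP; rewrite -subr_eq0; apply/eqP; apply: lt_eps_eq0 => e e0.
have e2 := divr_gt0 e0 (ltr0Sn R 1).
have [s0 H] := hl' _ e2; have [N H'] := hl _ e2.
pose n := maxn N (\max_(k <- s0) k).+1.
have := H (index_iota 0 n) (iota_uniq _ _); rewrite big_mkord => {}H.
have {}H : `|\sum_(k < n) v k - l'| < e / 2.
  apply: H => k ks; rewrite mem_index_iota /= leq_max ltnS.
  by apply/orP; right; exact: leq_bigmax_seq.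
have := H' n (leq_maxl _ _); move: H; rewrite !ltr_norml => /andP[? ?] /andP[? ?].
by apply/andP; split; lra.
Qed.

Lemma half_sum (N : nat) : \sum_(k < N) (2^-1 : R) ^+ k <= 2.
Proof.
suff -> : \sum_(k < N) (2^-1 : R) ^+ k = 2 - 2 * 2^-1 ^+ N.
  by rewrite lerBlDr lerDl mulr_ge0 ?exprn_ge0 ?invr_ge0.
elim: N => [|N IH]; first by rewrite big_ord0 expr0; lra.
by rewrite big_ord_recr /= IH exprS; lra.
Qed.

Lemma abdd_half (C : R) : 0 <= C -> abdd (fun k : nat => C * 2^-1 ^+ k) (C * 2).
Proof.
move=> C0; apply: abdd_nat => N.
under eq_bigr do rewrite normrM (ger0_norm C0) ger0_norm ?exprn_ge0 ?invr_ge0 //.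
by rewrite -mulr_sumr ler_wpM2l // half_sum.
Qed.

Lemma usum_geo (u : R) : `|u| <= 2^-1 -> usum (fun k : nat => u ^+ k) (1 - u)^-1.
Proof.
move=> hu; have u1 : 0 < 1 - u by have := ler_norm u; lra.
have hp n : `|u| ^+ n <= 2^-1 ^+ n by apply: lerXn2r; rewrite ?nnegrE ?invr_ge0.
apply: (@usum_nat _ (1 * 2)).
  apply: abdd_le (abdd_half ler01) => k; rewrite mul1r normrX.
  by rewrite [X in _ <= X]ger0_norm ?exprn_ge0 ?invr_ge0.
move=> e e0; have [N hN] := half_pow_lt (mulr_gt0 e0 u1).
exists N => n /hN h.
have -> : \sum_(k < n) u ^+ k = (1 - u ^+ n) / (1 - u).
  have un : 1 - u != 0 by rewrite gt_eqF.
  by apply: (mulIf un); rewrite divfK // -[1 - u ^+ n]opprB subrX1; ring.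
rewrite mulrBl mul1r addrC addKr normrN normrM (gtr0_norm (x := _^-1)) ?invr_gt0 //.
by rewrite ltr_pdivrMr // normrX; exact: le_lt_trans (hp n) h.
Qed.

Lemma An_series d r M (F : nat -> (nat -> R) -> R) m : nng r ->
  (forall k, An d r (m k) (F k)) -> abdd m M ->
  exists f, An d r M f /\ forall x, inbox d r x -> usum (fun k => F k x) (f x).
Proof.
move=> r0 hF hm.
have hb x : inbox d r x -> abdd (fun k => F k x) M.
  move=> xr; apply: abdd_le hm => k; apply: le_trans (An_le (hF k) xr) (ler_norm _).
have /choice[f hf] : forall x, exists v : R, inbox d r x -> usum (fun k => F k x) v.
  move=> x; case: (pselect (inbox d r x)) => xr; last by exists 0.
  by have [v hv _] := usum_exists (hb x xr); exists v.
by exists f; split=> //; apply: An_sum hF hm hf.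
Qed.

Lemma An_inv d r M f : nng r -> An d r M f -> f (fun=> 0) != 0 ->
  exists s M' : R, [/\ 0 < s <= 1, An d (fun i => s * r i) M' (fun x => (f x)^-1) &
    forall x, inbox d (fun i => s * r i) x -> 0 < f x * f (fun=> 0)].
Proof.
move=> r0 hf; set c := f _ => c0.
pose M1 := 1 + `|c^-1| * M.
have M11 : 1 <= M1 by rewrite lerDl mulr_ge0 // (An_ge0 hf).
have hu : An d r M1 (fun x => 1 - c^-1 * f x).
  by apply: An_sub => //; [have := An_const d r 1; rewrite normr1|exact: An_scale].
(* [1 - f / f 0] vanishes at the origin, so on the box scaled by [s] its majorant drops from [M1] to
   1/2, and the geometric series converges. *)
pose s := (2 * M1)^-1.
have s0 : 0 < s by rewrite invr_gt0; lra.
have s1 : s <= 1 by rewrite invf_le1; lra.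
have sr0 : nng (fun i => s * r i) by move=> i; rewrite mulr_ge0 // ltW.
have hus : An d (fun i => s * r i) 2^-1 (fun x => 1 - c^-1 * f x).
  have := An_small r0 (s := s) _ hu; rewrite (ltW s0) s1 /= => /(_ isT).
  rewrite mulVf // subrr => /(_ erefl); congr (An _ _ _ _).
  by rewrite /s invfM -mulrA mulVf ?mulr1 // gt_eqF //; lra.
have habs x : inbox d (fun i => s * r i) x -> `|1 - c^-1 * f x| <= 2^-1.
  by move=> xr; exact: An_le hus xr.
exists s, (`|c^-1| * (1 * 2)); split; first by rewrite s0.
- have : An d (fun i => s * r i) (1 * 2) (fun x => (1 - (1 - c^-1 * f x))^-1).
    apply: (@An_sum _ d _ _ _ (fun k x => (1 - c^-1 * f x) ^+ k) (fun k => 1 * 2^-1 ^+ k)) => //.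
    - by move=> k; rewrite mul1r; exact: An_exp.
    - exact: abdd_half.
    - by move=> x /habs; exact: usum_geo.
  move=> /(An_scale c^-1 sr0); apply: An_ext => x xr.
  by rewrite subKr invfM invrK mulKf.
- move=> x /habs; rewrite ler_norml => /andP[_ h].
  have : 0 < c^-1 * f x by lra.
  rewrite mulrC -(pmulr_lgt0 _ (_ : 0 < c * c)) //.
    by rewrite -mulrA mulKf // mulrC.
  by rewrite -expr2 exprn_even_gt0.
Qed.

Lemma An_raise d d' r M f : (d <= d')%N -> nng r -> An d r M f -> An d' r M f.
Proof.
move=> dd r0 hf; apply: (An_comp (g := fun i x => x i) r0 r0 hf) => i id.
by apply: An_coord => //; exact: leq_trans id dd.
Qed.

Lemma An_drop d r M f : nng r -> An d.+1 r M f -> An d r M (fun x => f (upd x d 0)).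
Proof.
move=> r0 hf; apply: (An_comp (g := fun i x => upd x d 0 i) r0 r0 hf) => i id.
rewrite /upd; case: eqP => [_|/eqP ne].
  by apply: An_monoM (An_const _ _ _); rewrite normr0.
by apply: An_coord => //; rewrite ltn_neqAle ne.
Qed.

Lemma inbox_upd d r (l : nat) x v : inbox d r x -> `|v| <= r l -> inbox d r (upd x l v).
Proof. by move=> xr vr i id; rewrite /upd; case: eqP => [->|_] //; exact: xr. Qed.

Lemma An_taylor d r M f p : nng r -> 0 < r d -> An d.+1 r M f ->
  exists (F : nat -> (nat -> R) -> R) h,
   [/\ forall k, (k < p)%N -> An d r (M / r d ^+ k) (F k), An d.+1 r (M / r d ^+ p) h &
    forall x, inbox d.+1 r x -> f x = \sum_(k < p) F k x * x d ^+ k + x d ^+ p * h x].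
Proof.
move=> r0 rd hf; elim: p => [|p [F [h [hF hh hfx]]]].
  exists (fun _ => f), f; split=> //; first by rewrite expr0 divr1.
  by move=> x _; rewrite big_ord0 expr0 mul1r add0r.
have [h' hh' hx] := An_peel r0 (ltnSn d) rd hh.
exists (fun k => if (k < p)%N then F k else fun x => h (upd x d 0)), h'; split.
- move=> k; rewrite ltnS leq_eqVlt; case: ltngtP => // [kp _|-> _]; first exact: hF.
  exact: An_drop.
- by rewrite exprSr invfM mulrA.
move=> x xr; rewrite hfx // big_ord_recr /= ltnn hx // exprSr.
under [in RHS]eq_bigr do rewrite ltn_ord.
by ring.
Qed.

Lemma dependent_choice (T : Type) (P : nat -> T -> Prop) (Q : nat -> T -> T -> Prop) (t0 : T) :
  P 0%N t0 -> (forall j t, P j t -> exists t', P j.+1 t' /\ Q j t t') ->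
  exists u : nat -> T, u 0%N = t0 /\ forall j, P j (u j) /\ Q j (u j) (u j.+1).
Proof.
move=> P0 H.
have /choice[F hF] : forall jt : nat * T, exists t', P jt.1 jt.2 ->
    P jt.1.+1 t' /\ Q jt.1 jt.2 t'.
  move=> [j t] /=; case: (pselect (P j t)) => [/H[t' ?]|nP]; first by exists t'.
  by exists t0.
pose u := fix u n := if n is n'.+1 then F (n', u n') else t0.
have Pu j : P j (u j) by elim: j => // j IH; exact: (hF (j, u j) IH).1.
by exists u; split=> // j; split=> //; exact: (hF (j, u j) (Pu j)).2.
Qed.

Lemma usum_shift (v : nat -> R) (l : R) : usum v l -> usum (fun k => v k.+1) (l - v 0%N).
Proof.
move=> h; have [M hM] := usum_abdd h.
have hM' : abdd (fun k => v k.+1) M.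
  move=> s us; have := hM (map S s); rewrite big_map map_inj_uniq ?us //; last exact: succn_inj.
  exact.
have [l' hl' _] := usum_exists hM'.
suff -> : l - v 0%N = l' by [].
have h1 : usum (fun k => if k is 0 then 0 else v k) l'.
  apply: (@usum_reindex _ nat nat S (fun k => if k is k'.+1 then Some k' else None)) => //.
  - by case.
  - by case.
have h2 : usum (fun k : nat => if k is 0 then v 0%N else 0) (v 0%N).
  by apply: (usum1 (v := fun k : nat => if k is 0 then v 0%N else 0) (i0 := 0%N)) => -[].
have h3 : usum v (l' + v 0%N).
  by apply: usum_ext (usumD h1 h2) => -[|k] /=; rewrite ?add0r ?addr0.
by rewrite (usum_unique h h3) addrK.
Qed.

Lemma usum_big (I : choiceType) (p : nat) (v : nat -> I -> R) (L : nat -> R) :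
  (forall k, (k < p)%N -> usum (v k) (L k)) ->
  usum (fun i => \sum_(k < p) v k i) (\sum_(k < p) L k).
Proof.
elim: p => [_|p IH h].
  by rewrite big_ord0; apply: usum_ext (usum0 I) => i; rewrite big_ord0.
rewrite big_ord_recr /=.
apply: usum_ext (usumD (IH (fun k kp => h k (ltnW kp))) (h p (ltnSn p))) => i.
by rewrite big_ord_recr.
Qed.

Lemma An_big d r (p : nat) (m : nat -> R) (F : nat -> (nat -> R) -> R) : nng r ->
  (forall k, (k < p)%N -> An d r (m k) (F k)) ->
  An d r (\sum_(k < p) m k) (fun x => \sum_(k < p) F k x).
Proof.
move=> r0; elim: p => [_|p IH h].
  have := An_const d r 0; rewrite normr0 big_ord0; apply: An_ext => x _; by rewrite big_ord0.
rewrite big_ord_recr /=.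
apply: An_ext (An_add r0 (IH (fun k kp => h k (ltnW kp))) (h p (ltnSn p))) => x _.
by rewrite big_ord_recr.
Qed.

(** With [phi] the quotient of the lower terms by [h], [f / h] is [x d ^+ p + phi]. A factor [s]
    that turns this into a monic polynomial in [x d] is the sum of the [S j], where [S 0 = 1] and
    [S j.+1] is minus the quotient of [S j * phi] by [x d ^+ p]: the sum telescopes to [s * phi =
    remainders - x d ^+ p * (s - 1)]. Multiplication by [h 0] fixes the sign of the unit. *)
Lemma weierstrass d r M (m : nat -> R) f p (F : nat -> (nat -> R) -> R) h :
  (forall i, 0 < r i) -> (forall k, (k < p)%N -> An d r (m k) (F k)) ->
  (forall k, (k < p)%N -> F k (fun=> 0) = 0) -> An d.+1 r M h -> h (fun=> 0) != 0 ->
  (forall x, inbox d.+1 r x -> f x = \sum_(k < p) F k x * x d ^+ k + x d ^+ p * h x) ->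
  exists r' (b : nat -> (nat -> R) -> R), [/\ forall i, 0 < r' i <= r i,
    forall k, (k < p)%N -> exists m', An d r' m' (b k) &
    forall x, inbox d.+1 r' x -> exists2 u, 0 < u &
      f x * h (fun=> 0) = u * (x d ^+ p + \sum_(k < p) b k x * x d ^+ k)].
Proof.
move=> rpos hF F0 hh h0 hf.
have r0 : nng r by move=> i; rewrite ltW.
have [s1 [M1 [/andP[s10 s11] hinv hsgn]]] := An_inv r0 hh h0.
pose r1 i := s1 * r i.
have r1pos i : 0 < r1 i by rewrite mulr_gt0.
have r10 : nng r1 by move=> i; rewrite ltW.
have r1r i : r1 i <= r i by rewrite ler_piMl // ltW.
pose rd := r1 d; have rd0 : 0 < rd by exact: r1pos.
pose B := (\sum_(k < p) m k * rd ^+ k) * M1.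
have m0 k : (k < p)%N -> 0 <= m k by move=> /hF /An_ge0.
have B0 : 0 <= B.
  apply: mulr_ge0; last exact: An_ge0 hinv.
  by apply: sumr_ge0 => k _; rewrite mulr_ge0 ?m0 // exprn_ge0 // ltW.
(* The [F k] vanish at the origin, so shrinking only the first [d] coordinates by [s2] brings the
   majorant of [phi] below [rd ^+ p / 4]. As the radius [rd] is kept, division by [x d ^+ p] costs
   [rd ^+ p], and each step of the iteration gains a factor 1/4. *)
pose s2 := Num.min 1 (rd ^+ p / 4 / (B + 1)).
have B1 : 0 < B + 1 by lra.
have s20 : 0 < s2 by rewrite lt_min ltr01 !divr_gt0 ?exprn_gt0.
have s21 : s2 <= 1 by rewrite ge_min lexx.
have s2B : s2 * B <= rd ^+ p / 4.
  apply: (@le_trans _ _ (rd ^+ p / 4 / (B + 1) * (B + 1))); last by rewrite divfK // gt_eqF.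
  by apply: ler_pM => //; [exact: ltW|rewrite ge_min lexx orbT|lra].
pose r2 i := if (i < d)%N then s2 * r1 i else r1 i.
have r2pos i : 0 < r2 i by rewrite /r2; case: ifP => // _; rewrite mulr_gt0.
have r20 : nng r2 by move=> i; rewrite ltW.
have r2r1 i : r2 i <= r1 i by rewrite /r2; case: ifP => // _; rewrite ler_piMl // ltW.
have r2d : r2 d = rd by rewrite /r2 ltnn.
have F2 k : (k < p)%N -> An d r2 (s2 * m k) (F k).
  move=> kp; have /(An_small r10 (s := s2)) : An d r1 (m k) (F k).
    by apply: An_shrink (hF k kp).
  rewrite (ltW s20) s21 => /(_ isT (F0 k kp)); apply: An_shrink => // i id.
  by rewrite /r2 id.
pose phi x := (\sum_(k < p) F k x * x d ^+ k) * (h x)^-1.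
have hphi : An d.+1 r2 (rd ^+ p / 4) phi.
  have h1 : An d.+1 r2 (\sum_(k < p) s2 * m k * rd ^+ k) (fun x => \sum_(k < p) F k x * x d ^+ k).
    apply: (An_big (m := fun k => s2 * m k * rd ^+ k) (F := fun k x => F k x * x d ^+ k)) => //.
    move=> k kp; apply: An_mul => //; first by apply: An_raise (F2 k kp).
    by rewrite -r2d; apply: An_exp => //; exact: An_coord.
  have h2 : An d.+1 r2 M1 (fun x => (h x)^-1) by apply: An_shrink hinv.
  apply: An_monoM (An_mul r20 h1 h2).
  suff -> : (\sum_(k < p) s2 * m k * rd ^+ k) * M1 = s2 * B by [].
  by rewrite /B mulrA mulr_sumr; congr (_ * _); apply: eq_bigr => k _; rewrite mulrA.
pose P j (g : (nat -> R) -> R) := An d.+1 r2 (4^-1 ^+ j) g.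
pose Q j (g g' : (nat -> R) -> R) := exists b : nat -> (nat -> R) -> R,
  (forall k, (k < p)%N -> An d r2 (4^-1 ^+ j * (rd ^+ p / 4) / rd ^+ k) (b k)) /\
  forall x, inbox d.+1 r2 x -> g x * phi x =
    \sum_(k < p) b k x * x d ^+ k - x d ^+ p * g' x.
have [S [S0 hS]] : exists u : nat -> (nat -> R) -> R, u 0%N = (fun=> 1) /\
    forall j, P j (u j) /\ Q j (u j) (u j.+1).
  apply: dependent_choice => [|j g Pg].
    by rewrite /P expr0; have := An_const d.+1 r2 1; rewrite normr1.
  have gphi := An_mul r20 Pg hphi.
  have [b [g' [hb hg' E]]] := @An_taylor d _ _ _ p r20 (r2pos d) gphi.
  exists (fun x => - 1 * g' x); split.
    have := An_scale (-1) r20 hg'; rewrite normrN1 mul1r; apply: An_monoM.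
    rewrite r2d -mulrA mulrAC mulfV ?mul1r; last by rewrite gt_eqF // exprn_gt0.
    by rewrite exprSr.
  exists b; split=> [k kp|x xr]; first by have := hb k kp; rewrite r2d.
  by rewrite E // mulN1r mulrN opprK.
have [b hb] := choice (fun j => (hS j).2).
have le42 j : (4^-1 : R) ^+ j <= 2^-1 ^+ j.
  by apply: lerXn2r; rewrite ?nnegrE ?invr_ge0 //; lra.
have p4 j : 0 <= (4^-1 : R) ^+ j by rewrite exprn_ge0 ?invr_ge0.
have p2 j : 0 <= (2^-1 : R) ^+ j by rewrite exprn_ge0 ?invr_ge0.
have ab : abdd (fun j : nat => 4^-1 ^+ j : R) (1 * 2).
  by apply: abdd_le (abdd_half ler01) => j; rewrite mul1r !ger0_norm.
have [s [sA hs]] := An_series r20 (fun j => (hS j).1) ab.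
have /choice[bb hbb] : forall k, exists bk : (nat -> R) -> R, (k < p)%N ->
    (exists m', An d r2 m' bk) /\
    forall x, inbox d r2 x -> usum (fun j => b j k x) (bk x).
  move=> k; case: (ltnP k p) => [kp|]; last by exists (fun=> 0).
  pose C := rd ^+ p / 4 / rd ^+ k.
  have C0 : 0 <= C by rewrite !divr_ge0 ?exprn_ge0 // ltW.
  have hbk j : An d r2 (4^-1 ^+ j * C) (b j k) by rewrite /C mulrA; apply: (hb j).1.
  have aC : abdd (fun j : nat => 4^-1 ^+ j * C) (C * 2).
    apply: abdd_le (abdd_half C0) => j; rewrite (ger0_norm (mulr_ge0 (p4 j) C0)).
    by rewrite (ger0_norm (mulr_ge0 C0 (p2 j))) mulrC ler_wpM2l.
  by have [bk [bA bu]] := An_series r20 hbk aC; exists bk => _; split=> //; exists (C * 2).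
exists r2, bb; split.
- by move=> i; rewrite r2pos (le_trans (r2r1 i)).
- by move=> k kp; have [] := hbb k kp.
move=> x xr.
have xrd : inbox d r2 x by move=> i id; apply: xr; exact: ltnW.
have xr1 : inbox d.+1 r1 x by move=> i id; apply: le_trans (xr i id) _.
have hsh := usum_shift (hs x xr); rewrite S0 in hsh.
have E1 : s x * phi x = \sum_(k < p) bb k x * x d ^+ k - x d ^+ p * (s x - 1).
  have u1 := usumZ (phi x) (hs x xr).
  have u2 : usum (fun j => \sum_(k < p) x d ^+ k * b j k x) (\sum_(k < p) x d ^+ k * bb k x).
    apply: (usum_big (v := fun k j => x d ^+ k * b j k x) (L := fun k => x d ^+ k * bb k x)) => k kp.
    by apply: usumZ; exact: (hbb k kp).2.
  have u3 := usumD u2 (usumZ (- x d ^+ p) hsh).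
  have u4 := usum_ext (w := fun j => phi x * S j x) _ u3.
  rewrite mulrC (usum_unique u1 (u4 _)) => [|j /=].
    by rewrite mulNr; congr (_ - _); apply: eq_bigr => k _; rewrite mulrC.
  rewrite [RHS]mulrC (hb j).2 // mulNr; congr (_ - _).
  by apply: eq_bigr => k _; rewrite mulrC.
(* The terms after [S 0 = 1] add up to at most 1/2, so [s x] is positive and can be moved into the
   unit. *)
have s_near : `|s x - 1| <= 4^-1 * 2.
  apply: abdd_usum_le hsh; apply: abdd_le (abdd_half _) => [j|]; last by rewrite invr_ge0.
  apply: le_trans (An_le (hS j.+1).1 xr) _; rewrite exprS ger0_norm ?mulr_ge0 ?invr_ge0 //.
  by rewrite ler_wpM2l ?invr_ge0.
have sx0 : 0 < s x by move: s_near; rewrite ler_norml => /andP[? ?]; lra.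
have hx0 := hsgn x xr1.
have hxn : h x != 0 by apply: contraTneq hx0 => ->; rewrite mul0r ltxx.
exists (h x * h (fun=> 0) / s x); first exact: divr_gt0.
have -> : x d ^+ p + \sum_(k < p) bb k x * x d ^+ k = s x * (phi x + x d ^+ p).
  rewrite mulrDr E1; set T := \sum_(_ < p) _; ring.
rewrite hf; last by move=> i id; apply: le_trans (xr1 i id) _.
by rewrite /phi; set L := \sum_(_ < p) _; field; rewrite hxn gt_eqF.
Qed.

End Weierstrass.

(** * Analytic germs *)

Section AnalyticGerms.
Context {R : realType}.
Implicit Types (d : nat) (p q r x y : nat -> R) (M : R) (f g h : (nat -> R) -> R).

Definition close d (e : R) p q := forall i, (i < d)%N -> `|q i - p i| < e.

Definition nearp d p (P : (nat -> R) -> Prop) :=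
  exists2 e : R, 0 < e & forall q, close d e p q -> P q.

(** The box constrains the first [d] coordinates only, so such an [f] depends on these alone near
    [p]; [ana_congr] extracts this. *)
Definition ana d f p := exists s M : R, 0 < s /\
  An d (fun=> s) M (fun x => f (fun i => p i + x i)).

Lemma close_refl d e p : 0 < e -> close d e p p.
Proof. by move=> e0 i _; rewrite subrr normr0. Qed.

Lemma close_le d e e' p q : e <= e' -> close d e p q -> close d e' p q.
Proof. by move=> ee h i id; apply: lt_le_trans (h i id) ee. Qed.

Lemma close_sub d d' e p q : (d <= d')%N -> close d' e p q -> close d e p q.
Proof. by move=> dd h i id; apply: h; exact: leq_trans id dd. Qed.

Lemma close_upd d e p q (l : nat) v : close d e p q -> `|v - p l| < e -> close d e p (upd q l v).
Proof. by move=> h hv i id; rewrite /upd; case: eqP => [->|_] //; exact: h. Qed.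

Lemma nearp_self d p P : nearp d p P -> P p.
Proof. by move=> [e e0]; apply; exact: close_refl. Qed.

Lemma nearp_mono d p (P Q : (nat -> R) -> Prop) :
  (forall q, P q -> Q q) -> nearp d p P -> nearp d p Q.
Proof. by move=> PQ [e e0 h]; exists e => // q /h /PQ. Qed.

Lemma nearp_and d p (P Q : (nat -> R) -> Prop) :
  nearp d p P -> nearp d p Q -> nearp d p (fun q => P q /\ Q q).
Proof.
move=> [e e0 h] [e' e0' h']; exists (Num.min e e'); first by rewrite lt_min e0.
by move=> q hq; split; [apply: h|apply: h']; apply: close_le hq; rewrite ge_min lexx ?orbT.
Qed.

Lemma fin_common (m : nat) (P : nat -> R -> Prop) :
  (forall i (e e' : R), 0 < e' <= e -> P i e -> P i e') ->
  (forall i, (i < m)%N -> exists2 e : R, 0 < e & P i e) ->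
  exists2 e : R, 0 < e & forall i, (i < m)%N -> P i e.
Proof.
move=> mono; elim: m => [_|m IH h]; first by exists 1.
have [e e0 he] := IH (fun i im => h i (ltnW im)).
have [e' e0' he'] := h m (ltnSn m).
have e2 : 0 < Num.min e e' by rewrite lt_min e0.
exists (Num.min e e') => // i; rewrite ltnS leq_eqVlt => /orP[/eqP ->|im].
  by apply: mono he'; rewrite e2 ge_min lexx orbT.
by apply: mono (he i im); rewrite e2 ge_min lexx.
Qed.

Lemma nearp_all d p (m : nat) (P : nat -> (nat -> R) -> Prop) :
  (forall i, (i < m)%N -> nearp d p (P i)) ->
  nearp d p (fun q => forall i, (i < m)%N -> P i q).
Proof.
move=> h; have [e e0 he] := @fin_common m (fun i e => forall q, close d e p q -> P i q)
  (fun i e e' ee hP q hq => hP q (close_le (proj2 (andP ee)) hq)) h.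
by exists e => // q hq i im; exact: he.
Qed.

Lemma nearp_sub d d' p P : (d <= d')%N -> nearp d p P -> nearp d' p P.
Proof. by move=> dd [e e0 h]; exists e => // q hq; apply: h; exact: close_sub hq. Qed.

Lemma ana_shrink d f p : ana d f p ->
  exists2 s : R, 0 < s & forall s' : R, 0 < s' <= s ->
    exists M, An d (fun=> s') M (fun x => f (fun i => p i + x i)).
Proof.
move=> [s [M [s0 h]]]; exists s => // s' /andP[s0' ss]; exists M.
by apply: An_shrink h => // i; exact: ltW.
Qed.

Lemma ana_of_An d r M f p : nng r -> An d r M f -> (forall i, (i < d)%N -> `|p i| < r i) ->
  ana d f p.
Proof.
move=> r0 hf pr.
have [s s0 hs] : exists2 s : R, 0 < s & forall i, (i < d)%N -> `|p i| + s <= r i.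
  apply: (@fin_common d (fun i s => `|p i| + s <= r i)).
    by move=> i e e' /andP[_ ?]; apply: le_trans; rewrite lerD2l.
  by move=> i /pr h; exists (r i - `|p i|); [rewrite subr_gt0|rewrite addrC subrK].
exists s, M; split=> //; have snn : nng (fun=> s) by move=> i; exact: ltW.
apply: (An_comp (g := fun i x => p i + x i) r0 snn hf) => i id.
apply: An_monoM (hs i id) _; apply: An_add => //; first exact: An_const.
by have := An_coord id snn.
Qed.

Lemma ana_near d f p : ana d f p -> nearp d p (ana d f).
Proof.
move=> [s [M [s0 h]]]; exists s => // q hq.
have [|s' [M' [s0' h']]] := ana_of_An (p := fun i => q i - p i) _ h hq.
  by move=> i; exact: ltW.
exists s', M'; split=> //; apply: An_ext h' => x _; congr f.
by apply/funext => i; ring.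
Qed.

Lemma ana_const d c p : ana d (fun=> c) p.
Proof. by exists 1, `|c|; split=> //; exact: An_const. Qed.

Lemma ana_coord d (l : nat) p : (l < d)%N -> ana d (fun x => x l) p.
Proof.
move=> ld; exists 1, (`|p l| + 1); split=> //.
have n1 : nng (fun _ : nat => 1 : R) by move=> i.
by apply: An_add => //; [exact: An_const|have := An_coord ld n1].
Qed.

Lemma ana_op2 d f g p (op : R -> R -> R) :
  (forall r M M' f g, nng r -> An d r M f -> An d r M' g ->
     exists M'', An d r M'' (fun x => op (f x) (g x))) ->
  ana d f p -> ana d g p -> ana d (fun x => op (f x) (g x)) p.
Proof.
move=> hop /ana_shrink[s s0 hs] /ana_shrink[s' s0' hs'].
have m0 : 0 < Num.min s s' by rewrite lt_min s0.
have [M hM] := hs (Num.min s s') ltac:(by rewrite m0 ge_min lexx).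
have [M' hM'] := hs' (Num.min s s') ltac:(by rewrite m0 ge_min lexx orbT).
have nn : nng (fun _ : nat => Num.min s s') by move=> i; exact: ltW.
have [M'' h] := hop _ _ _ _ _ nn hM hM'.
by exists (Num.min s s'), M''.
Qed.

Lemma anaD d f g p : ana d f p -> ana d g p -> ana d (fun x => f x + g x) p.
Proof. by apply: (ana_op2 (op := +%R)) => r M M' *; exists (M + M'); exact: An_add. Qed.

Lemma anaB d f g p : ana d f p -> ana d g p -> ana d (fun x => f x - g x) p.
Proof. by apply: (ana_op2 (op := fun u v => u - v)) => r M M' *; exists (M + M'); exact: An_sub. Qed.

Lemma anaM d f g p : ana d f p -> ana d g p -> ana d (fun x => f x * g x) p.
Proof. by apply: (ana_op2 (op := *%R)) => r M M' *; exists (M * M'); exact: An_mul. Qed.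

Lemma anaX d f p n : ana d f p -> ana d (fun x => f x ^+ n) p.
Proof.
move=> hf; elim: n => [|n IH]; first exact: ana_const.
by under [X in ana d X]funext do rewrite exprS; exact: anaM.
Qed.

Lemma ana_sum d (m : nat) (F : nat -> (nat -> R) -> R) p :
  (forall k, (k < m)%N -> ana d (F k) p) -> ana d (fun x => \sum_(k < m) F k x) p.
Proof.
elim: m => [_|m IH h].
  by under [X in ana d X]funext do rewrite big_ord0; exact: ana_const.
under [X in ana d X]funext do rewrite big_ord_recr /=.
by apply: anaD; [apply: IH => k km; apply: h; exact: ltnW|exact: h].
Qed.

Lemma ana_prod d (m : nat) (F : nat -> (nat -> R) -> R) p :
  (forall k, (k < m)%N -> ana d (F k) p) -> ana d (fun x => \prod_(k < m) F k x) p.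
Proof.
elim: m => [_|m IH h].
  by under [X in ana d X]funext do rewrite big_ord0; exact: ana_const.
under [X in ana d X]funext do rewrite big_ord_recr /=.
by apply: anaM; [apply: IH => k km; apply: h; exact: ltnW|exact: h].
Qed.

Lemma ana_comp d e f (g : nat -> (nat -> R) -> R) p :
  ana d f (fun i => g i p) -> (forall i, (i < d)%N -> ana e (g i) p) ->
  ana e (fun x => f (fun i => g i x)) p.
Proof.
move=> [s [M [s0 hf]]] hg.
have p0 : p = (fun i => p i + 0) by apply/funext => i; rewrite addr0.
have [t t0 ht] : exists2 t : R, 0 < t & forall i, (i < d)%N ->
    An e (fun=> t) s (fun x => g i (fun j => p j + x j) - g i p).
  apply: (@fin_common d (fun i t => An e (fun=> t) s (fun x => g i (fun j => p j + x j) - g i p))).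
    move=> i t t' /andP[t0 tt] h; apply: An_shrink h => // j; exact: ltW.
  move=> i /hg [t [N [t0 hN]]].
  have tn : nng (fun _ : nat => t) by move=> j; exact: ltW.
  have hd := An_sub tn hN (An_const e (fun=> t) (g i p)).
  set B := N + _ in hd; have B0 : 0 <= B := An_ge0 hd.
  (* On the box scaled by [c], [An_small] brings the majorant of [g i - g i p] below the radius [s]
     of the box of [f], as [An_comp] requires. *)
  pose c := Num.min 1 (s / (B + 1)).
  have B1 : 0 < B + 1 by lra.
  have c0 : 0 < c by rewrite lt_min ltr01 divr_gt0.
  exists (c * t); first exact: mulr_gt0.
  have := An_small tn (s := c) _ hd; rewrite (ltW c0) ge_min lexx => /(_ isT).
  have -> : (fun j => p j + 0) = p by [].
  rewrite subrr => /(_ erefl); apply: An_monoM.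
  apply: (@le_trans _ _ (s / (B + 1) * (B + 1))); last by rewrite divfK // gt_eqF.
  by apply: ler_pM => //; [exact: ltW|rewrite ge_min lexx orbT|lra].
exists t, M; split=> //.
have sn : nng (fun _ : nat => s) by move=> j; exact: ltW.
have tn : nng (fun _ : nat => t) by move=> j; exact: ltW.
apply: An_ext (An_comp sn tn hf ht) => x _; congr f.
by apply/funext => i; ring.
Qed.

Lemma ana_raise d d' f p : (d <= d')%N -> ana d f p -> ana d' f p.
Proof.
move=> dd hf; apply: (@ana_comp d d' f (fun i x => x i)) => // i id.
by apply: ana_coord; exact: leq_trans id dd.
Qed.

(** Recentred at [q] the increment vanishes at the origin, so [An_small] makes its majorant
    proportional to [e]. For [e] beyond half the radius the sup bound on both values is enough. *)
Lemma ana_lipschitz d f p : ana d f p -> exists C s : R, [/\ 0 <= C, 0 < s &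
  forall q q' (e : R), close d s p q -> close d s p q' ->
    (forall i, (i < d)%N -> `|q' i - q i| <= e) -> 0 <= e -> `|f q' - f q| <= C * e].
Proof.
move=> [s [M [s0 hf]]].
have M0 := An_ge0 hf.
have s2 : 0 < s / 2 by rewrite divr_gt0.
have sn : nng (fun _ : nat => s) by move=> j; exact: ltW.
exists (4 * M / s), (s / 2); split=> // [|q q' e hq hq' hqq e0].
  by rewrite divr_ge0 ?mulr_ge0 // ltW.
pose F x := f (fun i => p i + x i).
have fE x : f x = F (fun i => x i - p i) by congr f; apply/funext => i; ring.
have inb x : close d (s / 2) p x -> inbox d (fun=> s) (fun i => x i - p i).
  by move=> hx i id; apply: le_trans (ltW (hx i id)) _; lra.
have CE : 4 * M / s * e = 2 * M * (e / (s / 2)) by field; rewrite gt_eqF.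
have [es|se] := leP e (s / 2); last first.
  rewrite !fE; apply: le_trans (ler_normB _ _) _.
  have := An_le hf (inb _ hq); have := An_le hf (inb _ hq'); rewrite -/(F _) -/(F _).
  move=> a b; apply: (@le_trans _ _ (2 * M)); first lra.
  rewrite -[X in X <= _]mulr1 CE; apply: ler_wpM2l; first by rewrite mulr_ge0.
  by rewrite ler_pdivlMr // mul1r ltW.
have tn : nng (fun _ : nat => s / 2) by move=> j; exact: ltW.
have hG : An d (fun=> s / 2) M (fun x => F (fun i => (q i - p i) + x i)).
  apply: (An_comp (g := fun i x => (q i - p i) + x i) sn tn hf) => i id.
  apply: An_monoM (_ : `|q i - p i| + s / 2 <= _) _; first by have := hq i id; lra.
  by apply: An_add => //; [exact: An_const|have := An_coord id tn].
have hd := An_sub tn hG (An_const d (fun=> s / 2) (f q)).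
have fqM : `|f q| <= M by rewrite fE; exact: An_le hf (inb _ hq).
have := An_small tn (s := e / (s / 2)) _ (An_monoM (_ : _ <= M + M) hd).
rewrite divr_ge0 ?(ltW s2) //= ler_pdivrMr // mul1r => /(_ es) /=.
rewrite lerD2l => /(_ fqM).
have -> : F (fun i => q i - p i + 0) = f q by rewrite fE; congr F; apply/funext => i; rewrite addr0.
rewrite subrr => /(_ erefl) hs.
have -> : f q' - f q = F (fun i => (q i - p i) + (q' i - q i)) - f q.
  by rewrite fE; congr (F _ - _); apply/funext => i; ring.
have := An_le (x := fun i => q' i - q i) hs; rewrite divfK ?gt_eqF // => /(_ hqq).
move=> hb; rewrite CE; apply: le_trans hb _.
rewrite (_ : 2 * M = M + M); last by lra.
by rewrite mulrC.
Qed.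

End AnalyticGerms.

(** * Identity theorem, implicit functions and partial derivatives *)

Section LocalAnalysis.
Context {R : realType}.
Implicit Types (d : nat) (p q x y : nat -> R) (M : R) (f g h : (nat -> R) -> R).

Lemma ana_cont d f p (e : R) : ana d f p -> 0 < e -> nearp d p (fun q => `|f q - f p| < e).
Proof.
move=> /ana_lipschitz[C [s [C0 s0 h]]] e0.
have C1 : 0 < C + 1 by lra.
exists (Num.min s (e / (C + 1))); first by rewrite lt_min s0 divr_gt0.
move=> q hq; have a : close d s p q by apply: close_le hq; rewrite ge_min lexx.
apply: (@le_lt_trans _ _ (C * (e / (C + 1)))).
  apply: h => //; [exact: close_refl| |by rewrite divr_ge0 // ltW].
  by move=> i /hq /ltW /le_trans; apply; rewrite ge_min lexx orbT.
by rewrite mulrA ltr_pdivrMr // mulrC ltr_pM2l //; lra.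
Qed.

Lemma ana_gt0 d f p : ana d f p -> 0 < f p -> nearp d p (fun q => 0 < f q).
Proof.
move=> hf fp; apply: nearp_mono (ana_cont hf fp) => q.
by rewrite ltr_norml => /andP[? _]; lra.
Qed.

Lemma ana_neq0 d f p : ana d f p -> f p != 0 -> nearp d p (fun q => f q != 0).
Proof.
move=> hf fp; have fp0 : 0 < `|f p| by rewrite normr_gt0.
apply: nearp_mono (ana_cont hf fp0) => q; apply: contraTneq => ->.
by rewrite sub0r normrN ltxx.
Qed.

Lemma An_congr d r M f x y : An d r M f -> inbox d r x ->
  (forall i, (i < d)%N -> x i = y i) -> f x = f y.
Proof.
move=> [c [a [_ E]]] xr xy.
have yr : inbox d r y by move=> i id; rewrite -xy //; exact: xr.
apply: usum_unique (E x xr) _; apply: usum_ext (E y yr) => k /=; congr (_ * _).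
by apply: eq_bigr => j _; rewrite xy.
Qed.

(** Regularity of order [k] in the last variable, in the form in which repeated use of [An_peel]
    produces it and [weierstrass] consumes it. *)
Definition regular d r f (k : nat) := exists (F : nat -> (nat -> R) -> R) h,
  [/\ forall i, (i < k)%N -> exists m, An d r m (F i),
      forall i, (i < k)%N -> F i (fun=> 0) = 0,
      (exists m, An d.+1 r m h), h (fun=> 0) != 0 &
      forall x, inbox d.+1 r x -> f x = \sum_(i < k) F i x * x d ^+ i + x d ^+ k * h x].

(** If no order is ever reached, powers of the last variable can be peeled off for ever with
    majorants [M / r d ^+ N]. On the axis this gives [|f| <= M * (|t| / r d) ^+ N] for every [N]. *)
Lemma regular_or_zero d r M f : (forall i, 0 < r i) -> An d.+1 r M f ->
  (exists k, regular d r f k) \/ forall t, `|t| < r d -> f (upd (fun=> 0) d t) = 0.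
Proof.
move=> rpos hf; have r0 : nng r by move=> i; rewrite ltW.
case: (pselect (exists k, regular d r f k)) => [|nreg]; [by left|right].
have H k : exists (F : nat -> (nat -> R) -> R) h,
   [/\ forall i, (i < k)%N -> exists m, An d r m (F i),
      forall i, (i < k)%N -> F i (fun=> 0) = 0, An d.+1 r (M / r d ^+ k) h &
      forall x, inbox d.+1 r x -> f x = \sum_(i < k) F i x * x d ^+ i + x d ^+ k * h x].
  elim: k => [|k [F [h [hF F0 hh hx]]]].
    exists (fun _ => f), f; split=> //; first by rewrite expr0 divr1.
    by move=> x _; rewrite big_ord0 expr0 mul1r add0r.
  have h0 : h (fun=> 0) = 0.
    apply/eqP; apply/negPn/negP => h0; apply: nreg; exists k, F, h; split=> //.
    by exists (M / r d ^+ k).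
  have [h' hh' hx'] := An_peel r0 (ltnSn d) (rpos d) hh.
  exists (fun i => if (i < k)%N then F i else fun x => h (upd x d 0)), h'; split.
  - move=> i; rewrite ltnS leq_eqVlt; case: ltngtP => // [ik _|_ _]; first exact: hF.
    by exists (M / r d ^+ k); exact: An_drop.
  - move=> i; rewrite ltnS leq_eqVlt; case: ltngtP => // [ik _|_ _]; first exact: F0.
    by rewrite -[RHS]h0; congr h; apply/funext => j; rewrite /upd; case: eqP.
  - by rewrite exprSr invfM mulrA.
  move=> x xr; rewrite hx // big_ord_recr /= ltnn hx' // exprSr.
  under [in RHS]eq_bigr do rewrite ltn_ord.
  by ring.
move=> t ht; apply: lt_eps_eq0 => e e0.
have M0 := An_ge0 hf; have M1 : 0 < M + 1 by lra.
have q0 : 0 <= `|t| / r d by rewrite divr_ge0.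
have q1 : `|t| / r d < 1 by rewrite ltr_pdivrMr // mul1r.
have [N hN] := expr_lt_eps q0 q1 (divr_gt0 e0 M1).
have [F [h [hF F0 hh hx]]] := H N.
have xr : inbox d.+1 r (upd (fun=> 0) d t).
  apply: inbox_upd; first by move=> i _; rewrite normr0.
  exact: ltW.
rewrite hx // big1 => [|i _]; last first.
  have [m hm] := hF i (ltn_ord i).
  have z : inbox d r (fun=> 0) by move=> j _; rewrite normr0.
  rewrite -(An_congr (y := upd (fun=> 0) d t) hm z) ?F0 ?mul0r // => j jd.
  by rewrite /upd ltn_eqF.
have hb := An_le hh xr.
rewrite add0r /upd eqxx normrM normrX.
apply: (@le_lt_trans _ _ (`|t| ^+ N * (M / r d ^+ N))).
  by rewrite ler_wpM2l // exprn_ge0.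
have rN : r d ^+ N != 0 by rewrite expf_neq0 // gt_eqF.
have -> : `|t| ^+ N * (M / r d ^+ N) = (`|t| / r d) ^+ N * M.
  by rewrite expr_div_n; field.
apply: (@le_lt_trans _ _ ((`|t| / r d) ^+ N * (M + 1))).
  by rewrite ler_wpM2l ?exprn_ge0 // lerDl.
by rewrite -ltr_pdivlMr.
Qed.

Lemma regular_line d r f k : (forall i, 0 < r i) -> regular d r f k ->
  exists2 e : R, 0 < e & forall t, 0 < `|t| < e -> f (upd (fun=> 0) d t) != 0.
Proof.
move=> rpos [F [h [hF F0 [m hh] h0 hx]]].
have r0 : nng r by move=> i; rewrite ltW.
have ha : ana d.+1 h (fun=> 0) by apply: (ana_of_An r0 hh) => i _; rewrite normr0.
have [e e0 he] := ana_neq0 ha h0.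
exists (Num.min e (r d)); first by rewrite lt_min e0 rpos.
move=> t /andP[t0]; rewrite lt_min => /andP[te tr].
have xr : inbox d.+1 r (upd (fun=> 0) d t).
  by apply: inbox_upd; [move=> i _; rewrite normr0|exact: ltW].
rewrite hx // big1 => [|i _]; last first.
  have [n hn] := hF i (ltn_ord i).
  have z : inbox d r (fun=> 0) by move=> j _; rewrite normr0.
  rewrite -(An_congr (y := upd (fun=> 0) d t) hn z) ?F0 ?mul0r // => j jd.
  by rewrite /upd ltn_eqF.
rewrite add0r mulf_neq0 //; first by rewrite expf_neq0 // /upd eqxx -normr_gt0.
by apply: he; apply: close_upd; [exact: close_refl|rewrite subr0].
Qed.

(** The identity theorem on a line; [ana_line] transports it to several variables. *)
Lemma line_dichotomy (G : R -> R) (s M : R) : 0 < s -> An 1 (fun=> s) M (fun x => G (x 0%N)) ->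
  (forall t, `|t| < s -> G t = 0) \/
  (exists2 e : R, 0 < e & forall t, 0 < `|t| < e -> G t != 0).
Proof.
move=> s0 hG; have sp (i : nat) : 0 < (fun _ : nat => s) i by [].
have [[k hk]|h] := regular_or_zero sp hG; [right|left].
  have [e e0 he] := regular_line sp hk; exists e => // t /he; by rewrite /upd eqxx.
by move=> t /h; rewrite /upd eqxx.
Qed.

Lemma ana_line d f s M p q v (T : R) : 0 < T ->
  An d (fun=> s) M (fun x => f (fun i => p i + x i)) -> 0 < s ->
  (forall i, (i < d)%N -> `|q i - p i| + T * `|v i| <= s) ->
  An 1 (fun=> T) M (fun x => f (fun i => q i + x 0%N * v i)).
Proof.
move=> T0 hf s0 hv.
have sn : nng (fun _ : nat => s) by move=> j; exact: ltW.
have tn : nng (fun _ : nat => T) by move=> j; exact: ltW.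
apply: An_ext (An_comp (g := fun i x => (q i - p i) + v i * x 0%N) sn tn hf _) => [x _|i id].
  by congr f; apply/funext => i; ring.
apply: An_monoM (hv i id) _; apply: An_add => //; first exact: An_const.
rewrite mulrC; apply: An_scale => //; have := An_coord (ltn0Sn 0) tn; exact.
Qed.

Lemma not_nearp d p P : ~ nearp d p P -> forall e : R, 0 < e -> exists2 q, close d e p q & ~ P q.
Proof.
move=> h e e0; apply: contrapT => h'; apply: h; exists e => // q hq.
by apply: contrapT => nP; apply: h'; exists q.
Qed.

(** On the line from a point where [f] is nonzero to a point where [g] is nonzero, neither function
    vanishes identically. Both are then nonzero at all small positive times, in particular at one
    between the two points. *)
Lemma ana_mul_neq0 d f g p : ana d f p -> ana d g p ->
  ~ nearp d p (fun q => f q = 0) -> ~ nearp d p (fun q => g q = 0) ->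
  ~ nearp d p (fun q => f q * g q = 0).
Proof.
move=> /ana_shrink[s s0 hs] /ana_shrink[s' s0' hs'] nf ng [e e0 he].
pose t := Num.min s s'.
have t0 : 0 < t by rewrite lt_min s0.
have [M hM] := hs t ltac:(by rewrite t0 ge_min lexx).
have [M' hM'] := hs' t ltac:(by rewrite t0 ge_min lexx orbT).
(* The line has to stay in the box beyond time 1, here up to time 3: [1/8 + 3 * 2/8 < 1]. *)
pose u := Num.min e (t / 8).
have u0 : 0 < u by rewrite lt_min e0 divr_gt0.
have [q hq fq] := not_nearp nf u0; have [q' hq' gq] := not_nearp ng u0.
pose v i := q' i - q i.
have hv i : (i < d)%N -> `|q i - p i| + 3 * `|v i| <= t.
  move=> id; have ut : u <= t / 8 by rewrite ge_min lexx orbT.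
  have a := hq i id; have b := hq' i id.
  have : `|v i| <= `|q' i - p i| + `|q i - p i|.
    by apply: le_trans (ler_normB _ _); rewrite /v le_eqVlt; apply/orP; left;
      apply/eqP; congr `|_|; ring.
  lra.
have T0 : 0 < 3 :> R by [].
have [z|[e1 e10 h1]] := line_dichotomy (G := fun t => f (fun i => q i + t * v i)) T0 (ana_line T0 hM t0 hv).
  apply: fq; have := z 0; rewrite normr0 => <-; last by lra.
  by congr f; apply/funext => i; rewrite mul0r addr0.
have [z|[e2 e20 h2]] := line_dichotomy (G := fun t => g (fun i => q i + t * v i)) T0 (ana_line T0 hM' t0 hv).
  apply: gq; have := z 1; rewrite normr1 => <-; last by lra.
  by congr g; apply/funext => i; rewrite /v; ring.
pose w := Num.min 1 (Num.min e1 e2) / 2.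
have m0 : 0 < Num.min 1 (Num.min e1 e2) by rewrite !lt_min ltr01 e10.
have w0 : 0 < w by rewrite divr_gt0.
have [w1 we1 we2] : [/\ w < 1, w < e1 & w < e2].
  have : w < Num.min 1 (Num.min e1 e2) by rewrite /w; lra.
  by rewrite !lt_min => /and3P.
clearbody w.
suff cl : close d e p (fun i => q i + w * v i).
  have /eqP := he _ cl; rewrite mulf_eq0 => /orP[]; apply/negP; [apply: h1|apply: h2];
    by rewrite gtr0_norm ?w0.
move=> i id.
have -> : q i + w * v i - p i = (1 - w) * (q i - p i) + w * (q' i - p i) by rewrite /v; ring.
have ue : u <= e by rewrite ge_min lexx.
have a := hq i id; have b := hq' i id.
apply: le_lt_trans (ler_normD _ _) _; rewrite !normrM (gtr0_norm w0) gtr0_norm ?subr_gt0 //.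
have a1 : (1 - w) * `|q i - p i| < (1 - w) * u by rewrite ltr_pM2l // subr_gt0.
have b1 : w * `|q' i - p i| < w * u by rewrite ltr_pM2l.
lra.
Qed.

Lemma weierstrass_at d f q : ana d.+1 f q ->
  (forall e : R, 0 < e -> exists t, `|t| < e /\ f (upd q d (q d + t)) != 0) ->
  exists (k : nat) (b : nat -> (nat -> R) -> R) (s c : R), [/\ 0 < s, c != 0,
    forall i, (i < k)%N -> forall x, close d s q x -> ana d (b i) x &
    forall x, close d.+1 s q x -> exists2 u, 0 < u &
      f x * c = u * ((x d - q d) ^+ k + \sum_(i < k) b i x * (x d - q d) ^+ i)].
Proof.
move=> [s [M [s0 hf]]] hline.
have sp (i : nat) : 0 < (fun _ : nat => s) i by [].
have sn : nng (fun _ : nat => s) by move=> j; exact: ltW.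
have [[k [F [h [hF F0 [m hh] h0 hx]]]]|z] := regular_or_zero sp hf; last first.
  have [t [ht /eqP[]]] := hline _ s0.
  rewrite -(z t ht); congr f; apply/funext => i.
  by rewrite /upd; case: eqP => [->|]; rewrite ?addr0.
have /choice[mm hm] : forall i, exists m, (i < k)%N -> An d (fun=> s) m (F i).
  move=> i; case: (ltnP i k) => [/hF[m' hm']|]; [by exists m'|by exists 0].
have [r' [b [hr' hb hu]]] := weierstrass sp hm F0 hh h0 hx.
have [s1 s10 hs1] : exists2 s : R, 0 < s & forall i, (i < d.+1)%N -> s <= r' i.
  apply: (@fin_common _ d.+1 (fun i s => s <= r' i)).
    by move=> i e e' /andP[_]; exact: le_trans.
  by move=> i _; exists (r' i) => //; have /andP[] := hr' i.
exists k, (fun i x => b i (fun j => x j - q j)), s1, (h (fun=> 0)); split=> //.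
- move=> i ik x hx'; have [m' hm'] := hb i ik.
  have rn : nng r' by move=> j; apply: ltW; have /andP[] := hr' j.
  have ha : ana d (b i) (fun j => x j - q j).
    apply: (ana_of_An rn hm') => j jd; apply: lt_le_trans (hx' j jd) _.
    by apply: hs1; exact: ltnW.
  apply: (ana_comp (g := fun j x => x j - q j) ha) => j jd.
  by apply: anaB; [exact: ana_coord|exact: ana_const].
- move=> x hx'; have [|u u0 E] := hu (fun i => x i - q i).
    by move=> i id; apply: le_trans (ltW (hx' i id)) _; exact: hs1.
  exists u => //; rewrite -E; congr (f _ * _); apply/funext => i; ring.
Qed.

Lemma ana_congr d f x y : ana d f x -> (forall i, (i < d)%N -> x i = y i) -> f x = f y.
Proof.
move=> /ana_lipschitz[C [s [C0 s0 h]]] xy; apply/eqP; rewrite eq_sym -subr_eq0 -normr_le0.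
rewrite -[X in _ <= X](mulr0 C); apply: h => //; first exact: close_refl.
  by move=> i id; rewrite xy // subrr normr0.
by move=> i id; rewrite xy // subrr normr0.
Qed.

(** Weierstrass preparation in degree 1: the zeros are those of [x d - q d + b 0]. The derivative in
    the last variable enters only through a quadratic estimate on the axis, which identifies [c]
    with the value at the origin of the quotient [h]. *)
Lemma ift d f q (c C e : R) : ana d.+1 f q -> f q = 0 -> c != 0 -> 0 < e ->
  (forall t, `|t| < e -> `|f (upd q d (q d + t)) - c * t| <= C * t ^+ 2) ->
  exists xi, [/\ ana d xi q, xi q = q d & nearp d.+1 q (fun x => f x = 0 <-> x d = xi x)].
Proof.
move=> [s [M [s0 hf]]] fq c0 e0 hC.
have sp (i : nat) : 0 < (fun _ : nat => s) i by [].
have sn : nng (fun _ : nat => s) by move=> j; exact: ltW.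
pose F x := f (fun i => q i + x i).
have F0 : F (fun=> 0) = 0 by rewrite -[RHS]fq; congr f; apply/funext => i; rewrite addr0.
have [h hh hx] := An_peel sn (ltnSn d) s0 hf.
have h0 : h (fun=> 0) = c.
  have ha : ana d.+1 h (fun=> 0) by apply: (ana_of_An sn hh) => i _; rewrite normr0.
  apply/eqP; rewrite -subr_eq0; apply/eqP; apply: lt_eps_eq0 => d0 d00.
  have [e1 e10 he1] := ana_cont ha (divr_gt0 d00 (ltr0Sn R 1)).
  have [C1 C10 CC1] : exists2 C1 : R, 0 < C1 & C <= C1.
    by exists (`|C| + 1); rewrite ?ltr_wpDl // (le_trans (ler_norm C)) // lerDl.
  pose t := Num.min (Num.min e s) (Num.min e1 (d0 / 2 / C1)) / 2.
  have m0 : 0 < Num.min (Num.min e s) (Num.min e1 (d0 / 2 / C1)).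
    by rewrite !lt_min e0 s0 e10 !divr_gt0.
  have t0 : 0 < t by rewrite divr_gt0.
  have : t < Num.min (Num.min e s) (Num.min e1 (d0 / 2 / C1)) by exact: half_lt.
  rewrite !lt_min => /andP[/andP[te ts] /andP[te1 td]].
  pose x := upd (fun=> 0) d t.
  have xs : inbox d.+1 (fun=> s) x.
    apply: inbox_upd; first by move=> i _; rewrite normr0 ltW.
    by rewrite gtr0_norm // ltW.
  have E : f (upd q d (q d + t)) = t * h x.
    have xd : x d = t by rewrite /x /upd eqxx.
    have F0x : F (upd x d 0) = 0.
      by rewrite -[RHS]F0; congr F; apply/funext => i; rewrite /x /upd; case: eqP.
    transitivity (F x).
      congr f; apply/funext => i; rewrite /x /upd.
      by case: eqP => [->|]; rewrite ?addr0.
    by rewrite (hx x xs : F x = F (upd x d 0) + x d * h x) F0x xd add0r.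
  have a := hC t; rewrite gtr0_norm // E -[c * t]mulrC -mulrBr normrM gtr0_norm // in a.
  have {}a := a te.
  have b : `|h x - c| <= C1 * t.
    rewrite -(ler_pM2l t0); apply: le_trans a _; rewrite expr2 mulrA [X in _ <= X]mulrC.
    rewrite -mulrA -[X in _ <= X]mulrA; apply: ler_wpM2r; first by rewrite mulr_ge0 // ltW.
    by [].
  have g := he1 x _.
  have {}g : `|h x - h (fun=> 0)| < d0 / 2.
    by apply: g; apply: close_upd; [exact: close_refl|rewrite subr0 gtr0_norm].
  rewrite ltr_pdivlMr // in td.
  have -> : h (fun=> 0) - c = (h x - c) - (h x - h (fun=> 0)) by ring.
  apply: le_lt_trans (ler_normB _ _) _; rewrite (splitr d0); apply: ler_ltD => //.
  by apply: le_trans b _; rewrite mulrC ltW.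
have h0' : h (fun=> 0) != 0 by rewrite h0.
have Fd : An d (fun=> s) M (fun x => F (upd x d 0)) by exact: An_drop.
have [||r' [b [hr' hb hu]]] := @weierstrass _ d _ _ (fun=> M) F 1 (fun _ x => F (upd x d 0)) h sp
    (fun k _ => Fd) _ hh h0' _.
- by move=> k _; rewrite -[RHS]F0; congr F; apply/funext => i; rewrite /upd; case: eqP.
- by move=> x xs; rewrite big_ord_recl big_ord0 /= expr0 mulr1 addr0 expr1; exact: hx.
have [m' hm'] := hb 0%N isT.
have rn : nng r' by move=> j; apply: ltW; have /andP[] := hr' j.
have b0 : b 0%N (fun=> 0) = 0.
  have [|u u0] := hu (fun=> 0); first by move=> i _; rewrite normr0.
  rewrite F0 mul0r big_ord_recl big_ord0 /= expr0 expr1 mulr1 addr0 add0r => /esym/eqP.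
  by rewrite mulf_eq0 gt_eqF //= => /eqP.
have qq : (fun j => q j - q j) = fun=> 0 by apply/funext => j; rewrite subrr.
exists (fun x => q d - b 0%N (fun j => x j - q j)); split.
- apply: anaB; first exact: ana_const.
  apply: (ana_comp (g := fun j x => x j - q j)) => [|j jd].
    by apply: (ana_of_An rn hm') => j _; rewrite subrr normr0; have /andP[] := hr' j.
  by apply: anaB; [exact: ana_coord|exact: ana_const].
- by rewrite qq b0 subr0.
have [s1 s10 hs1] : exists2 s : R, 0 < s & forall i, (i < d.+1)%N -> s <= r' i.
  apply: (@fin_common _ d.+1 (fun i s => s <= r' i)).
    by move=> i t t' /andP[_]; exact: le_trans.
  by move=> i _; exists (r' i) => //; have /andP[] := hr' i.
exists s1 => // x hx'; have [|u u0] := hu (fun i => x i - q i).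
  by move=> i id; apply: le_trans (ltW (hx' i id)) _; exact: hs1.
have -> : F (fun i => x i - q i) = f x by congr f; apply/funext => i; ring.
rewrite big_ord_recl big_ord0 /= expr0 expr1 mulr1 addr0 => E; split=> [fx|xd].
  move: E; rewrite fx mul0r => /esym/eqP; rewrite mulf_eq0 gt_eqF //= => /eqP H.
  by rewrite -[RHS]addr0 -H; ring.
have z : x d - q d + b 0%N (fun i => x i - q i) = 0 by rewrite xd; ring.
move/eqP: E; rewrite z mulr0 mulf_eq0 (negPf h0') orbF.
by move/eqP.
Qed.

(** The increment becomes an extra variable of index [d]. The difference quotient is then the
    quotient [h] of [An_peel], the derivative is [h] at increment 0, and a Lipschitz constant of [h]
    gives the quadratic remainder with one [C] for all [q]. *)
Lemma ana_deriv d f p (l : nat) : ana d f p -> (l < d)%N -> exists f' (C s : R), 0 < s /\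
  forall q, close d s p q -> ana d f' q /\
    forall t, `|t| < s -> `|f (upd q l (q l + t)) - f q - f' q * t| <= C * t ^+ 2.
Proof.
move=> [s [M [s0 hf]]] ld.
have sn : nng (fun _ : nat => s) by move=> j; exact: ltW.
have s2 : 0 < s / 2 by rewrite divr_gt0.
have tn : nng (fun _ : nat => s / 2) by move=> j; exact: ltW.
pose F x := f (fun i => p i + x i).
have hG1 : An d.+1 (fun=> s / 2) M (fun x => F (upd x l (x l + x d))).
  apply: (An_comp (g := fun i x => upd x l (x l + x d) i) sn tn hf) => i id.
  rewrite /upd; case: eqP => [_|_].
    rewrite [X in An _ _ X](splitr s).
    by apply: An_add => //; [have := An_coord (leqW ld) tn|have := An_coord (ltnSn d) tn].
  have := An_coord (leqW id) tn; apply: An_monoM; lra.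
have hG2 : An d.+1 (fun=> s / 2) M F.
  by apply: (An_raise (leqnSn d) tn); apply: (An_shrink tn _ hf) => i _; lra.
have hG := An_sub tn hG1 hG2.
have [h hh hx] := An_peel tn (ltnSn d) s2 hG.
have ha : ana d.+1 h (fun=> 0) by apply: (ana_of_An tn hh) => i _; rewrite normr0.
have [C [s1 [C0 s10 hL]]] := ana_lipschitz ha.
pose s3 := Num.min s1 (s / 2).
have s30 : 0 < s3 by rewrite lt_min s10.
have s31 : s3 <= s1 by rewrite ge_min lexx.
have s32 : s3 <= s / 2 by rewrite ge_min lexx orbT.
have hd := An_drop tn hh.
exists (fun q => h (upd (fun j => q j - p j) d 0)), C, s3; split=> // q hq; split.
  apply: (ana_comp (f := fun x => h (upd x d 0)) (g := fun j x => x j - p j)) => [|j jd].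
    by apply: (ana_of_An tn hd) => j jd; apply: lt_le_trans (hq j jd) s32.
  by apply: anaB; [exact: ana_coord|exact: ana_const].
move=> t ht; pose y v := upd (fun j => q j - p j) d v.
have yin v : `|v| < s3 -> close d.+1 s3 (fun=> 0) (y v).
  move=> hv i; rewrite subr0 /y /upd; case: eqP => // /eqP ni.
  by rewrite ltnS leq_eqVlt (negPf ni) => /hq.
have z0 : `|0 : R| < s3 by rewrite normr0.
have yc v : `|v| < s3 -> close d.+1 s1 (fun=> 0) (y v) by move=> /yin; exact: close_le.
have yb : inbox d.+1 (fun=> s / 2) (y t).
  by move=> i id; have := yin t ht i id; rewrite subr0 => /ltW /le_trans; apply.
have E := hx _ yb.
have ld' : (l == d) = false by rewrite ltn_eqF.
have y_lt i : (i < d)%N -> y t i = q i - p i.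
  by move=> id; rewrite /y /upd ltn_eqF.
have yd v : y v d = v by rewrite /y /upd eqxx.
have -> : f (upd q l (q l + t)) - f q = t * h (y t).
  pose z := upd (y t) l (y t l + y t d).
  have zb : inbox d (fun=> s) z.
    move=> i id; rewrite /z {1}/upd; case: eqP => [_|_].
      rewrite yd y_lt //; apply: le_trans (ler_normD _ _) _.
      by have := hq l ld; have := ht; lra.
    by rewrite y_lt //; have := hq i id; lra.
  have eq1 : F z = f (upd q l (q l + t)).
    transitivity (F (fun i => upd q l (q l + t) i - p i)); last first.
      by congr f; apply/funext => i; ring.
    apply: An_congr hf zb _ => i id; rewrite /z /upd; case: eqP => [->|_]; last exact: y_lt.
    by rewrite yd y_lt //; ring.
  have eq2 : F (y t) = f q.
    transitivity (F (fun i => q i - p i)); last by congr f; apply/funext => i; ring.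
    apply: An_congr hf _ _ => [i id|]; last exact: y_lt.
    by rewrite y_lt //; have := hq i id; lra.
  have eq3 : upd (upd (y t) d 0) l (upd (y t) d 0 l + upd (y t) d 0 d) = upd (y t) d 0.
    by apply/funext => i; rewrite /upd eqxx addr0 ld'; case: eqP => // ->; rewrite ld'.
  by move: E; rewrite -/z eq1 eq2 eq3 subrr add0r yd.
have hL' : `|h (y t) - h (y 0)| <= C * `|t|.
  apply: hL; rewrite ?normr_ge0 //; [exact: yc|exact: yc|move=> i id].
  rewrite /y /upd; case: eqP => _; first by rewrite subr0.
  by rewrite subrr normr0.
rewrite -/(y 0) mulrC -mulrBl normrM; apply: le_trans (ler_wpM2r (normr_ge0 t) hL') _.
by rewrite -mulrA -expr2 real_normK // num_real.
Qed.

(** Cut into [n] steps, the total change over [[a, b]] is at most [n * (C * (L / n) ^+ 2)], which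
    tends to 0. *)
Lemma deriv0_const (G : R -> R) (C : R) (a b : R) (s : R) : 0 < s -> a <= b ->
  (forall u t, a <= u <= b -> a <= u + t <= b -> `|t| < s -> `|G (u + t) - G u| <= C * t ^+ 2) ->
  G b = G a.
Proof.
move=> s0 ab hG; apply/eqP; rewrite -subr_eq0; apply/eqP; apply: lt_eps_eq0 => e e0.
pose L := b - a; have L0 : 0 <= L by rewrite subr_ge0.
have C1 : 0 < `|C| * L ^+ 2 + 1 by rewrite ltr_wpDl // mulr_ge0 ?exprn_ge0.
pose X := L / s + (`|C| * L ^+ 2 + 1) / e.
have X0 : 0 <= X by rewrite addr_ge0 ?divr_ge0 // ltW.
have [n hn] : exists n : nat, X < n%:R by exists (Num.bound X); exact: archi_boundP.
have n0 : 0 < n%:R :> R by exact: le_lt_trans hn.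
pose t := L / n%:R; have t0 : 0 <= t by rewrite divr_ge0 // ltW.
have nt : n%:R * t = L by rewrite mulrC divfK // gt_eqF.
have ts : t < s.
  rewrite /t ltr_pdivrMr // mulrC -ltr_pdivrMr //; apply: le_lt_trans hn.
  by rewrite lerDl divr_ge0 // ltW.
have H k : (k <= n)%N -> `|G (a + k%:R * t) - G a| <= k%:R * (`|C| * t ^+ 2).
  elim: k => [_|k IH kn]; first by rewrite mul0r addr0 subrr normr0 mul0r.
  have inI j : (j <= n)%N -> a <= a + j%:R * t <= b.
    move=> jn; rewrite lerDl mulr_ge0 //= -lerBrDl -/L -nt ler_wpM2r // ler_nat //.
  have E : a + k.+1%:R * t = a + k%:R * t + t by rewrite -(natr1 k); ring.
  have h1 := hG (a + k%:R * t) t (inI k (ltnW kn)).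
  rewrite -E in h1; have {}h1 := h1 (inI _ kn); rewrite ger0_norm // in h1.
  have {}h1 := h1 ts; have h2 := IH (ltnW kn).
  have -> : G (a + k.+1%:R * t) - G a = (G (a + k.+1%:R * t) - G (a + k%:R * t)) +
     (G (a + k%:R * t) - G a) by ring.
  apply: le_trans (ler_normD _ _) _; rewrite [X in _ <= X](_ : _ =
    `|C| * t ^+ 2 + k%:R * (`|C| * t ^+ 2)); last by rewrite -(natr1 k); ring.
  apply: lerD => //; apply: le_trans h1 _.
  by rewrite ler_wpM2r ?exprn_ge0 // ler_norm.
have aL : a + L = b by rewrite /L addrC subrK.
have := H n (leqnn n); rewrite nt aL => h; apply: le_lt_trans h _.
have -> : n%:R * (`|C| * t ^+ 2) = `|C| * L ^+ 2 / n%:R.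
  by rewrite /t; field; rewrite gt_eqF.
rewrite ltr_pdivrMr // [e * _]mulrC -ltr_pdivrMr //; apply: le_lt_trans hn.
apply: (@le_trans _ _ ((`|C| * L ^+ 2 + 1) / e)); last by rewrite lerDr divr_ge0 // ltW.
by rewrite ler_pM2r ?invr_gt0 // lerDl.
Qed.

End LocalAnalysis.

(** * Zero sets *)

Section ZeroSets.
Context {R : realType}.
Implicit Types (d e m : nat) (p q u x y : nat -> R) (f h : (nat -> R) -> R).
Implicit Types (W O T Z : set (nat -> R)).

Definition eo e W := forall u, W u -> nearp e u W.

(* Dimension < m in the countable sense; only the first d coordinates of a
   stream matter. *)
Inductive CP d m : set (nat -> R) -> Prop :=
| CP_none : CP d m set0
| CP_img e W (g : nat -> (nat -> R) -> R) : (e < m)%N -> eo e W ->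
    (forall u, W u -> forall i, (i < d)%N -> ana e (g i) u) ->
    CP d m [set z | exists2 u, W u & forall i, (i < d)%N -> z i = g i u]
| CP_union (F : nat -> set (nat -> R)) : (forall n, CP d m (F n)) ->
    CP d m [set z | exists n, F n z].

Lemma CP_mono d m m' Z : (m <= m')%N -> CP d m Z -> CP d m' Z.
Proof.
move=> mm; elim=> [|e W g em oW hg|F _ IH]; first exact: CP_none.
  exact: (CP_img (leq_trans em mm) oW hg).
exact: CP_union.
Qed.

Lemma CP_image d e m Z (h : nat -> (nat -> R) -> R) : CP e m Z ->
  (forall z, Z z -> forall i, (i < d)%N -> ana e (h i) z) ->
  CP d m [set y | exists2 z, Z z & forall i, (i < d)%N -> y i = h i z].
Proof.
elim=> [|e' W g em oW hg|F hF IH] hh.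
- suff -> : [set y | exists2 z, set0 z & forall i, (i < d)%N -> y i = h i z] = set0.
    exact: CP_none.
  by rewrite -subset0 => y [].
- have hZ u : W u -> (exists2 v, W v & forall i, (i < e)%N -> g i u = g i v) by exists u.
  have := CP_img (g := fun i u => h i (fun j => g j u)) em oW _.
  move=> /(_ d) H; have {}H := H _; apply: (eq_rect _ (CP d m) (H _)) => [u Wu i id|].
    by apply: ana_comp => [|j je]; [exact: hh (hZ u Wu) i id|exact: hg].
  apply/seteqP; split=> y /=.
    by move=> [u Wu E]; exists (fun j => g j u); [exact: hZ|].
  move=> [z [u Wu zu] E]; exists u => // i id; rewrite E //.
  apply: (ana_congr (d := e)) => //; apply: hh => //; by exists u.
- have H n := IH n (fun z Fz i id => hh z (ex_intro _ n Fz) i id).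
  apply: (eq_rect _ (CP d m) (CP_union H)); apply/seteqP; split=> y /=.
    by move=> [n [z Fz E]]; exists z => //; exists n.
  by move=> [z [n Fz] E]; exists n, z.
Qed.

Lemma eo_sat e W x y : eo e W -> (forall i, (i < e)%N -> x i = y i) -> W x -> W y.
Proof.
move=> oW xy /oW[s s0]; apply => i id; by rewrite xy // subrr normr0.
Qed.

Lemma eo_close e s p : eo e (close e s p).
Proof.
move=> u hu.
have [t t0 ht] : exists2 t : R, 0 < t & forall i, (i < e)%N -> t <= s - `|u i - p i|.
  apply: (@fin_common _ e (fun i t => t <= s - `|u i - p i|)).
    by move=> i t t' /andP[_]; exact: le_trans.
  by move=> i /hu hi; exists (s - `|u i - p i|); rewrite ?subr_gt0.
exists t => // q hq i id.
have -> : q i - p i = (u i - p i) + (q i - u i) by ring.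
apply: le_lt_trans (ler_normD _ _) _; rewrite -ltrBrDl.
exact: lt_le_trans (hq i id) (ht i id).
Qed.

Lemma eo_near e W (P : (nat -> R) -> Prop) : eo e W ->
  (forall u, W u -> P u -> nearp e u P) -> eo e [set u | W u /\ P u].
Proof. by move=> oW oP u [Wu Pu]; apply: nearp_and; [exact: oW|exact: oP]. Qed.

Lemma eo_preim e d W O (h : nat -> (nat -> R) -> R) : eo e W -> eo d O ->
  (forall u, W u -> forall i, (i < d)%N -> ana e (h i) u) ->
  eo e [set u | W u /\ O (fun i => h i u)].
Proof.
move=> oW oO hh; apply: eo_near => // u Wu /oO[s s0 hs].
have := nearp_all (P := fun i q => `|h i q - h i u| < s) (m := d) (p := u) (d := e).
by move=> H; apply: nearp_mono (H _) => [q hq|i id]; [exact: hs|exact: ana_cont (hh _ _ _ _) s0].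
Qed.

Lemma eo_setT e : eo e setT.
Proof. by move=> u _; exists 1. Qed.

Definition rbox e (c : seq rat * nat) : set (nat -> R) :=
  close e (c.2.+1%:R^-1) (fun i => ratr (nth 0 c.1 i)).

Lemma rat_approx (w a : R) : 0 < a -> exists c : rat, `|w - ratr c| < a.
Proof.
move=> a0; have h : w - a < w + a by lra.
have [c] := rat_in_itvoo h; rewrite in_itv /= => /andP[? ?]; exists c.
by rewrite ltr_norml; apply/andP; split; lra.
Qed.

Lemma rbox_small e u (s : R) : 0 < s -> exists c, rbox e c u /\
  rbox e c `<=` close e s u.
Proof.
move=> s0; pose k := Num.bound (2 / s).
have hk : 2 / s < k.+1%:R.
  have h : 0 <= 2 / s by rewrite divr_ge0 // ltW.
  by apply: lt_le_trans (archi_boundP h) _; rewrite ler_nat.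
have k0 : 0 < (k.+1%:R : R)^-1 by rewrite invr_gt0 ltr0n.
have ks : 2 * (k.+1%:R : R)^-1 <= s.
  by rewrite ler_pdivrMr ?ltr0n // mulrC -ler_pdivrMr // ltW.
have /choice[c hc] : forall i, exists c : rat, `|u i - ratr c| < (k.+1%:R)^-1.
  by move=> i; exact: rat_approx.
have E i : (i < e)%N -> nth 0 (mkseq c e) i = c i by move=> ie; rewrite nth_mkseq.
exists (mkseq c e, k); split=> [i ie|x hx i ie]; first by rewrite /= E.
have := hx i ie; have := hc i; rewrite /= E // => a b.
have -> : x i - u i = (x i - ratr (c i)) - (u i - ratr (c i)) by ring.
apply: le_lt_trans (ler_normB _ _) _; apply: lt_le_trans ks.
by rewrite mulr2n mulrDl mul1r; exact: ltrD.
Qed.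

(** There are countably many rational boxes. The local hypothesis asks for every small open [O]
    because the box that captures [u] need not be centred at [u]. *)
Lemma lindelof e (Phi : set (nat -> R) -> Prop) W T : eo e W -> Phi set0 ->
  (forall F, (forall n, Phi (F n)) -> Phi [set z | exists n : nat, F n z]) ->
  (forall u, W u -> exists2 s : R, 0 < s & forall O, eo e O -> O `<=` close e s u ->
     O `<=` W -> Phi [set z | O z /\ T z]) ->
  Phi [set z | W z /\ T z].
Proof.
move=> oW P0 PU H.
pose good c := rbox e c `<=` W /\ Phi [set z | rbox e c z /\ T z].
pose F n := if @unpickle (seq rat * nat)%type n is Some c then
  (if `[< good c >] then [set z | rbox e c z /\ T z] else set0) else set0.
have PF n : Phi (F n).
  by rewrite /F; case: unpickle => // c; case: asboolP => // -[].
have -> : [set z | W z /\ T z] = [set z | exists n, F n z]; last exact: PU.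
apply/seteqP; split=> z /=.
  move=> [Wz Tz]; have [s s0 hs] := H z Wz; have [t t0 ht] := oW z Wz.
  have m0 : 0 < Num.min s t by rewrite lt_min s0.
  have [c [zc hc]] := rbox_small e z m0.
  exists (pickle c); rewrite /F pickleK asboolT //; split.
    by move=> x /hc hx; apply: ht; apply: close_le hx; rewrite ge_min lexx orbT.
  apply: hs; first exact: eo_close.
    by move=> x /hc hx; apply: close_le hx; rewrite ge_min lexx.
  by move=> x /hc hx; apply: ht; apply: close_le hx; rewrite ge_min lexx orbT.
move=> [n]; rewrite /F; case: unpickle => // c; case: asboolP => // -[cW _] [zc Tz].
by split=> //; exact: cW.
Qed.

(** Turns the last axis through [p] into any line through [p] transverse to [y d = p d]. With
    [lam d = 0] coordinate [d] is kept and the inverse is the shear by [- lam]. *)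
Definition shear d (lam : nat -> R) p y : nat -> R := fun i => y i + lam i * (y d - p d).

Lemma shearK d lam p : lam d = 0 ->
  cancel (shear d lam p) (shear d (fun i => - lam i) p).
Proof. by move=> l0 y; apply/funext => i; rewrite /shear l0 mul0r addr0; ring. Qed.

Lemma shear_base d lam p : shear d lam p p = p.
Proof. by apply/funext => i; rewrite /shear subrr mulr0 addr0. Qed.

Lemma ana_shear d d' lam p (i : nat) x : (d < d')%N -> (i < d')%N ->
  ana d' (fun y => shear d lam p y i) x.
Proof.
move=> dd id; apply: anaD; first exact: ana_coord.
by apply: anaM; [exact: ana_const|apply: anaB; [exact: ana_coord|exact: ana_const]].
Qed.

(** The product of [f] with [q d - p d] is not locally zero, which yields a point [q] where [f] is
    nonzero and whose coordinate [d] differs from that of [p]. The line through [p] and [q] is then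
    the image of the last axis under a shear. *)
Lemma good_direction d f p : ana d.+1 f p -> ~ nearp d.+1 p (fun q => f q = 0) ->
  exists lam, lam d = 0 /\ forall s : R, 0 < s ->
    exists t, `|t| < s /\ f (shear d lam p (upd p d (p d + t))) != 0.
Proof.
move=> fa nf; have hd : ana d.+1 (fun q => q d - p d) p.
  by apply: anaB; [exact: ana_coord|exact: ana_const].
have nd : ~ nearp d.+1 p (fun q => q d - p d = 0).
  move=> [s s0 hs]; pose z := upd p d (p d + s / 2).
  have E : z d - p d = s / 2 by rewrite /z /upd eqxx addrAC subrr add0r.
  have cl : close d.+1 s p z.
    apply: close_upd; first exact: close_refl.
    by rewrite addrAC subrr add0r gtr0_norm ?divr_gt0 // half_lt.
  by have /eqP := hs _ cl; rewrite E gt_eqF // divr_gt0.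
have := ana_mul_neq0 fa hd nf nd; have [s [M [s0 hM]]] := fa.
have s2 := divr_gt0 s0 (ltr0Sn R 1).
move=> /not_nearp/(_ _ s2)[q hq /eqP]; rewrite mulf_eq0 negb_or => /andP[fq qd].
pose v i := q i - p i.
have T0 : 0 < 2 :> R by [].
have hv i : (i < d.+1)%N -> `|p i - p i| + 2 * `|v i| <= s.
  by move=> id; rewrite subrr normr0 add0r mulrC -ler_pdivlMr // ltW // hq.
have [z|[e e0 he]] := line_dichotomy (G := fun t => f (fun i => p i + t * v i)) T0
    (ana_line T0 hM s0 hv).
  have h1 : `|1 : R| < 2 by rewrite normr1; lra.
  have fq0 := z 1 h1; case/eqP: fq; rewrite -[RHS]fq0.
  by congr f; apply/funext => i; rewrite /v; ring.
exists (fun i => if i == d then 0 else v i / v d); rewrite eqxx; split=> // t t0.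
have vd : 0 < `|v d| by rewrite normr_gt0.
pose w := Num.min e (t / `|v d|) / 2.
have m0 : 0 < Num.min e (t / `|v d|) by rewrite lt_min e0 divr_gt0.
have w0 : 0 < w by rewrite divr_gt0.
have : w < Num.min e (t / `|v d|) by exact: half_lt.
rewrite lt_min => /andP[we wt]; clearbody w.
exists (w * v d); split; first by rewrite normrM gtr0_norm // -ltr_pdivlMr.
have := he w; rewrite gtr0_norm // w0 we => /(_ isT); congr (f _ != 0).
apply/funext => i; rewrite /shear /upd eqxx; case: eqP => [->|_]; first by ring.
by field.
Qed.

Definition pol (k : nat) (b : nat -> (nat -> R) -> R) x : {poly R} :=
  'X^k + \poly_(i < k) b i x.

Lemma coef_pol k b x (i : nat) : (pol k b x)`_i = if (i < k)%N then b i x else (i == k)%:R.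
Proof.
rewrite coefD coefXn coef_poly; case: ltngtP => // ik; by rewrite ?add0r ?addr0.
Qed.

Lemma size_pol k b x : size (pol k b x) = k.+1.
Proof.
rewrite /pol size_polyDl size_polyXn //.
by rewrite ltnS; apply: leq_trans (size_poly _ _) _.
Qed.

Lemma horner_pol k b x (w : R) : (pol k b x).[w] = w ^+ k + \sum_(i < k) b i x * w ^+ i.
Proof. by rewrite hornerD hornerXn horner_poly. Qed.

Lemma ana_horner e (N : nat) (P : (nat -> R) -> {poly R}) (g : (nat -> R) -> R) x :
  (forall y, (size (P y) <= N)%N) -> (forall i, (i < N)%N -> ana e (fun y => (P y)`_i) x) ->
  ana e g x -> ana e (fun y => (P y).[g y]) x.
Proof.
move=> sP hP hg.
under [X in ana e X]funext => y do rewrite (horner_coef_wide _ (sP y)).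
apply: (ana_sum (F := fun i y => (P y)`_i * g y ^+ i)) => i iN.
by apply: anaM; [exact: hP|exact: anaX].
Qed.

Lemma ana_deriv_pol e k b (j : nat) (g : (nat -> R) -> R) x :
  (forall i, (i < k)%N -> ana e (b i) x) -> ana e g x ->
  ana e (fun y => ((pol k b y)^`(j)).[g y]) x.
Proof.
move=> hb hg; apply: (ana_horner (N := k.+1)) => // [y|i _].
  apply/leq_sizeP => i ki; rewrite coef_derivn nth_default ?mul0rn // size_pol.
  exact: leq_trans ki (leq_addl _ _).
have -> : (fun y => ((pol k b y)^`(j))`_i) =
    (fun y => (if (j + i < k)%N then b (j + i)%N y else (j + i == k)%N%:R) * ((j + i) ^_ j)%:R).
  by apply/funext => y; rewrite coef_derivn coef_pol mulr_natr.
apply: anaM; last exact: ana_const.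
by case: ltnP => h; [exact: hb|exact: ana_const].
Qed.

Lemma poly_taylor2 (P : {poly R}) (w : R) : exists C : R, forall t, `|t| < 1 ->
  `|P.[w + t] - P.[w] - P^`().[w] * t| <= C * t ^+ 2.
Proof.
exists (\sum_(i < size P) `|P^`N(i.+2).[w]|) => t t1.
have E : P.[w + t] = \sum_(i < (size P).+2) P^`N(i).[w] * t ^+ i.
  rewrite (nderiv_taylor _ (mulrC _ _)) !big_ord_recr /=.
  by rewrite !nderivn_poly0 ?leqnSn // !horner0 !mul0r !addr0.
rewrite E !big_ord_recl /= nderivn0 nderivn1 expr0 mulr1 expr1.
set S := \sum_(_ < _) _.
have -> : P.[w] + (P^`().[w] * t + S) - P.[w] - P^`().[w] * t = S by ring.
apply: le_trans (ler_norm_sum _ _ _) _; rewrite mulr_suml; apply: ler_sum => i _.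
rewrite [bump 0 _](_ : _ = i.+2) // normrM ler_wpM2l // -(addn2 i) exprD normrM normrX.
rewrite [`|t ^+ 2|]ger0_norm ?exprn_even_ge0 // ler_piMl ?exprn_even_ge0 //.
by rewrite exprn_ile1 // ltW.
Qed.

Lemma CP_ext d m Z Z' : (forall z, Z z <-> Z' z) -> CP d m Z -> CP d m Z'.
Proof. by move=> h; have -> : Z = Z' by apply/seteqP; split=> z /h. Qed.

Lemma CP_open e W : eo e W -> CP e e.+1 W.
Proof.
move=> oW; have := CP_img (d := e) (g := fun i u => u i) (ltnSn e) oW.
move=> H; apply: CP_ext (H _) => [z|u _ i ie]; last exact: ana_coord.
split=> [[u Wu zu]|Wz]; last by exists z.
by apply: (eo_sat oW _ Wu) => i ie; rewrite zu.
Qed.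

Definition zset W (F : (nat -> R) -> R) : set (nat -> R) := [set u | W u /\ F u = 0].

Lemma CP_empty d m Z : (forall z, ~ Z z) -> CP d m Z.
Proof. by move=> h; apply: CP_ext (CP_none d m) => z; split=> // /h. Qed.

Lemma CP_bigU d m (n : nat) (F : nat -> set (nat -> R)) :
  (forall j, (j < n)%N -> CP d m (F j)) -> CP d m [set z | exists2 j, (j < n)%N & F j z].
Proof.
move=> h; have H : forall j, CP d m [set z | (j < n)%N /\ F j z].
  move=> j; case: (ltnP j n) => jn.
    by apply: CP_ext (h j jn) => z; split=> [//|[]].
  by apply: CP_empty => z [].
by apply: CP_ext (CP_union H) => z; split=> [[j []]|[j jn Fz]]; exists j.
Qed.

(* Substituting xi for the last variable leaves a zero set in one variable less. *)
Lemma CP_graph e V O (P xi : (nat -> R) -> R) :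
  (forall W F, eo e W -> (forall u, W u -> ana e F u) -> CP e e.+1 (zset W F)) ->
  eo e V -> (forall x, V x -> ana e xi x) -> eo e.+1 O -> O `<=` V ->
  (forall x, O x -> ana e.+1 P x) ->
  CP e.+1 e.+1 [set x | O x /\ (P x = 0 /\ x e = xi x)].
Proof.
move=> IH oV axi oO OV aP.
pose hh i x := if i == e then xi x else x i : R.
have hhE x : (fun i => hh i x) = upd x e (xi x).
  by apply/funext => i; rewrite /hh /upd; case: eqP => // ->.
have ahh x i : V x -> (i < e.+1)%N -> ana e (hh i) x.
  move=> Vx; rewrite ltnS leq_eqVlt /hh; case: eqP => [_ _|_ /= ie]; first exact: axi.
  exact: ana_coord.
have oW1 := eo_preim oV oO (fun x Vx i ie => ahh x i Vx ie).
have aPh u : [set u | V u /\ O (fun i => hh i u)] u -> ana e (fun x => P (fun i => hh i x)) u.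
  by move=> [Vu Ou]; apply: (ana_comp (aP _ Ou)) => i ie; exact: ahh.
have Z1 := IH _ _ oW1 aPh.
have Z2 : CP e.+1 e.+1 _ := CP_image (h := hh) Z1 (fun z hz i ie => ahh z i hz.1.1 ie).
apply: CP_ext Z2 => x; split=> [[z [[Vz Oz] Pz] xz]|[Ox [Px xe]]].
  have Ox : O x by apply: (eo_sat oO _ Oz) => i /xz ->.
  have xx i : (i < e)%N -> x i = z i.
    by move=> ie; rewrite xz ?leqW // /hh ltn_eqF.
  split=> //; split.
    rewrite -[RHS]Pz; apply: ana_congr (aP x Ox) _ => i /xz; exact.
  by rewrite xz // /hh eqxx; apply: ana_congr (axi z Vz) _ => i /xx ->.
have E : (fun i => hh i x) = x.
  by apply/funext => i; rewrite /hh; case: eqP => // ->; rewrite xe.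
exists x; last by move=> i _; rewrite -{1}E.
by split; [split; [exact: OV|rewrite E]|rewrite E].
Qed.

(** The derivative of order [k] of a monic polynomial of degree [k] is the constant [k!], so at each
    root there is [j < k] such that derivative [j] vanishes and derivative [j.+1] does not. Near
    such a point [ift] solves the equation [P j = 0] for the last variable, and [CP_graph]
    applies. *)
Lemma zset_pol e k b p (s : R) O :
  (forall W F, eo e W -> (forall u, W u -> ana e F u) -> CP e e.+1 (zset W F)) ->
  (forall i, (i < k)%N -> forall x, close e s p x -> ana e (b i) x) ->
  eo e.+1 O -> O `<=` close e.+1 s p ->
  CP e.+1 e.+1 (zset O (fun x => (pol k b x).[x e - p e])).
Proof.
move=> IH hb oO Os.
pose P j x := ((pol k b x)^`(j)).[x e - p e].
have aP j x : close e.+1 s p x -> ana e.+1 (P j) x.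
  move=> hx; apply: (ana_deriv_pol j (g := fun x => x e - p e)) => [i ik|].
    by apply: ana_raise (leqnSn e) (hb i ik _ (close_sub (leqnSn e) hx)).
  by apply: anaB; [exact: ana_coord|exact: ana_const].
suff H : forall j, CP e.+1 e.+1
    [set x | (O x /\ P j.+1 x != 0) /\ (P 0%N x = 0 /\ P j x = 0)].
  apply: CP_ext (CP_bigU (n := k) (fun j _ => H j)) => x; split.
    by move=> [j _ [[Ox _] [Px _]]].
  move=> [Ox Px].
  have [j jk [h0 h1]] : exists2 j, (j < k)%N & P j x = 0 /\ P j.+1 x != 0.
    apply: contrapT => hn.
    have z j : (j <= k)%N -> P j x = 0.
      elim: j => [_|j IHj jk]; first exact: Px.
      apply/eqP/negPn/negP => nz; apply: hn; exists j => //; split=> //.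
      by apply: IHj; exact: ltnW.
    have := z k (leqnn k); rewrite /P.
    have -> : (pol k b x)^`(k) = (k`!%:R)%:P.
      apply/polyP => i; rewrite coef_derivn coef_pol coefC.
      case: i => [|i]; last by rewrite addnS ltnNge ltnW ?ltnS ?leq_addr //= gtn_eqF
        ?ltnS ?leq_addr // mul0rn.
      by rewrite addn0 ltnn eqxx ffactnn.
    by move=> /eqP; rewrite hornerC pnatr_eq0 -leqn0 leqNgt fact_gt0.
  by exists j.
move=> j; have oOj : eo e.+1 [set x | O x /\ P j.+1 x != 0].
  by apply: eo_near => // x /Os hx; apply: ana_neq0; exact: aP.
apply: (lindelof (Phi := CP e.+1 e.+1) oOj).
- exact: CP_none.
- exact: CP_union.
move=> x0 [Ox0 nz]; have cx0 := Os _ Ox0.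
have [z|nzj] := eqVneq (P j x0) 0; last first.
  have [t t0 ht] := ana_neq0 (aP j x0 cx0) nzj; exists t => // O' _ hO' _.
  by apply: CP_empty => x [/hO'/ht/eqP ? [_ ?]].
have [C hC] := poly_taylor2 ((pol k b x0)^`(j)) (x0 e - p e).
have hC' t : `|t| < 1 -> `|P j (upd x0 e (x0 e + t)) - P j.+1 x0 * t| <= C * t ^+ 2.
  move=> t1; have := hC t t1; rewrite -[_.[x0 e - p e]]/(P j x0) z subr0 -derivnS.
  congr (`| _ - _ * t| <= _); rewrite /P {2}/upd eqxx addrAC; congr (_.[_]).
  congr derivn; apply/polyP => i; rewrite !coef_pol; case: ltnP => // ik.
  apply: ana_congr (hb i ik x0 (close_sub (leqnSn e) cx0)) _ => l le.
  by rewrite /upd ltn_eqF.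
have [xi [axi _ hxi]] := ift (aP j x0 cx0) z nz ltr01 hC'.
have [t1 t10 ht1] := hxi; have [t2 t20 ht2] := ana_near axi.
exists (Num.min t1 t2) => [|O' oO' hO' O'W]; first by rewrite lt_min t10.
have G := CP_graph (P := P 0%N) IH (@eo_close e t2 x0) ht2 oO' _ _.
apply: CP_ext (G _ _) => [x|x O'x|x O'x].
- have E (O'x : O' x) : P j x = 0 <-> x e = xi x.
    by apply: ht1; apply: close_le (hO' _ O'x); rewrite ge_min lexx.
  by split=> [[Ox [Px xe]]|[Ox [Px Pj]]]; split=> //; split=> //; apply/E.
- apply: close_sub (leqnSn e) _; apply: close_le (hO' _ O'x).
  by rewrite ge_min lexx orbT.
- by apply: aP; apply: Os; have [] := O'W _ O'x.
Qed.

(** After a shear the last axis is a line on which [F] is not identically zero, so Weierstrass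
    preparation replaces [F] by a monic polynomial up to a unit; the inverse shear, being analytic,
    respects [CP]. *)
Lemma zset_local e F p :
  (forall W F, eo e W -> (forall u, W u -> ana e F u) -> CP e e.+1 (zset W F)) ->
  ana e.+1 F p -> ~ nearp e.+1 p (fun q => F q = 0) ->
  exists2 s : R, 0 < s & forall O, eo e.+1 O -> O `<=` close e.+1 s p ->
    CP e.+1 e.+1 (zset O F).
Proof.
move=> IH aF nF; have [lam [l0 hlam]] := good_direction aF nF.
pose L := shear e lam p; pose L' := shear e (fun i => - lam i) p.
have LK : cancel L L' by exact: shearK.
have LK' : cancel L' L.
  move=> y; have := shearK p (lam := fun i => - lam i) (d := e).
  rewrite l0 oppr0 => /(_ erefl y); rewrite /L /L'; congr (_ = _).
  by congr (shear _ _ _ _); apply/funext => i; rewrite opprK.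
have aL i x : (i < e.+1)%N -> ana e.+1 (fun y => L y i) x.
  by move=> ie; exact: ana_shear.
have aL' i x : (i < e.+1)%N -> ana e.+1 (fun y => L' y i) x.
  by move=> ie; exact: ana_shear.
have aFL : ana e.+1 (fun y => F (L y)) p.
  apply: (ana_comp (d := e.+1) (g := fun i y => L y i)) => [|i ie]; last exact: aL.
  have -> : (fun i => L p i) = p by exact: shear_base.
  exact: aF.
have [k [b [s [c [s0 c0 hb hF]]]]] := weierstrass_at aFL hlam.
have n1 : nearp e.+1 p (fun x => close e.+1 s p (L' x)).
  apply: (nearp_all (P := fun i x => `|L' x i - p i| < s)) => i ie.
  have := ana_cont (aL' i p ie) s0; rewrite /L' shear_base; exact.
have [t t0 ht] := nearp_and n1 (ana_near aF).
exists t => // O oO hO.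
pose O' := [set y | setT y /\ O (fun i => L y i)].
have oO' : eo e.+1 O' by apply: eo_preim (@eo_setT _) oO _ => u _ i; exact: aL.
have O's : O' `<=` close e.+1 s p.
  by move=> y [_ /hO/ht[+ _]]; rewrite -[fun i => L y i]/(L y) LK.
have Z := zset_pol IH hb oO' O's.
apply: CP_ext (CP_image (h := fun i y => L y i) Z (fun z _ i ie => aL i z ie)) => x.
have ZE y : O' y -> ((pol k b y).[y e - p e] = 0 <-> F (L y) = 0).
  move=> O'y; have [u u0] := hF y (O's _ O'y); rewrite -horner_pol => E; split=> h.
    by move/eqP: E; rewrite h mulr0 mulf_eq0 (negPf c0) orbF => /eqP.
  by move/esym/eqP: E; rewrite h mul0r mulf_eq0 gt_eqF //= => /eqP.
split=> [[y [O'y /(ZE y O'y) Fy] xy]|[Ox Fx]].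
  have [_ Oy] := O'y; have Ox : O x by apply: (eo_sat oO _ Oy) => i /xy ->.
  split=> //; rewrite -[RHS]Fy; apply: ana_congr _ xy.
  by have [] := ht _ (hO _ Ox).
have O'y : O' (L' x) by split=> //; rewrite -[fun i => L _ i]/(L (L' x)) LK'.
exists (L' x); first by split=> //; apply/(ZE _ O'y); rewrite LK'.
by move=> i _; rewrite LK'.
Qed.

(** The first conclusion is what [CP_graph] needs one dimension lower; the second is the drop of
    dimension on which [image_PU] relies. *)
Lemma zero_set e W F : eo e W -> (forall u, W u -> ana e F u) ->
  CP e e.+1 (zset W F) /\
  ((forall u, W u -> ~ nearp e u (fun q => F q = 0)) -> CP e e (zset W F)).
Proof.
elim: e W F => [|e IH] W F oW aF.
  have sat (T : set (nat -> R)) : eo 0 T -> forall x y, T x -> T y.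
    by move=> oT x y; apply: (eo_sat oT).
  split; last first.
    move=> H; apply: CP_empty => z [Wz Fz]; apply: (H z Wz).
    exists 1 => // q _; rewrite -[RHS]Fz; apply: esym; exact: ana_congr (aF z Wz) _.
  apply: CP_ext (CP_open (_ : eo 0 (zset W F))) => // z [Wz Fz].
  exists 1 => // q _; split; first exact: sat Wz.
  rewrite -[RHS]Fz; apply: esym; exact: ana_congr (aF z Wz) _.
have IH1 W' F' := fun oW' aF' => (IH W' F' oW' aF').1.
(* Serves both conclusions: [m = e.+2] admits open pieces on which [F] vanishes, [m = e.+1] does
   not. *)
have step m : (e < m)%N -> (forall u, W u -> ~ nearp e.+1 u (fun q => F q = 0) \/ (e.+1 < m)%N) ->
    CP e.+1 m (zset W F).
  move=> em H; apply: (lindelof (Phi := CP e.+1 m) oW).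
  - exact: CP_none.
  - exact: CP_union.
  move=> u Wu; case: (pselect (nearp e.+1 u (fun q => F q = 0))) => [hz|hz].
    have [//|em1] := H u Wu; have [s s0 hs] := hz; exists s => // O oO hO _.
    apply: CP_mono em1 _; apply: CP_ext (CP_open oO) => x.
    by split=> [Ox|[]//]; split=> //; apply: hs; exact: hO.
  have [s s0 hs] := zset_local IH1 (aF u Wu) hz; exists s => // O oO hO _.
  by apply: CP_mono em _; exact: hs.
split; first by apply: step => // u _; right.
by move=> H; apply: step => // u Wu; left; exact: H.
Qed.

End ZeroSets.

(** * Images of analytic maps *)

Section Rows.
Context {R : realType}.

Definition ofrow N (x : 'rV[R]_N) : nat -> R :=
  fun i => if insub i is Some j then x ord0 j else 0.

Definition torow N (u : nat -> R) : 'rV[R]_N := \row_j u j.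

Lemma ofrowE N (x : 'rV[R]_N) (j : 'I_N) : ofrow x j = x ord0 j.
Proof. by rewrite /ofrow valK. Qed.

Lemma torowE N (u : nat -> R) (j : 'I_N) : torow N u ord0 j = u j.
Proof. by rewrite mxE. Qed.

Lemma ofrowK N : cancel (@ofrow N) (torow N).
Proof. by move=> x; apply/rowP => j; rewrite torowE ofrowE. Qed.

Lemma coord_le_enorm N (x : 'rV[R]_N) (j : 'I_N) : `|x ord0 j| <= enorm x.
Proof.
rewrite -sqrtr_sqr ler_sqrt ?sumr_ge0 // => [|i _]; last exact: sqr_ge0.
by rewrite (bigD1 j) //= lerDl sumr_ge0 // => i _; exact: sqr_ge0.
Qed.

Lemma enorm_ge0 N (x : 'rV[R]_N) : 0 <= enorm x.
Proof. exact: sqrtr_ge0. Qed.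

Lemma enorm_le N (x : 'rV[R]_N) (t : R) : 0 <= t -> (forall j, `|x ord0 j| <= t) ->
  enorm x <= (N%:R + 1) * t.
Proof.
move=> t0 h; have b0 : 0 <= (N%:R + 1) * t by rewrite mulr_ge0 // addr_ge0.
rewrite -[X in _ <= X]ger0_norm // -sqrtr_sqr ler_sqrt ?sqr_ge0 //.
apply: (@le_trans _ _ (\sum_(i < N) t ^+ 2)).
  apply: ler_sum => i _; rewrite -[_ ^+ 2]real_normK ?num_real //.
  by apply: lerXn2r; rewrite ?nnegrE.
rewrite sumr_const card_ord -[_ *+ N]mulr_natl exprMn ler_wpM2r ?sqr_ge0 //.
have := ler0n R N; set a := N%:R => a0; rewrite expr2; nra.
Qed.

Lemma monomE N (al : N.-tuple nat) (y : 'rV[R]_N) :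
  monom al y = mon N (nth 0%N al) (ofrow y).
Proof. by apply: eq_bigr => i _; rewrite ofrowE (tnth_nth 0%N). Qed.

Lemma analytic_on_ana N (U : set 'rV[R]_N) f x : analytic_on U f -> U x ->
  ana N (fun u => f (torow N u)) (ofrow x).
Proof.
move=> hf /hf[r r0 [c hc]].
pose t := r / (N%:R + 2); have n0 := ler0n R N.
have N2 : 0 < N%:R + 2 :> R by lra.
have t0 : 0 < t by rewrite divr_gt0.
have tr : (N%:R + 1) * t < r by rewrite /t mulrA ltr_pdivrMr // mulrC ltr_pM2l //; lra.
have inb u : inbox N (fun=> t) u -> eball x r (torow N (fun i => ofrow x i + u i)).
  move=> hu; rewrite /eball /=; apply: le_lt_trans tr; apply: enorm_le; first exact: ltW.
  by move=> j; rewrite !mxE ofrowE addrAC subrr add0r; exact: hu.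
have mE (al : N.-tuple nat) u :
    monom al (torow N (fun i => ofrow x i + u i) - x) = mon N (nth 0%N al) u.
  rewrite monomE; apply: eq_bigr => i _; congr (_ ^+ _).
  by rewrite ofrowE !mxE ofrowE; ring.
have us u : inbox N (fun=> t) u ->
    usum (fun al : N.-tuple nat => c al * mon N (nth 0%N al) u)
      (f (torow N (fun i => ofrow x i + u i))).
  by move=> /inb/hc h; apply: usum_ext h => al; rewrite mE.
have tb : inbox N (fun=> t) (fun=> t) by move=> i _; rewrite gtr0_norm.
have [M hM] := usum_abdd (us _ tb).
by exists t, M; split=> //; exact: (An_count hM us).
Qed.

(** [analytic_on] wants one coefficient per multi-index, while a series of [An] may repeat
    monomials. [L al] is the sum, at the corner of the box, of all terms of multi-index [al];
    dividing by the monomial there gives the coefficient, and Fubini regroups the series. *)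
Lemma ana_analytic_on N (U : set 'rV[R]_N) (F : (nat -> R) -> R) :
  (forall x, U x -> ana N F (ofrow x)) -> analytic_on U (fun x => F (ofrow x)).
Proof.
move=> hF x /hF[s [M [s0 [c [a [hM hs]]]]]]; exists s => //.
pose tup k : N.-tuple nat := [tuple a k i | i < N].
have tE k y : mon N (nth 0%N (tup k)) y = mon N (a k) y :> R.
  by apply: eq_bigr => i _; rewrite -tnth_nth tnth_mktuple.
pose w (al : N.-tuple nat) k := if tup k == al then c k * mon N (a k) (fun=> s) else 0.
have wabd al : abdd (w al) M.
  by apply: abdd_le hM => k; rewrite /w; case: eqP => // _; rewrite normr0.
have /choice[L hL] : forall al, exists l, usum (w al) l.
  by move=> al; have [l hl _] := usum_exists (wabd al); exists l.
have ms al : 0 < mon N (nth 0%N al) (fun=> s) by apply: prodr_gt0 => i _; exact: exprn_gt0.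
exists (fun al => L al / mon N (nth 0%N al) (fun=> s)) => y hy.
pose z i := ofrow y i - ofrow x i.
have zb : inbox N (fun=> s) z.
  move=> i iN; rewrite /z -[i]/(val (Ordinal iN)) !ofrowE.
  apply: ltW; apply: le_lt_trans hy.
  by have := coord_le_enorm (y - x) (Ordinal iN); rewrite !mxE.
have mz al : monom al (y - x) = mon N (nth 0%N al) z.
  by rewrite monomE; apply: eq_bigr => i _; rewrite /z !ofrowE !mxE.
pose v (p : nat * N.-tuple nat) : R :=
  if tup p.1 == p.2 then c p.1 * mon N (a p.1) z else 0.
have v1 k : usum (fun al => v (k, al)) (c k * mon N (a k) z).
  have -> : c k * mon N (a k) z = v (k, tup k) by rewrite /v /= eqxx.
  by apply: (usum1 (v := fun al => v (k, al))) => al; rewrite /v /= eq_sym => /negPf ->.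
have v2 k : abdd (fun al => v (k, al)) `|c k * mon N (a k) z|.
  have h : abdd (fun al => `|v (k, al)|) `|c k * mon N (a k) z|.
    apply: usum_abdd_ge0 => //.
    have -> : `|c k * mon N (a k) z| = `|v (k, tup k)| by rewrite /v /= eqxx.
    apply: (usum1 (v := fun al => `|v (k, al)|)) => al; rewrite /v /= eq_sym => /negPf ->.
    by rewrite normr0.
  by apply: abdd_le h => al; rewrite normr_id.
have v3 : abdd (fun k => `|c k * mon N (a k) z|) M.
  by have := abdd_mon_box zb hM; apply: abdd_le => k; rewrite normr_id.
have := usum_swap (usum_pair v2 v3 v1 (hs z zb)) => H.
have zy : F (fun i => ofrow x i + z i) = F (ofrow y).
  by congr F; apply/funext => i; rewrite /z; ring.
rewrite zy in H.
suff : usum (fun al => L al / mon N (nth 0%N al) (fun=> s) * monom al (y - x)) (F (ofrow y)).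
  by [].
apply: usum_fubini H _ => al.
have := usumZ (mon N (nth 0%N al) z / mon N (nth 0%N al) (fun=> s)) (hL al).
rewrite [X in usum _ X](_ : _ = L al / mon N (nth 0%N al) (fun=> s) * monom al (y - x)).
  apply: usum_ext => k /=; rewrite /w /v /=; case: eqP => [<-|_]; last by rewrite mulr0.
  by rewrite !tE; field; rewrite -tE gt_eqF.
by rewrite mz; ring.
Qed.

End Rows.

Section AnalyticImages.
Context {R : realType}.
Implicit Types (d n : nat) (p q u x y : nat -> R) (f : (nat -> R) -> R).
Implicit Types (W O Z : set (nat -> R)) (g : nat -> (nat -> R) -> R).

Definition is_piece n (X : set 'rV[R]_n) (k : nat) : Prop :=
  exists (c : 'I_k -> 'I_n) (W : set 'rV[R]_k) (phi : 'rV[R]_k -> 'rV[R]_n),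
    [/\ injective c, eopen W,
        (forall j : 'I_n, analytic_on W (fun v => phi v ord0 j)),
        (forall v i, W v -> phi v ord0 (c i) = v ord0 i) &
        X = phi @` W].

(** The counterpart of [CP] whose pieces are graphs over coordinate planes, as in
    [has_analytic_piece], so that the dimension of each nonempty piece inside a set is bounded by
    the pieces that this set contains. *)
Inductive PU n : set 'rV[R]_n -> Prop :=
| PU_none : PU set0
| PU_piece X k : is_piece X k -> PU X
| PU_union (F : nat -> set 'rV[R]_n) : (forall i, PU (F i)) -> PU [set a | exists i, F i a].

Definition img n g Z : set 'rV[R]_n :=
  [set a | exists2 u, Z u & forall j : 'I_n, a ord0 j = g j u].

Arguments img n g Z : clear implicits.

Lemma img_union n g (F : nat -> set (nat -> R)) :
  img n g [set z | exists i, F i z] = [set a | exists i, img n g (F i) a].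
Proof.
apply/seteqP; split=> a /=.
  by move=> [u [i Fu] E]; exists i, u.
by move=> [i [u Fu E]]; exists u => //; exists i.
Qed.

Lemma img0 n g : img n g set0 = set0.
Proof. by rewrite -subset0 => a [u]. Qed.

Lemma PU_setU n (A B : set 'rV[R]_n) : PU A -> PU B -> PU (A `|` B).
Proof.
move=> hA hB; have := PU_union (F := fun i => if i is 0 then A else B).
have -> : [set a | exists i : nat, (if i is 0 then A else B) a] = A `|` B.
  apply/seteqP; split=> a /=; first by move=> [[|i] h]; [left|right].
  by move=> [h|h]; [exists 0%N|exists 1%N].
by apply => -[].
Qed.

Definition img_PU d := forall n g W, eo d W ->
  (forall u, W u -> forall i, (i < n)%N -> ana d (g i) u) -> PU (img n g W).

Lemma PU_of_CP d m n g Z : (forall d', (d' < m)%N -> img_PU d') -> CP d m Z ->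
  (forall u, Z u -> forall i, (i < n)%N -> ana d (g i) u) -> PU (img n g Z).
Proof.
move=> IH; elim=> [|e W h em oW hh|F hF IHF] hg.
- rewrite img0; exact: PU_none.
- have hZ u : W u -> (exists2 v, W v & forall i, (i < d)%N -> h i u = h i v) by exists u.
  have := IH e em n (fun i u => g i (fun j => h j u)) W oW _.
  have -> : img n (fun i u => g i (fun j => h j u)) W =
      img n g [set z | exists2 u, W u & forall i, (i < d)%N -> z i = h i u].
    apply/seteqP; split=> a /=.
      by move=> [u Wu E]; exists (fun j => h j u); [exact: hZ|].
    move=> [z [u Wu zu] E]; exists u => // j; rewrite E.
    apply: (ana_congr (d := d)); last exact: zu.
    by apply: hg (ltn_ord j); exists u.
  apply=> u Wu i iN; apply: (ana_comp (d := d)) => [|j jd]; last exact: hh.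
  by apply: hg iN; exact: hZ.
- rewrite img_union; apply: PU_union => i; apply: IHF => u Fu; apply: hg; by exists i.
Qed.

(** If [f] vanished near [q], it would vanish on the line from [q] to a nearby point where it is
    nonzero. *)
Lemma not_near_zero_open d f p : ana d f p -> ~ nearp d p (fun q => f q = 0) ->
  exists2 s : R, 0 < s & forall q, close d s p q -> ~ nearp d q (fun q => f q = 0).
Proof.
move=> [s [M [s0 hM]]] nf; exists (s / 8); first by rewrite divr_gt0.
move=> q hq [e e0 he].
have s8 : 0 < s / 8 by rewrite divr_gt0.
have [q' hq' fq'] := not_nearp nf s8.
pose v i := q' i - q i.
have hv i : (i < d)%N -> `|q i - p i| + 3 * `|v i| <= s.
  move=> id; have a := hq i id; have b := hq' i id.
  have : `|v i| <= `|q' i - p i| + `|q i - p i|.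
    by apply: le_trans (ler_normB _ _); rewrite /v le_eqVlt; apply/orP; left;
      apply/eqP; congr `|_|; ring.
  by move=> c; lra.
have T0 : 0 < 3 :> R by [].
have [z|[e1 e10 h1]] := line_dichotomy (G := fun t => f (fun i => q i + t * v i)) T0
    (ana_line T0 hM s0 hv).
  have h1 : `|1 : R| < 3 by rewrite normr1; lra.
  apply: fq'; rewrite -[RHS](z 1 h1).
  by congr f; apply/funext => i; rewrite /v; ring.
have [t [t0 te ht]] : exists t : R, [/\ 0 < t, t < e1 & forall i, (i < d)%N -> t * `|v i| < e].
  have [t t0 ht] : exists2 t : R, 0 < t & forall i, (i < d)%N -> t * (`|v i| + 1) < e.
    apply: (@fin_common _ d (fun i t => t * (`|v i| + 1) < e)).
      move=> i t t' /andP[_ tt]; apply: le_lt_trans; apply: ler_wpM2r => //.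
      by rewrite addr_ge0.
    move=> i _; have v1 : 0 < `|v i| + 1 by rewrite ltr_wpDl.
    exists (e / (`|v i| + 1) / 2); first by rewrite !divr_gt0.
    by rewrite mulrAC divfK ?gt_eqF // half_lt.
  have m0 : 0 < Num.min t e1 by rewrite lt_min t0.
  have : Num.min t e1 / 2 < Num.min t e1 by exact: half_lt.
  rewrite lt_min => /andP[mt me]; exists (Num.min t e1 / 2); split=> //.
    by rewrite divr_gt0.
  move=> i id; apply: le_lt_trans (ht i id); apply: ler_pM => //.
  - by rewrite ltW // divr_gt0.
  - exact: ltW.
  - by rewrite lerDl.
have th1 : 0 < `|t| < e1 by rewrite gtr0_norm // t0.
have /eqP := h1 t th1; apply; apply: he => i id; rewrite addrAC subrr add0r normrM gtr0_norm //; exact: ht.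
Qed.

Lemma ana_sat d f p q : ana d f p -> (forall i, (i < d)%N -> p i = q i) -> ana d f q.
Proof.
move=> /ana_near[e e0 he] pq; apply: he => i id; by rewrite pq // subrr normr0.
Qed.

Lemma upd_ne (T : Type) (x : nat -> T) l v i : i != l -> upd x l v i = x i.
Proof. by rewrite /upd => /negPf ->. Qed.

Lemma upd_upd (T : Type) (x : nat -> T) l v w : upd (upd x l v) l w = upd x l w.
Proof. by apply/funext => i; rewrite /upd; case: eqP. Qed.

Lemma upd_id (T : Type) (x : nat -> T) l : upd x l (x l) = x.
Proof. by apply/funext => i; rewrite /upd; case: eqP => [->|]. Qed.

Lemma updE (T : Type) (x : nat -> T) l v : upd x l v l = v.
Proof. by rewrite /upd eqxx. Qed.

Lemma indep_of_deriv0 d f p (l : nat) (C s : R) (f' : (nat -> R) -> R) : 0 < s ->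
  (forall q, close d s p q -> f' q = 0 /\
    forall t, `|t| < s -> `|f (upd q l (q l + t)) - f q - f' q * t| <= C * t ^+ 2) ->
  forall q v, (l < d)%N -> close d s p q -> `|v - p l| < s -> f (upd q l v) = f q.
Proof.
move=> s0 H q v ld hq hv.
have key a b : a <= b -> `|a - p l| < s -> `|b - p l| < s -> f (upd q l b) = f (upd q l a).
  move=> ab ha hb.
  apply: (@deriv0_const _ (fun w => f (upd q l w)) C a b s s0 ab) => u t hu hut ts.
  have cl : close d s p (upd q l u).
    apply: close_upd => //; move: ha hb hu; rewrite !ltr_norml => /andP[? ?] /andP[? ?] /andP[? ?].
    by apply/andP; split; lra.
  have [z h] := H _ cl; have := h t ts.
  by rewrite z mul0r subr0 updE upd_upd.
rewrite -[in RHS](upd_id q l).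
have [h|h] := leP (q l) v; first by apply: key => //; exact: hq.
by apply: esym; apply: key; [exact: ltW|exact: hv|exact: hq].
Qed.

Definition freeze (js : seq nat) u0 u : nat -> R := fun i => if i \in js then u i else u0 i.

(** The coordinates outside [js] are moved to those of [p] one at a time; [ka m] is the stage after
    the indices below [m]. *)
Lemma freeze_indep d f p (js : seq nat) (s : R) : 0 < s ->
  (forall q, close d s p q -> ana d f q) ->
  (forall l, (l < d)%N -> l \notin js -> forall q v, close d s p q -> `|v - p l| < s ->
     f (upd q l v) = f q) ->
  forall u, close d s p u -> f u = f (freeze js p u).
Proof.
move=> s0 af H u hu.
pose ka m i := if (i < m)%N && (i \notin js) then p i else u i.
have ka_close m : close d s p (ka m).
  move=> i id; rewrite /ka; case: ifP => _; last exact: hu.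
  by rewrite subrr normr0.
have hm m : (m <= d)%N -> f (ka m) = f u.
  elim: m => [_|m IH md].
    by congr f; apply/funext => i.
  rewrite -(IH (ltnW md)); have [mj|mj] := boolP (m \in js).
    congr f; apply/funext => i; rewrite /ka ltnS leq_eqVlt.
    by case: eqP => [->|//]; rewrite mj /= !andbF.
  have -> : ka m.+1 = upd (ka m) m (p m).
    apply/funext => i; rewrite /ka /upd ltnS leq_eqVlt; case: eqP => [->|//].
    by rewrite mj.
  by apply: H => //; rewrite subrr normr0.
rewrite -(hm d (leqnn d)); apply: (ana_congr (d := d)); first exact: af.
by move=> i id; rewrite /ka /freeze id /=; case: (i \in js).
Qed.

(** The parameters in [js] are themselves components of [g], and all components depend on them
    alone: the image is a graph over the projection of [O] to these parameters. *)
Lemma straight_piece d n g p (js : seq nat) (c : nat -> nat) (s : R) O : 0 < s ->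
  uniq js -> (forall l, l \in js -> (l < d)%N) -> (forall l, l \in js -> (c l < n)%N) ->
  (forall q, close d s p q -> forall i, (i < n)%N -> ana d (g i) q) ->
  (forall l q, l \in js -> close d s p q -> g (c l) q = q l) ->
  (forall i q, (i < n)%N -> close d s p q -> g i q = g i (freeze js p q)) ->
  eo d O -> O `<=` close d s p -> PU (img n g O).
Proof.
move=> s0 ujs jd jn ag gs gf oO Os.
case: (pselect (exists u, O u)) => [[u1 Ou1]|nO]; last first.
  rewrite (_ : img n g O = set0); first exact: PU_none.
  by rewrite -subset0 => a [u Ou]; exfalso; apply: nO; exists u.
pose k := size js.
pose lft (y : nat -> R) i := if i \in js then y (index i js) else p i.
have nj (r : 'I_k) : nth 0%N js r \in js by exact: mem_nth.
have hc (r : 'I_k) : (c (nth 0%N js r) < n)%N by exact: jn.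
pose cc r := Ordinal (hc r).
pose W := [set v : 'rV[R]_k | exists2 u, O u & forall r : 'I_k, u (nth 0%N js r) = v ord0 r].
pose phi (v : 'rV[R]_k) : 'rV[R]_n := \row_j g j (lft (ofrow v)).
have lftE u (v : 'rV[R]_k) : (forall r : 'I_k, u (nth 0%N js r) = v ord0 r) ->
    lft (ofrow v) = freeze js p u.
  move=> uv; apply/funext => i; rewrite /lft /freeze; case: ifP => // ij.
  have hi : (index i js < k)%N by rewrite index_mem.
  by rewrite -[index i js]/(val (Ordinal hi)) ofrowE -uv /= nth_index.
have frc u : close d s p u -> close d s p (freeze js p u).
  move=> hu i id; rewrite /freeze; case: ifP => _; first exact: hu.
  by rewrite subrr normr0.
apply: (@PU_piece _ _ k); exists cc, W, phi; split.
(* Two parameters equal to the same component would agree on all of [O]; moving one of them inside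
   the open set excludes this. *)
- move=> r r' /(congr1 val) /= E; apply: val_inj => /=; apply/eqP/negPn/negP => rr.
  have ll : nth 0%N js r != nth 0%N js r' by rewrite nth_uniq.
  have [t t0 ht] := oO u1 Ou1; set l := nth 0%N js r in E ll; set l' := nth 0%N js r' in E ll.
  pose u2 := upd u1 l (u1 l + t / 2).
  have Ou2 : O u2.
    apply: ht; apply: close_upd; first exact: close_refl.
    by rewrite addrAC subrr add0r gtr0_norm ?divr_gt0 // half_lt.
  have e1 : u2 l = u2 l' by rewrite -(gs l u2 (nj r) (Os _ Ou2)) E (gs l' u2 (nj r') (Os _ Ou2)).
  have e2 : u1 l = u1 l' by rewrite -(gs l u1 (nj r) (Os _ Ou1)) E (gs l' u1 (nj r') (Os _ Ou1)).
  move: e1; rewrite /u2 updE /upd eq_sym (negPf ll) -e2 => /eqP.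
  by rewrite -subr_eq0 addrAC subrr add0r gt_eqF // divr_gt0.
- move=> v [u Ou uv]; have [t t0 ht] := oO u Ou; exists t => // v' hv'.
  exists (fun i => if i \in js then ofrow v' (index i js) else u i); last first.
    by move=> r; rewrite nj index_uniq // ofrowE.
  apply: ht => i id; case: ifP => ij; last by rewrite subrr normr0.
  have hi : (index i js < k)%N by rewrite index_mem.
  rewrite -[index i js]/(val (Ordinal hi)) ofrowE.
  have -> : u i = v ord0 (Ordinal hi) by rewrite -uv /= nth_index.
  apply: le_lt_trans hv'; have := coord_le_enorm (v' - v) (Ordinal hi); by rewrite !mxE.
- move=> j; have -> : (fun v => phi v ord0 j) = (fun v => (fun y => g j (lft y)) (ofrow v)).
    by apply/funext => v; rewrite mxE.
  apply: (ana_analytic_on (F := fun y => g j (lft y))) => v [u Ou uv].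
  apply: (ana_comp (d := d) (g := fun i y => lft y i)) => [|i id].
    have -> : (fun i => lft (ofrow v) i) = freeze js p u by exact: lftE.
    by apply: ag => //; apply: frc; exact: Os.
  rewrite /lft; case: (boolP (i \in js)) => ij; last exact: ana_const.
  by apply: ana_coord; rewrite index_mem.
- move=> v r [u Ou uv]; rewrite mxE (lftE u v uv) /= gs //; last by apply: frc; exact: Os.
  by rewrite /freeze nj uv.
- apply/seteqP; split=> a.
    move=> [u Ou au]; exists (\row_r u (nth 0%N js r)); first by exists u => // r; rewrite mxE.
    apply/rowP => j; rewrite mxE (lftE u) => [|r]; last by rewrite mxE.
    by rewrite au (gf j u (ltn_ord j) (Os _ Ou)).
  move=> [v [u Ou uv] <-]; exists u => // j.
  by rewrite mxE (lftE u v uv) -gf //; exact: Os.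
Qed.

(* By the implicit function theorem the value of g j replaces the parameter l. *)
Lemma straighten_step d n g (js : seq nat) (c : nat -> nat) W (l j : nat) p (f' : R) (C s : R) :
  0 < s -> (l < d)%N -> (j < n)%N -> l \notin js ->
  (forall u, W u -> forall i, (i < n)%N -> ana d (g i) u) -> eo d W -> W p ->
  (forall l' u, l' \in js -> W u -> g (c l') u = u l') -> f' != 0 ->
  (forall t, `|t| < s -> `|g j (upd p l (p l + t)) - g j p - f' * t| <= C * t ^+ 2) ->
  (forall V g', eo d V -> (forall u, V u -> forall i, (i < n)%N -> ana d (g' i) u) ->
     (forall l' u, l' \in l :: js -> V u -> g' (upd c l j l') u = u l') -> PU (img n g' V)) ->
  exists2 e : R, 0 < e & forall O, eo d O -> O `<=` close d e p -> O `<=` W -> PU (img n g O).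
Proof.
move=> s0 ld jn lj ag oW Wp gs f0 hC IH.
(* Slot [l] now carries the value of [g j], and the extra slot [d] carries the old parameter, which
   is the unknown of the equation [F = 0]. *)
pose q := upd (upd p l (g j p)) d (p l).
pose F x := g j (upd x l (x d)) - x l.
have dl : d != l by rewrite gtn_eqF.
have dlF : (d == l) = false by rewrite (negPf dl).
have ldF : (l == d) = false by rewrite eq_sym dlF.
have ldn : l != d by rewrite ldF.
have ql : q l = g j p by rewrite /q /upd ldF eqxx.
have qd : q d = p l by rewrite /q updE.
have qlt i : (i < d)%N -> upd q l (q d) i = p i.
  move=> id; rewrite qd /q /upd (ltn_eqF id); case: eqP => [->|] //.
have aq : ana d (g j) (upd q l (q d)).
  by apply: (ana_sat (ag p Wp j jn)) => i /qlt.
have gq : g j (upd q l (q d)) = g j p by apply: ana_congr aq _ => i /qlt.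
have aF : ana d.+1 F q.
  apply: anaB; last by apply: ana_coord; exact: leqW.
  apply: (ana_comp (d := d) (g := fun i x => upd x l (x d) i)) => [|i id]; first exact: aq.
  by rewrite /upd; case: (i == l); apply: ana_coord => //; exact: leqW.
have Fq : F q = 0 by rewrite /F gq ql subrr.
have [tw tw0 htw] := oW p Wp.
have m0 : 0 < Num.min s tw by rewrite lt_min s0.
have hF t : `|t| < Num.min s tw -> `|F (upd q d (q d + t)) - f' * t| <= C * t ^+ 2.
  rewrite lt_min => /andP[ts tt]; have := hC t ts.
  rewrite /F updE (upd_ne _ _ ldn) ql.
  have Wt : W (upd p l (p l + t)).
    by apply: htw; apply: close_upd; [exact: close_refl|rewrite addrAC subrr add0r].
  suff -> : g j (upd (upd q d (q d + t)) l (q d + t)) = g j (upd p l (p l + t)) by [].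
  apply: esym; apply: (ana_congr (ag _ Wt j jn)) => i id.
  rewrite qd /q /upd (ltn_eqF id); case: eqP => //.
have [xi [axi xiq [t1 t10 ht1]]] := ift aF Fq f0 m0 hF.
have [t2 t20 ht2] := ana_near axi.
have [t3 t30 ht3] := ana_cont axi t10.
pose s1 := Num.min t1 (Num.min t2 t3).
have s10 : 0 < s1 by rewrite !lt_min t10 t20.
have [s1t1 s1t2 s1t3] : [/\ s1 <= t1, s1 <= t2 & s1 <= t3].
  by split; rewrite !ge_min lexx ?orbT.
have [t4 t40 ht4] := ana_cont (ag p Wp j jn) s10.
pose e := Num.min s1 t4; have e0 : 0 < e by rewrite lt_min s10.
have [es1 et4] : e <= s1 /\ e <= t4 by split; rewrite ge_min lexx ?orbT.
exists e => // O oO Oe OW.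
pose hh i y := if i == l then xi y else y i : R.
have hhE y : (fun i => hh i y) = upd y l (xi y).
  by apply/funext => i; rewrite /hh /upd; case: eqP => // ->.
have axi1 y : close d s1 q y -> ana d xi y.
  by move=> hy; apply: ht2; exact: close_le hy.
have ahh y i : close d s1 q y -> (i < d)%N -> ana d (hh i) y.
  move=> hy id; rewrite /hh; case: (i == l); first exact: axi1.
  exact: ana_coord.
pose V := [set y | close d s1 q y /\ O (fun i => hh i y)].
have oV : eo d V by apply: (eo_preim (@eo_close _ d s1 q) oO) => u hu i; exact: ahh.
have xi_upd y v : close d s1 q y -> xi (upd y d v) = xi y.
  move=> hy; apply: esym; apply: (ana_congr (axi1 y hy)) => i id; by rewrite /upd ltn_eqF.
have PV : PU (img n (fun i y => g i (fun k => hh k y)) V).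
  apply: IH => // [y [hy Oy] i iN|l' y lj' [hy Oy]].
    by apply: (ana_comp (ag _ (OW _ Oy) i iN)) => k kd; exact: ahh.
  move: lj'; rewrite inE; case: eqP => [-> _|/eqP ll /= l'j]; last first.
    by rewrite {1}/upd (negPf ll) gs //; [rewrite /hh (negPf ll)|exact: OW].
  rewrite updE; pose x := upd y d (xi y).
  have cx : close d.+1 t1 q x.
    move=> i; rewrite ltnS leq_eqVlt /x /upd; case: eqP => [->|_ /= id].
      by rewrite -xiq => _; apply: ht3; exact: close_le hy.
    exact: lt_le_trans (hy i id) s1t1.
  have Fx : F x = 0 by apply/(ht1 x cx); rewrite /x updE xi_upd.
  have xd : x d = xi y by rewrite /x updE.
  have xl : x l = y l by rewrite /x upd_ne.
  move: Fx; rewrite /F xd xl => /eqP; rewrite subr_eq0 => /eqP <-.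
  apply: (ana_congr (ag _ (OW _ Oy) j jn)) => i id.
  by rewrite /hh /x /upd; case: eqP => // _; rewrite ltn_eqF.
suff -> : img n g O = img n (fun i y => g i (fun k => hh k y)) V by [].
apply/seteqP; split=> a; last first.
  by move=> [y [_ Oy] E]; exists (fun i => hh i y).
move=> [u Ou E]; pose y := upd u l (g j u).
have cu := Oe _ Ou.
have cy : close d s1 q y.
  move=> i id; rewrite /y /q /upd (ltn_eqF id); case: eqP => [_|_].
    by apply: ht4; exact: close_le cu.
  exact: lt_le_trans (cu i id) es1.
have xiy : xi y = u l.
  pose x := upd y d (u l).
  have cx : close d.+1 t1 q x.
    move=> i; rewrite ltnS leq_eqVlt /x {1}/upd; case: eqP => [-> _|_ /= id].
      by rewrite qd; apply: lt_le_trans (cu l ld) (le_trans es1 s1t1).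
    exact: lt_le_trans (cy i id) s1t1.
  have Fx : F x = 0.
    have xd : x d = u l by rewrite /x updE.
    have xl : x l = g j u by rewrite /x upd_ne // /y updE.
    rewrite /F xd xl.
    suff -> : g j (upd x l (u l)) = g j u by rewrite subrr.
    apply: esym; apply: (ana_congr (ag _ (OW _ Ou) j jn)) => i id.
    by rewrite /x /y /upd; case: eqP => [->|] //; rewrite ltn_eqF.
  by have := (ht1 x cx).1 Fx; rewrite /x updE xi_upd.
have hy : (fun i => hh i y) = u.
  by rewrite hhE xiy /y upd_upd upd_id.
by exists y; [split; rewrite ?hy|move=> i; rewrite E hy].
Qed.

(** A rank argument by double induction: on [d], and on the number of parameters not yet in [js],
    those in [js] being already equal to components ([c l] is the component equal to parameter [l]).
    If some component has a derivative in a further parameter that is not locally zero, the zeros of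
    this derivative form a set of dimension below [d], and elsewhere [straighten_step] adds the
    parameter to [js]. If there is none, the map is locally independent of the remaining parameters
    and [straight_piece] concludes. *)
Lemma image_PU d : img_PU d.
Proof.
elim/ltn_ind: d => d IHd n g0 W0 oW0 ag0.
suff H k : forall (js : seq nat) (c : nat -> nat) g W, (d - size js < k)%N -> uniq js ->
    (forall l, l \in js -> (l < d)%N) -> (forall l, l \in js -> (c l < n)%N) ->
    eo d W -> (forall u, W u -> forall i, (i < n)%N -> ana d (g i) u) ->
    (forall l u, l \in js -> W u -> g (c l) u = u l) -> PU (img n g W).
  by apply: (H d.+1 [::] id) => //; rewrite ltnS leq_subr.
elim: k => [//|k IHk] js c g W hk ujs jd jn oW ag gs.
have Wand T : [set z | T z /\ [set: nat -> R] z] = T by apply/seteqP; split=> z; [case|].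
have PhiU F : (forall i : nat, PU (img n g (F i))) -> PU (img n g [set z | exists i, F i z]).
  by move=> hF; rewrite img_union; exact: PU_union.
have Phi0 : PU (img n g set0) by rewrite img0; exact: PU_none.
rewrite -(Wand W); apply: (lindelof (Phi := fun T => PU (img n g T)) oW Phi0 PhiU) => p Wp.
have /choice[D hD] : forall lj : nat * nat, exists D : ((nat -> R) -> R) * (R * R),
  (lj.1 < d)%N -> (lj.2 < n)%N -> 0 < D.2.2 /\
  forall q, close d D.2.2 p q -> ana d D.1 q /\ forall t, `|t| < D.2.2 ->
    `|g lj.2 (upd q lj.1 (q lj.1 + t)) - g lj.2 q - D.1 q * t| <= D.2.1 * t ^+ 2.
  move=> [l j] /=; case: (pselect ((l < d)%N /\ (j < n)%N)) => [[ld jn']|nn].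
    by have [f' [C [s [s0 hs]]]] := ana_deriv (ag p Wp j jn') ld; exists (f', (C, s)).
  by exists (fun=> 0, (0, 0)) => ? ?; case: nn.
pose bad l j := [/\ (l < d)%N, (j < n)%N, l \notin js & ~ nearp d p (fun q => (D (l, j)).1 q = 0)].
case: (pselect (exists l j, bad l j)) => [[l [j [ld jn' lj nz]]]|nobad].
  have [s0 hs] := hD (l, j) ld jn'; rewrite /= in s0 hs nz.
  set f' := (D (l, j)).1 in hs nz; set C := (D (l, j)).2.1 in hs.
  set s := (D (l, j)).2.2 in s0 hs.
  have [af' _] := hs p (@close_refl _ d s p s0).
  have [t t0 ht] := not_near_zero_open af' nz.
  exists (Num.min s t) => [|O oO Os OW]; first by rewrite lt_min s0.
  have Oin q : O q -> close d s p q /\ close d t p q.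
    by move=> /Os h; split; apply: close_le h; rewrite ge_min lexx ?orbT.
  rewrite Wand.
  have -> : img n g O = img n g (zset O f') `|` img n g [set u | O u /\ f' u != 0].
    apply/seteqP; split=> a; last by move=> [[u [Ou _] E]|[u [Ou _] E]]; exists u.
    move=> [u Ou E]; case: (eqVneq (f' u) 0) => fu; [left|right]; by exists u.
  apply: PU_setU.
    have Z := (zero_set oO (fun u Ou => (hs u (Oin u Ou).1).1)).2
      (fun u Ou => ht u (Oin u Ou).2).
    apply: (PU_of_CP (m := d) _ Z); first by move=> d' /IHd.
    by move=> u [/OW Wu _]; exact: ag.
  have oO1 : eo d [set u | O u /\ f' u != 0].
    by apply: eo_near => // u Ou; apply: ana_neq0; exact: (hs u (Oin u Ou).1).1.
  rewrite -(Wand [set u | O u /\ f' u != 0]).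
  apply: (lindelof (Phi := fun T => PU (img n g T)) oO1 Phi0 PhiU) => u [Ou fu].
  have IH V g' : eo d V -> (forall u, V u -> forall i, (i < n)%N -> ana d (g' i) u) ->
     (forall l' u, l' \in l :: js -> V u -> g' (upd c l j l') u = u l') -> PU (img n g' V).
    move=> oV ag' gs'; apply: (IHk (l :: js) (upd c l j)) => //=.
    - have : (size (l :: js) <= size (iota 0 d))%N.
        apply: uniq_leq_size; first by rewrite /= lj.
        by move=> i; rewrite inE mem_iota /= => /predU1P[->|/jd].
      by rewrite size_iota /= => sd; move: hk; rewrite ltnS; lia.
    - by rewrite lj.
    - by move=> i; rewrite inE => /predU1P[->|/jd].
    - by move=> i; rewrite inE /upd; case: eqP => [//|_ /= /jn].
  have [e e0 he] := straighten_step s0 ld jn' lj ag oW (OW _ Ou) gs fu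
    (hs u (Oin u Ou).1).2 IH.
  exists e => // O' oO' O'e O'O1; rewrite Wand; apply: he => //.
  by move=> z /O'O1[/OW].
have [s s0 hs] : exists2 s : R, 0 < s & forall i, (i < d)%N -> forall j, (j < n)%N ->
    i \notin js -> s <= (D (i, j)).2.2 /\ forall q, close d s p q -> (D (i, j)).1 q = 0.
  apply: (@fin_common _ d (fun i s => forall j, (j < n)%N ->
    i \notin js -> s <= (D (i, j)).2.2 /\ forall q, close d s p q -> (D (i, j)).1 q = 0)).
    move=> i e e' /andP[_ ee] h j jn' ij; have [h1 h2] := h j jn' ij.
    by split; [exact: le_trans ee h1|move=> q /(close_le ee)/h2].
  move=> i id; apply: (@fin_common _ n (fun j s => i \notin js -> s <= (D (i, j)).2.2 /\
    forall q, close d s p q -> (D (i, j)).1 q = 0)).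
    move=> j e e' /andP[_ ee] h ij; have [h1 h2] := h ij.
    by split; [exact: le_trans ee h1|move=> q /(close_le ee)/h2].
  move=> j jn'; have [ij|ij] := boolP (i \in js); first by exists 1.
  have [z z0 hz] : nearp d p (fun q => (D (i, j)).1 q = 0).
    by apply: contrapT => nz; apply: nobad; exists i, j.
  have [D0 _] := hD (i, j) id jn'.
  exists (Num.min z (D (i, j)).2.2) => [|_]; first by rewrite lt_min z0.
  split; first by rewrite ge_min lexx orbT.
  by move=> q hq; apply: hz; apply: close_le hq; rewrite ge_min lexx.
have [t t0 ht] := oW p Wp.
pose r := Num.min s t; have r0 : 0 < r by rewrite lt_min s0.
have rs : r <= s by rewrite ge_min lexx.
have rW q : close d r p q -> W q.
  by move=> hq; apply: ht; apply: close_le hq; rewrite ge_min lexx orbT.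
exists r => // O oO Or OW; rewrite Wand.
apply: (straight_piece (d := d) (p := p) (js := js) (c := c) (s := r)) => //.
- by move=> q /rW; exact: ag.
- by move=> l q lj /rW; exact: gs.
- move=> i q iN; apply: (freeze_indep r0 _ _ (u := q)) => [q' /rW Wq|l ld lj]; first exact: ag.
  have [sD z] := hs l ld i iN lj.
  move=> q' v hq' hv.
  apply: (indep_of_deriv0 (C := (D (l, i)).2.1) (f' := (D (l, i)).1) r0 _ ld hq' hv) => y hy; split.
    by apply: z; exact: close_le hy.
  move=> u hu; have [_ h] := hD (l, i) ld iN.
  apply: (h y _).2; first by apply: close_le hy; exact: le_trans rs sD.
  by apply: lt_le_trans hu _; exact: le_trans rs sD.
Qed.

End AnalyticImages.
Arguments img {R} n g Z.

(** * Elimination of the last coordinate *)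

Section SignElimination.
Context {R : realType}.

(** A comparison is represented by the difference of its sides, whose sign settles it. *)
Fixpoint atoms (f : qe_rcf.formula R) : seq (qe_rcf.term R) :=
  match f with
  | qe_rcf.Bool _ => [::]
  | qe_rcf.Equal t u => [:: qe_rcf.Add t (qe_rcf.Opp u)]
  | qe_rcf.Lt t u => [:: qe_rcf.Add t (qe_rcf.Opp u)]
  | qe_rcf.Le t u => [:: qe_rcf.Add t (qe_rcf.Opp u)]
  | qe_rcf.And f1 f2 => atoms f1 ++ atoms f2
  | qe_rcf.Or f1 f2 => atoms f1 ++ atoms f2
  | qe_rcf.Implies f1 f2 => atoms f1 ++ atoms f2
  | qe_rcf.Not f1 => atoms f1
  end.

Definition same_signs (e e' : seq R) (ts : seq (qe_rcf.term R)) :=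
  forall i, (i < size ts)%N -> Num.sg (qe_rcf.eval e (nth (qe_rcf.NatConst R 0) ts i)) =
    Num.sg (qe_rcf.eval e' (nth (qe_rcf.NatConst R 0) ts i)).

Lemma same_signs_cat e e' ts us : same_signs e e' (ts ++ us) ->
  same_signs e e' ts /\ same_signs e e' us.
Proof.
move=> h; split=> i si.
  by have := h i; rewrite size_cat nth_cat si; apply; exact: ltn_addr.
have := h (size ts + i)%N; rewrite size_cat !nth_cat ltn_add2l.
by rewrite (ltnNge (_ + i)) leq_addr /= addKn => /(_ si).
Qed.

Lemma qf_eval_same_signs e e' f : same_signs e e' (atoms f) ->
  qe_rcf.qf_eval e f = qe_rcf.qf_eval e' f.
Proof.
elim: f => //=.
- move=> t u /(_ 0%N isT) /= h; rewrite -[LHS]subr_eq0 -[RHS]subr_eq0.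
  by rewrite -[LHS]sgr_eq0 h sgr_eq0.
- move=> t u /(_ 0%N isT) /= h; rewrite -[LHS]subr_lt0 -[RHS]subr_lt0.
  by rewrite -[LHS]sgr_lt0 h sgr_lt0.
- move=> t u /(_ 0%N isT) /= h; rewrite -[LHS]subr_le0 -[RHS]subr_le0.
  by rewrite -[LHS]sgr_le0 h sgr_le0.
- by move=> f IHf g IHg /same_signs_cat[/IHf -> /IHg ->].
- by move=> f IHf g IHg /same_signs_cat[/IHf -> /IHg ->].
- by move=> f IHf g IHg /same_signs_cat[/IHf -> /IHg ->].
- by move=> f IHf /IHf ->.
Qed.

Lemma horner_eval_poly e (s : seq (qe_rcf.term R)) (x : R) :
  (qe_rcf.eval_poly e s).[x] =
  \sum_(i < size s) qe_rcf.eval e (nth (qe_rcf.NatConst R 0) s i) * x ^+ i.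
Proof.
elim: s => [|t s IH] /=; first by rewrite big_ord0 horner0.
rewrite big_ord_recl /= expr0 mulr1 hornerD hornerMX hornerC IH addrC mulr_suml.
by congr (_ + _); apply: eq_bigr => i _; rewrite /bump /= add1n exprSr mulrA.
Qed.

(** An environment of [qe_rcf] is a single list, so the coefficients of polynomial [i] occupy the
    block of length [D] that starts at [i * D]. *)
Definition vpoly (D : nat) (e : seq R) (i : nat) (x : R) : R :=
  \sum_(k < D) nth 0 e (i * D + k) * x ^+ k.

(** For each of the finitely many sign patterns, [CcountGt0] is a quantifier-free condition on the
    coefficients for the pattern to be realised between [q1] and [q2]. Its truth depends only on the
    signs of its atoms, and [ts] collects the atoms for all patterns. *)
Lemma sign_elim (m D : nat) (q1 q2 : R) : exists ts : seq (qe_rcf.term R),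
  forall e e' : seq R, same_signs e e' ts ->
  forall w, q1 < w < q2 -> exists2 w', q1 < w' < q2 &
    forall i, (i < m)%N -> Num.sg (vpoly D e i w) = Num.sg (vpoly D e' i w').
Proof.
pose tp i := [seq qe_rcf.Var R (i * D + k) | k <- iota 0 D].
pose tn i := [seq qe_rcf.Opp (qe_rcf.Var R (i * D + k)) | k <- iota 0 D].
have tpE e i x : (qe_rcf.eval_poly e (tp i)).[x] = vpoly D e i x.
  rewrite horner_eval_poly size_map size_iota; apply: eq_bigr => k _.
  by rewrite (nth_map 0%N) ?size_iota // nth_iota.
have tnE e i x : (qe_rcf.eval_poly e (tn i)).[x] = - vpoly D e i x.
  rewrite horner_eval_poly size_map size_iota -sumrN; apply: eq_bigr => k _.
  by rewrite (nth_map 0%N) ?size_iota // nth_iota //= mulNr.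
pose sig := {ffun 'I_m -> option bool}.
pose sp (s : sig) := [seq tp (val i) | i <- enum 'I_m & s i == None].
(* The first two polynomials, [x - q1] and [q2 - x], keep the point inside the interval; negative
   signs are encoded by positivity of the opposite polynomial. *)
pose sq (s : sig) := [:: qe_rcf.Const (- q1); qe_rcf.NatConst R 1] ::
  [:: qe_rcf.Const q2; qe_rcf.Opp (qe_rcf.NatConst R 1)] ::
  [seq tp (val i) | i <- enum 'I_m & s i == Some true] ++
  [seq tn (val i) | i <- enum 'I_m & s i == Some false].
pose phi s := qe_rcf.CcountGt0 (sp s) (sq s).
pose ep e := @qe_rcf.eval_poly R e.
have spE e s : map (ep e) (sp s) = [seq ep e (tp (val i)) | i <- enum 'I_m & s i == None].
  by rewrite -map_comp.
have sqE e s : map (ep e) (sq s) = ep e [:: qe_rcf.Const (- q1); qe_rcf.NatConst R 1] ::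
    ep e [:: qe_rcf.Const q2; qe_rcf.Opp (qe_rcf.NatConst R 1)] ::
    [seq ep e (tp (val i)) | i <- enum 'I_m & s i == Some true] ++
    [seq ep e (tn (val i)) | i <- enum 'I_m & s i == Some false].
  by rewrite /= map_cat -!map_comp.
have phiP e (s : sig) : reflect (exists w, q1 < w < q2 /\ forall i : 'I_m,
    match s i with None => vpoly D e i w == 0 | Some true => 0 < vpoly D e i w
      | Some false => vpoly D e i w < 0 end) (qe_rcf.qf_eval e (phi s)).
  rewrite qe_rcf.eval_CcountGt0; apply: (iffP (qe_rcf_th.ccount_gt0P _ _)).
    move=> [w]; rewrite -/(ep e) spE sqE !big_all => /andP[/allP hp /allP hq]; exists w; split.
      have := hq _ (mem_head _ _); rewrite /ep /= !hornerE /= => h1.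
      have := hq (ep e [:: qe_rcf.Const q2; qe_rcf.Opp (qe_rcf.NatConst R 1)]).
      rewrite !inE eqxx orbT /ep /= !hornerE /= => /(_ isT) h2.
      by apply/andP; split; lra.
    move=> i; case E: (s i) => [[]|].
    - rewrite -tpE; apply: hq; rewrite !inE mem_cat.
      rewrite (map_f (fun i : 'I_m => ep e (tp (val i)))) ?orbT //.
      by rewrite mem_filter E eqxx mem_enum.
    - rewrite -oppr_gt0 -tnE; apply: hq; rewrite !inE mem_cat.
      rewrite [X in [|| _, _, _ | X]](map_f (fun i : 'I_m => ep e (tn (val i)))) ?orbT //.
      by rewrite mem_filter E eqxx mem_enum.
    - rewrite -tpE; apply: hp; apply: (map_f (fun i : 'I_m => ep e (tp (val i)))).
      by rewrite mem_filter E eqxx mem_enum.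
  move=> [w [hw H]]; exists w; rewrite -/(ep e) spE sqE !big_all.
  apply/andP; split; apply/allP => P.
    move=> /mapP[i]; rewrite mem_filter => /andP[/eqP si _] ->.
    by rewrite /ep tpE; have := H i; rewrite si.
  rewrite !inE => /or3P[/eqP ->|/eqP ->|].
  - by rewrite /= !hornerE /=; move: hw => /andP[? ?]; lra.
  - by rewrite /= !hornerE /=; move: hw => /andP[? ?]; lra.
  rewrite mem_cat => /orP[] /mapP[i]; rewrite mem_filter => /andP[/eqP si _] ->.
  - by rewrite /ep tpE; have := H i; rewrite si.
  - by rewrite /ep tnE oppr_gt0; have := H i; rewrite si.
exists (flatten [seq atoms (phi s) | s <- enum {: sig}]) => e e' H w hw.
pose s : sig := [ffun i : 'I_m => let v := vpoly D e i w in
  if v == 0 then None else Some (0 < v)].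
have he : qe_rcf.qf_eval e (phi s).
  apply/phiP; exists w; split=> // i; rewrite ffunE /=.
  case E: (vpoly D e i w == 0) => //; case L: (0 < vpoly D e i w) => //.
  by rewrite lt_neqAle E /= leNgt L.
have Hs : same_signs e e' (atoms (phi s)).
  have : s \in enum {: sig} by rewrite mem_enum.
  elim: (enum _) H => //= s' l IH /same_signs_cat[H1 H2].
  by rewrite inE => /predU1P[->|/(IH H2)].
rewrite (qf_eval_same_signs Hs) in he; have [w' [hw' H']] := phiP e' s he.
exists w' => // i im; have := H' (Ordinal im); rewrite ffunE /=.
case E: (vpoly D e i w == 0); first by move=> /eqP ->; rewrite (eqP E).
case L: (0 < vpoly D e i w) => h; first by rewrite !gtr0_sg.
by rewrite !ltr0_sg // lt_neqAle E /= leNgt L.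
Qed.

Lemma ana_eval d (m : nat) (a : nat -> (nat -> R) -> R) (t : qe_rcf.term R) p :
  (forall i, (i < m)%N -> ana d (a i) p) ->
  ana d (fun x => qe_rcf.eval (mkseq (fun i => a i x) m) t) p.
Proof.
move=> ha; elim: t => /=.
- move=> i; have [im|im] := ltnP i m.
    by under [X in ana d X]funext do rewrite nth_mkseq //; exact: ha.
  under [X in ana d X]funext do rewrite nth_default ?size_mkseq //; exact: ana_const.
- by move=> c; exact: ana_const.
- by move=> c; exact: ana_const.
- by move=> t ht u hu; exact: anaD.
- move=> t ht; under [X in ana d X]funext do rewrite -sub0r.
  by apply: anaB ht; exact: ana_const.
- move=> t ht n; under [X in ana d X]funext do rewrite -mulr_natr.
  by apply: anaM ht _; exact: ana_const.
- by move=> t ht u hu; exact: anaM.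
- by move=> t ht n; exact: anaX.
Qed.

End SignElimination.

Section Elimination.
Context {R : realType}.
Implicit Types (d m : nat) (p q x y z : nat -> R) (f : (nat -> R) -> R) (S O W Z : set (nat -> R)).

(* Semianalyticity of S near p on the side x_0 > 0, with no reference to a
   formula defining S. *)
Definition sa d S p := exists m (f : nat -> (nat -> R) -> R) (e : R),
  [/\ 0 < e, forall i, (i < m)%N -> ana d (f i) p &
   forall q q', close d e p q -> close d e p q' -> 0 < q 0%N -> 0 < q' 0%N ->
     (forall i, (i < m)%N -> Num.sg (f i q) = Num.sg (f i q')) -> S q -> S q'].

Definition cl d S p := forall e : R, 0 < e -> exists x, [/\ S x, 0 < x 0%N & close d e p x].

(** If every power of [rho] divided [f], the majorants [M / s ^+ k] would force [f] to vanish near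
    [p]. At the last possible power the quotient is not locally zero on [rho = 0], since otherwise
    it could be divided once more. *)
Lemma divide_rho d f p : ana d.+1 f p -> p 0%N = 0 -> ~ nearp d.+1 p (fun q => f q = 0) ->
  exists k g, [/\ ana d.+1 g p, nearp d.+1 p (fun q => f q = q 0%N ^+ k * g q) &
    ~ nearp d.+1 p (fun q => g (upd q 0%N 0) = 0)].
Proof.
move=> [s [M [s0 hM]]] p0 nf.
have sn : nng (fun _ : nat => s) by move=> j; exact: ltW.
pose F x := f (fun i => p i + x i).
pose E k := exists h, An d.+1 (fun=> s) (M / s ^+ k) h /\
  forall x, (forall i, (i < d.+1)%N -> `|x i| < s) -> F x = x 0%N ^+ k * h x.
have M0 := An_ge0 hM.
case: (pselect (forall k, E k)) => [allE|].
  exfalso; apply: nf; exists (s / 2); first by rewrite divr_gt0.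
  move=> q hq; pose x i := q i - p i.
  have fq : f q = F x by congr f; apply/funext => i; rewrite /x; ring.
  have xs i : (i < d.+1)%N -> `|x i| < s by move=> /hq h; apply: lt_trans h (half_lt s0).
  rewrite fq; apply: lt_eps_eq0 => e e0; have M1 : 0 < M + 1 by lra.
  have q0 : 0 <= `|x 0%N| / s by rewrite divr_ge0 // ltW.
  have q1 : `|x 0%N| / s < 1 by rewrite ltr_pdivrMr // mul1r xs.
  have [N hN] := expr_lt_eps q0 q1 (divr_gt0 e0 M1).
  have [h [hA hx]] := allE N; rewrite hx // normrM normrX.
  have hb : `|h x| <= M / s ^+ N by apply: An_le hA _ => i /xs /ltW.
  apply: (@le_lt_trans _ _ (`|x 0%N| ^+ N * (M / s ^+ N))).
    by rewrite ler_wpM2l // exprn_ge0.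
  have rN : s ^+ N != 0 by rewrite expf_neq0 // gt_eqF.
  have -> : `|x 0%N| ^+ N * (M / s ^+ N) = (`|x 0%N| / s) ^+ N * M.
    by rewrite expr_div_n; field.
  apply: (@le_lt_trans _ _ ((`|x 0%N| / s) ^+ N * (M + 1))).
    by rewrite ler_wpM2l ?exprn_ge0 // lerDl.
  by rewrite -ltr_pdivlMr.
move=> /existsNP nE.
have E0 : E 0%N.
  by exists F; split=> [|x _]; rewrite ?expr0 ?divr1 ?mul1r.
have [k [[h [hA hx]] nEk]] : exists k, E k /\ ~ E k.+1.
  apply: contrapT => H; have [k] := nE; apply; elim: k => // k IHk.
  by apply: contrapT => nEk; apply: H; exists k.
have mE x (T : R) : 0 < T -> (forall i, (i < d.+1)%N -> T * `|x i| <= s) ->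
    An 1 (fun=> T) (M / s ^+ k) (fun t => h (upd (fun i => t 0%N * x i) 0%N 0)).
  move=> T0 hT; have Tn : nng (fun _ : nat => T) by move=> j; exact: ltW.
  apply: (An_comp (g := fun i t => upd (fun i => t 0%N * x i) 0%N 0 i) sn Tn hA) => i id.
  rewrite /upd; case: (i == 0%N).
    by apply: An_monoM (An_const _ _ _); rewrite normr0 ltW.
  have := An_scale (x i) Tn (An_coord (ltn0Sn 0) Tn) => H.
  apply: An_ext (An_monoM _ H) => [t _|]; first by rewrite mulrC.
  by rewrite mulrC hT.
exists k, (fun q => h (fun i => q i - p i)); split.
- apply: (ana_comp (d := d.+1) (g := fun i q => q i - p i)) => [|i id].
    by apply: (ana_of_An sn hA) => i _; rewrite subrr normr0.
  by apply: anaB; [exact: ana_coord|exact: ana_const].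
- exists s => // q hq.
  have -> : f q = F (fun i => q i - p i) by congr f; apply/funext => i; ring.
  by rewrite (hx (fun i => q i - p i) hq) p0 subr0.
move=> [e e0 he]; apply: nEk.
have [h' hA' hx'] := An_peel sn (ltn0Sn d) s0 hA.
exists h'; split; first by rewrite exprSr invfM mulrA.
move=> x xs; rewrite hx // hx'; last by move=> i /xs /ltW.
suff -> : h (upd x 0%N 0) = 0 by rewrite add0r exprSr mulrA.
(* The quotient vanishes on [rho = 0] only near [p], but one more division needs this on the whole
   box: vanishing spreads along the ray from [p] towards [x], and [1 + de] leaves room beyond time
   1. *)
have [de de0 hde] : exists2 de : R, 0 < de & forall i, (i < d.+1)%N -> (1 + de) * `|x i| <= s.
  apply: (@fin_common _ d.+1 (fun i de => (1 + de) * `|x i| <= s)).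
    move=> i t t' /andP[t0 tt]; apply: le_trans; apply: ler_wpM2r => //.
    by rewrite lerD2l.
  move=> i id; have xi := xs i id; have x1 : 0 < `|x i| + 1 by rewrite ltr_wpDl.
  exists ((s - `|x i|) / (`|x i| + 1)); first by rewrite divr_gt0 // subr_gt0.
  rewrite mulrDl mul1r -lerBrDl mulrAC ler_pdivrMr //.
  by rewrite ler_wpM2l ?subr_ge0 ?(ltW xi) // lerDl.
have T0 : 0 < 1 + de by lra.
pose G t := h (upd (fun i => t * x i) 0%N 0).
have [z|[e1 e10 h1]] := line_dichotomy (G := G) T0 (mE x (1 + de) T0 hde).
  have h1 : `|1 : R| < 1 + de by rewrite normr1; lra.
  by rewrite -[RHS](z 1 h1) /G; congr (h (upd _ _ _)); apply/funext => i; rewrite mul1r.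
exfalso.
pose t := Num.min e1 (e / s) / 2.
have m0 : 0 < Num.min e1 (e / s) by rewrite lt_min e10 divr_gt0.
have t0 : 0 < t by rewrite divr_gt0.
have : t < Num.min e1 (e / s) by exact: half_lt.
rewrite lt_min => /andP[te ts]; clearbody t.
have /eqP := h1 t ltac:(by rewrite gtr0_norm // t0); apply.
have cl1 : close d.+1 e p (fun i => p i + t * x i).
  move=> i id; rewrite addrAC subrr add0r normrM gtr0_norm //.
  apply: (@le_lt_trans _ _ (t * s)); first by rewrite ler_wpM2l ?ltW // xs.
  by rewrite -ltr_pdivlMr.
have := he _ cl1; rewrite /G; congr (h _ = 0); apply/funext => i.
rewrite /upd; case: eqP => [->|_]; first by rewrite p0 subrr.
by ring.
Qed.

Lemma ana_prod_neq0 d (m : nat) (G : nat -> (nat -> R) -> R) p :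
  (forall i, (i < m)%N -> ana d (G i) p /\ ~ nearp d p (fun q => G i q = 0)) ->
  ~ nearp d p (fun q => \prod_(i < m) G i q = 0).
Proof.
elim: m => [_|m IH h].
  by move=> /nearp_self; rewrite big_ord0 => /eqP; rewrite oner_eq0.
have := ana_mul_neq0 (ana_prod (fun k km => (h k (leqW km)).1)) (h m (ltnSn m)).1
  (IH (fun k km => h k (leqW km))) (h m (ltnSn m)).2.
by apply: contra_not; apply: nearp_mono => q; rewrite big_ord_recr.
Qed.

Lemma sg_of_factor (f c u P : R) : c != 0 -> 0 < u -> f * c = u * P ->
  Num.sg f = Num.sg c * Num.sg P.
Proof.
move=> c0 u0 E; have /(congr1 Num.sg) := E; rewrite !sgrM (gtr0_sg u0) mul1r => <-.
by rewrite mulrCA -expr2 sqr_sg c0 mulr1.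
Qed.

Lemma shear_near d d' lam p (e : R) : (d < d')%N -> 0 < e ->
  nearp d' p (fun y => close d' e p (shear d lam p y)).
Proof.
move=> dd e0; apply: (nearp_all (P := fun i x => `|shear d lam p x i - p i| < e)) => i id.
have := ana_cont (ana_shear lam p p dd id) e0; rewrite shear_base; exact.
Qed.

(** In sheared coordinates and for [rho > 0], membership in [S] near [p] is decided by the signs of
    monic polynomials in the last variable. The condition [lam 0 = 0] means that the shear keeps
    [rho]. *)
Definition good_form N S p lam (eta : R) m (k : nat -> nat) (b : nat -> nat -> (nat -> R) -> R) :=
  [/\ lam N.+1 = 0, lam 0%N = 0, 0 < eta,
    forall i j, (i < m)%N -> (j < k i)%N -> forall x, close N.+1 eta p x -> ana N.+1 (b i j) x &
    forall q q', close N.+2 eta p q -> close N.+2 eta p q' -> 0 < q 0%N -> 0 < q' 0%N ->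
     (forall i, (i < m)%N -> Num.sg (pol (k i) (b i) q).[q N.+1 - p N.+1] =
                            Num.sg (pol (k i) (b i) q').[q' N.+1 - p N.+1]) ->
     S (shear N.+1 lam p q) -> S (shear N.+1 lam p q')].

(** One shear serves all [f i], since it is chosen for the product of their reduced factors. These
    are restricted to [rho = 0], hence insensitive to coordinate 0, so that component of the
    direction can be reset to 0. *)
Lemma reduction N S p : sa N.+2 S p -> p 0%N = 0 ->
  exists lam eta m k b, good_form N S p lam eta m k b.
Proof.
move=> [m [f [e [e0 fa hS]]]] p0.
have /choice[G hG] : forall i, exists kg : nat * ((nat -> R) -> R), (i < m)%N ->
    ~ nearp N.+2 p (fun q => f i q = 0) ->
    [/\ ana N.+2 kg.2 p, nearp N.+2 p (fun q => f i q = q 0%N ^+ kg.1 * kg.2 q) &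
    ~ nearp N.+2 p (fun q => kg.2 (upd q 0%N 0) = 0)].
  move=> i; case: (pselect ((i < m)%N /\ ~ nearp N.+2 p (fun q => f i q = 0))) => [[im nz]|n].
    by have [k [g hg]] := divide_rho (fa i im) p0 nz; exists (k, g).
  by exists (0%N, fun=> 0) => im nz; case: n.
(* An [f i] that vanishes near [p] imposes nothing and contributes the factor 1. *)
pose H i q := if `[< nearp N.+2 p (fun q => f i q = 0) >] then 1 else (G i).2 (upd q 0%N 0).
have hH i : (i < m)%N -> ana N.+2 (H i) p /\ ~ nearp N.+2 p (fun q => H i q = 0).
  move=> im; rewrite /H; case: asboolP => nz.
    split; first exact: ana_const.
    by move=> /nearp_self /eqP; rewrite oner_eq0.
  have [ga _ gn] := hG i im nz; split=> //.
  apply: (ana_comp (d := N.+2) (g := fun j q => upd q 0%N 0 j)) => [|j jd].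
    have -> : (fun j => upd p 0%N 0 j) = p.
      by apply/funext => j; rewrite /upd; case: eqP => // ->; rewrite p0.
    exact: ga.
  by rewrite /upd; case: (j == 0%N); [exact: ana_const|exact: ana_coord].
have [lam [lamd hlam]] := good_direction (ana_prod (fun i im => (hH i im).1)) (ana_prod_neq0 hH).
pose la := upd lam 0%N 0.
have lad : la N.+1 = 0 by rewrite /la upd_ne.
have lineH i (s : R) : (i < m)%N -> 0 < s -> exists t, `|t| < s /\
    H i (shear N.+1 lam p (upd p N.+1 (p N.+1 + t))) != 0.
  move=> im /hlam[t [ts]] /prodf_neq0 nz; exists t; split=> //.
  exact: (nz (Ordinal im)).
have loc i : (i < m)%N -> exists kb : nat * (nat -> (nat -> R) -> R), exists2 s : R, 0 < s &
   (forall j, (j < kb.1)%N -> forall x, close N.+1 s p x -> ana N.+1 (kb.2 j) x) /\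
   forall q q', close N.+2 s p q -> close N.+2 s p q' -> 0 < q 0%N -> 0 < q' 0%N ->
    Num.sg (pol kb.1 kb.2 q).[q N.+1 - p N.+1] = Num.sg (pol kb.1 kb.2 q').[q' N.+1 - p N.+1] ->
    Num.sg (f i (shear N.+1 la p q)) = Num.sg (f i (shear N.+1 la p q')).
  move=> im; have := lineH i ^~ im; rewrite /H; case: asboolP => [[s s0 hs] _|nz hl].
    have [t t0 ht] := shear_near la p (ltnSn N.+1) s0.
    exists (0%N, fun _ _ => 0); exists t => //; split=> // q q' /ht/hs -> /ht/hs -> //.
  have [ga gf gn] := hG i im nz.
  set k := (G i).1 in gf; set g := (G i).2 in ga gf gn.
  have gLa : ana N.+2 (fun y => g (shear N.+1 la p y)) p.
    apply: (ana_comp (d := N.+2) (g := fun j y => shear N.+1 la p y j)) => [|j jd].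
      have -> : (fun j => shear N.+1 la p p j) = p by exact: shear_base.
      exact: ga.
    exact: ana_shear.
  have hline (s : R) : 0 < s -> exists t, `|t| < s /\
      g (shear N.+1 la p (upd p N.+1 (p N.+1 + t))) != 0.
    move=> /hl[t [ts gt]]; exists t; split=> //; move: gt; congr (g _ != 0).
    apply/funext => j; rewrite /la /upd /shear eqxx; case: eqP => [->|_] //.
    by rewrite /= p0 mul0r addr0.
  have [n [b [s [c [s0 c0 hb hu]]]]] := weierstrass_at gLa hline.
  have [s1 s10 hs1] := gf.
  have [t t0 ht] := shear_near la p (ltnSn N.+1) s10.
  have st q : close N.+2 (Num.min s t) p q -> close N.+2 s p q /\ close N.+2 t p q.
    by move=> h; split; apply: close_le h; rewrite ge_min lexx ?orbT.
  exists (n, b); exists (Num.min s t) => /=; first by rewrite lt_min s0.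
  split=> [j jn x hx|q q' /st[qs /ht/hs1 fq] /st[q's /ht/hs1 fq'] q0 q0' sgq].
    by apply: hb => //; apply: close_le hx; rewrite ge_min lexx.
  have sh0 y : shear N.+1 la p y 0%N = y 0%N by rewrite /shear /la updE mul0r addr0.
  have [u u0 E] := hu q qs; have [u' u0' E'] := hu q' q's.
  rewrite fq fq' !sh0 !sgrM !sgrX (gtr0_sg q0) (gtr0_sg q0') !expr1n !mul1r.
  rewrite -horner_pol in E; rewrite -horner_pol in E'.
  by rewrite (sg_of_factor c0 u0 E) (sg_of_factor c0 u0' E') sgq.
have /choice[kb hkb] : forall i, exists kb : nat * (nat -> (nat -> R) -> R), (i < m)%N ->
   exists2 s : R, 0 < s &
   (forall j, (j < kb.1)%N -> forall x, close N.+1 s p x -> ana N.+1 (kb.2 j) x) /\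
   forall q q', close N.+2 s p q -> close N.+2 s p q' -> 0 < q 0%N -> 0 < q' 0%N ->
    Num.sg (pol kb.1 kb.2 q).[q N.+1 - p N.+1] = Num.sg (pol kb.1 kb.2 q').[q' N.+1 - p N.+1] ->
    Num.sg (f i (shear N.+1 la p q)) = Num.sg (f i (shear N.+1 la p q')).
  move=> i; case: (ltnP i m) => [/loc[kb hkb]|]; first by exists kb.
  by exists (0%N, fun _ _ => 0).
have [s s0 hs] := fin_common (fun i s s' (ss : 0 < s' <= s) (h :
   (forall j, (j < (kb i).1)%N -> forall x, close N.+1 s p x -> ana N.+1 ((kb i).2 j) x) /\
   forall q q', close N.+2 s p q -> close N.+2 s p q' -> 0 < q 0%N -> 0 < q' 0%N ->
    Num.sg (pol (kb i).1 (kb i).2 q).[q N.+1 - p N.+1] =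
    Num.sg (pol (kb i).1 (kb i).2 q').[q' N.+1 - p N.+1] ->
    Num.sg (f i (shear N.+1 la p q)) = Num.sg (f i (shear N.+1 la p q'))) =>
   conj (fun j jk x hx => h.1 j jk x (close_le (proj2 (andP ss)) hx))
        (fun q q' hq hq' => h.2 q q' (close_le (proj2 (andP ss)) hq)
            (close_le (proj2 (andP ss)) hq'))) hkb.
have [t t0 ht] := shear_near la p (ltnSn N.+1) e0.
have st q : close N.+2 (Num.min s t) p q -> close N.+2 s p q /\ close N.+2 t p q.
  by move=> h; split; apply: close_le h; rewrite ge_min lexx ?orbT.
exists la, (Num.min s t), m, (fun i => (kb i).1), (fun i => (kb i).2); split=> //.
- by rewrite lt_min s0.
- move=> i j im jk x hx; apply: (hs i im).1 => //; apply: close_le hx.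
  by rewrite ge_min lexx.
move=> q q' /st[qs /ht qe] /st[q's /ht q'e] q0 q0' sgs.
have sh0 y : shear N.+1 la p y 0%N = y 0%N by rewrite /shear /la updE mul0r addr0.
apply: hS => //; rewrite ?sh0 // => i im.
by apply: (hs i im).2 => //; exact: sgs.
Qed.

Definition slice N S p lam (q1 q2 : R) : set (nat -> R) :=
  [set x | exists2 w, q1 < w < q2 & S (shear N.+1 lam p (upd x N.+1 w))].

Lemma cl_slice N S p lam (q1 q2 : R) x : cl N.+2 (fun y => S (shear N.+1 lam p y)) x ->
  q1 < x N.+1 < q2 -> cl N.+1 (slice N S p lam q1 q2) x.
Proof.
move=> hx /andP[h1 h2] e e0.
pose t := Num.min e (Num.min (x N.+1 - q1) (q2 - x N.+1)).
have t0 : 0 < t by rewrite !lt_min e0 !subr_gt0 h1.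
have [y [Sy y0 hy]] := hx t t0.
exists y; split=> //; last first.
  by apply: close_sub (leqnSn _) _; apply: close_le hy; rewrite ge_min lexx.
exists (y N.+1); last by rewrite upd_id.
have := hy N.+1 (ltnSn _); rewrite !lt_min => /and3P[_].
by rewrite !ltr_norml => /andP[? ?] /andP[? ?]; apply/andP; split; lra.
Qed.

(** Whether a point lies in the slice depends only on which sign patterns of the monic polynomials
    occur over it, hence by [sign_elim] on the signs of finitely many terms in their coefficients.
    These terms are polynomial, so they are analytic in the remaining variables. *)
Lemma slice_sa N S p lam eta m k b (q1 q2 : R) z : good_form N S p lam eta m k b ->
  p N.+1 - eta <= q1 -> q2 <= p N.+1 + eta -> close N.+1 eta p z ->
  sa N.+1 (slice N S p lam q1 q2) z.
Proof.
move=> [_ _ eta0 hb hS] hq1 hq2 hz.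
pose D := (\max_(i < m) k i).+1.
have kD i : (i < m)%N -> (k i < D)%N.
  by move=> im; rewrite ltnS; exact: (@leq_bigmax _ (fun i : 'I_m => k i) (Ordinal im)).
have D0 : (0 < D)%N by [].
pose a l x := (pol (k (l %/ D)%N) (b (l %/ D)%N) x)`_(l %% D)%N.
pose E x := mkseq (fun l => a l x) (m * D).
have vE x i w : (i < m)%N -> vpoly D (E x) i w = (pol (k i) (b i) x).[w].
  move=> im; rewrite (horner_coef_wide (n := D)); last by rewrite size_pol; exact: kD.
  apply: eq_bigr => j _; rewrite nth_mkseq; last first.
    by apply: (@leq_trans (i.+1 * D)); [rewrite mulSn addnC ltn_add2r|rewrite leq_pmul2r].
  by rewrite /a divnMDl // divn_small // addn0 modnMDl modn_small.
have [ts hts] := sign_elim m D (q1 - p N.+1) (q2 - p N.+1).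
have [t t0 ht] := @eo_close _ N.+1 eta p z hz.
exists (size ts), (fun i x => qe_rcf.eval (E x) (nth (qe_rcf.NatConst R 0) ts i)), t.
split=> // [i its|q q' hq hq' q0 q0' sgs [w hw Sw]].
  apply: (ana_eval (a := a)) => l lm.
  have im : (l %/ D < m)%N by rewrite ltn_divLR.
  rewrite /a; under [X in ana _ X]funext do rewrite coef_pol.
  by case: ltnP => h; [exact: hb|exact: ana_const].
have hw' : q1 - p N.+1 < w - p N.+1 < q2 - p N.+1 by rewrite !ltrD2r.
have [v hv hsg] := hts (E q) (E q') sgs _ hw'.
have hv' : q1 < v + p N.+1 < q2 by move: hv => /andP[? ?]; apply/andP; split; lra.
exists (v + p N.+1); first exact: hv'.
have cu x u : close N.+1 t z x -> q1 < u < q2 -> close N.+2 eta p (upd x N.+1 u).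
  move=> /ht hx /andP[u1 u2] i; rewrite ltnS leq_eqVlt /upd; case: eqP => [-> _|_ /= /hx //].
  by rewrite ltr_norml; apply/andP; split; lra.
have polu x u i : (i < m)%N -> close N.+1 t z x ->
    pol (k i) (b i) (upd x N.+1 u) = pol (k i) (b i) x.
  move=> im /ht hx; apply/polyP => j; rewrite !coef_pol; case: ltnP => // jk.
  apply: esym; apply: (ana_congr (hb i j im jk x hx)) => l lN.
  by rewrite upd_ne // ltn_eqF.
apply: (hS (upd q N.+1 w)) => //.
- exact: cu.
- exact: cu.
move=> i im; rewrite !updE addrK !polu // -!vE //; exact: hsg.
Qed.

Lemma cl_shear d d' S lam p (q : nat -> R) : (d < d')%N -> (0 < d)%N -> lam d = 0 -> lam 0%N = 0 ->
  cl d' S (shear d lam p q) -> cl d' (fun y => S (shear d lam p y)) q.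
Proof.
move=> dd d0 ld l0 h e e0.
have L'K : cancel (shear d (fun i => - lam i) p) (shear d lam p).
  move=> y; have := shearK p (lam := fun i => - lam i) (d := d).
  rewrite ld oppr0 => /(_ erefl y); congr (_ = _).
  by congr (shear _ _ _ _); apply/funext => i; rewrite opprK.
pose x0 := shear d lam p q.
have [t t0 ht] : nearp d' x0 (fun y => close d' e q (shear d (fun i => - lam i) p y)).
  apply: (nearp_all (P := fun i y => `|shear d (fun i => - lam i) p y i - q i| < e)) => i id.
  have := ana_cont (ana_shear (fun i => - lam i) p x0 dd id) e0.
  by rewrite /x0 shearK.
have [y [Sy y0 hy]] := h t t0.
exists (shear d (fun i => - lam i) p y); split; first by rewrite L'K.
  by rewrite /shear l0 oppr0 mul0r addr0.
exact: ht.
Qed.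

(** In the single variable [rho], each [f i] either vanishes near 0 or is a power of [rho] times a
    function that is nonzero at 0; its sign is constant for small [rho > 0]. *)
Lemma sa_near_const S p : sa 1 S p -> p 0%N = 0 -> exists2 s : R, 0 < s &
  forall q q', close 1 s p q -> close 1 s p q' -> 0 < q 0%N -> 0 < q' 0%N -> S q -> S q'.
Proof.
move=> [m [f [e [e0 fa hS]]]] p0.
have [s s0 hs] : exists2 s : R, 0 < s & forall i, (i < m)%N -> forall q q',
    close 1 s p q -> close 1 s p q' -> 0 < q 0%N -> 0 < q' 0%N ->
    Num.sg (f i q) = Num.sg (f i q').
  apply: (@fin_common _ m (fun i s => forall q q', close 1 s p q -> close 1 s p q' ->
     0 < q 0%N -> 0 < q' 0%N -> Num.sg (f i q) = Num.sg (f i q'))).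
    move=> i s s' /andP[_ ss] h q q' hq hq'; apply: h; exact: close_le ss _.
  move=> i im; case: (pselect (nearp 1 p (fun q => f i q = 0))) => [[s s0 hs]|nz].
    by exists s => // q q' /hs -> /hs ->.
  have [k [g [ga [s s0 hs] gn]]] := divide_rho (fa i im) p0 nz.
  have gp : g p != 0.
    apply/eqP => gp0; apply: gn.
    apply: nearp_mono (ana_near ga) => q gq.
    rewrite -[RHS]gp0; apply: esym; apply: (ana_congr ga) => -[|//] _.
    by rewrite updE.
  have gc : ana 1 (fun q => g q * g p) p by apply: anaM ga _; exact: ana_const.
  have gpp : 0 < g p * g p by rewrite -expr2 exprn_even_gt0.
  have [t t0 ht] := ana_gt0 gc gpp.
  exists (Num.min s t) => [|q q' hq hq' q0 q0']; first by rewrite lt_min s0.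
  have E x : close 1 (Num.min s t) p x -> 0 < x 0%N -> Num.sg (f i x) = Num.sg (g p).
    move=> hx x0; rewrite hs; last by apply: close_le hx; rewrite ge_min lexx.
    rewrite sgrM sgrX gtr0_sg // expr1n mul1r.
    have := ht x _; rewrite -sgr_gt0 sgrM => H.
    have {}H := H (close_le _ hx); have {}H := H ltac:(by rewrite ge_min lexx orbT).
    by move: H; case: (sgrP (g x)); case: (sgrP (g p)); rewrite ?mulr0 ?mul0r ?ltxx //;
      rewrite ?mulrN1 ?mulN1r ?mul1r ?mulr1 ?opprK; lra.
  by rewrite !E.
exists (Num.min s e) => [|q q' hq hq' q0 q0' Sq]; first by rewrite lt_min s0.
apply: (hS q) => //; try by (apply: close_le hq; rewrite ge_min lexx orbT).
  by apply: close_le hq'; rewrite ge_min lexx orbT.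
move=> i im; apply: (hs i im) => //.
  by apply: close_le hq; rewrite ge_min lexx.
by apply: close_le hq'; rewrite ge_min lexx.
Qed.

(* Replaces curve selection: the last coordinate is eliminated by sign_elim. *)
Lemma cl_all_rho N S p : sa N.+1 S p -> p 0%N = 0 -> cl N.+1 S p ->
  forall e : R, 0 < e -> exists2 de : R, 0 < de & forall rho, 0 < rho < de ->
    exists x, [/\ S x, x 0%N = rho & close N.+1 e p x].
Proof.
elim: N S p => [|N IH] S p hsa p0 hcl e e0.
  have [s s0 hs] := sa_near_const hsa p0.
  have [x [Sx x0 hx]] := hcl s s0.
  exists (Num.min s e) => [|rho /andP[r0]]; first by rewrite lt_min s0.
  rewrite lt_min => /andP[rs re]; exists (fun=> rho); split=> //.
    apply: (hs x) => // -[|//] _; by rewrite p0 subr0 gtr0_norm.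
  by move=> -[|//] _; rewrite p0 subr0 gtr0_norm.
have [lam [eta [m [k [b gf]]]]] := reduction hsa p0.
have [lamd lam0 eta0 _ _] := gf.
have hcl' : cl N.+2 (fun y => S (shear N.+1 lam p y)) p.
  by apply: cl_shear => //; rewrite shear_base.
have [t t0 ht] := shear_near lam p (ltnSn N.+1) e0.
pose c := Num.min eta t; have c0 : 0 < c by rewrite lt_min eta0.
have ceta : c <= eta by rewrite ge_min lexx.
have ct : c <= t by rewrite ge_min lexx orbT.
have sS : sa N.+1 (slice N S p lam (p N.+1 - c) (p N.+1 + c)) p.
  by apply: slice_sa gf _ _ _; [lra|lra|exact: close_refl].
have cS : cl N.+1 (slice N S p lam (p N.+1 - c) (p N.+1 + c)) p.
  by apply: cl_slice => //; apply/andP; split; lra.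
have [de de0 hde] := IH _ p sS p0 cS c c0.
exists de => // rho /hde[x [[w hw Sw] xr hx]].
exists (shear N.+1 lam p (upd x N.+1 w)); split=> //.
  by rewrite /shear lam0 mul0r addr0 upd_ne.
apply: ht => i; rewrite ltnS leq_eqVlt /upd; case: eqP => [-> _|_ /= iN].
  by rewrite ltr_norml; move: hw => /andP[? ?]; apply/andP; split; lra.
exact: lt_le_trans (hx i iN) ct.
Qed.

End Elimination.

(** * Closures of semianalytic sets *)

Section ClosureSets.
Context {R : realType}.
Implicit Types (d m : nat) (p q x y z : nat -> R) (f : (nat -> R) -> R) (S O W Z : set (nat -> R)).

(** [Z] ignores coordinate [N.+1], so it becomes a cylinder with one more parameter, placed in slot
    [e]. The condition [f y = 0] is pulled back to a zero set in the parameters, to which [zero_set]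
    applies. *)
Lemma CP_slice N m Z O f : CP N.+1 m Z -> eo N.+2 O -> (forall y, O y -> ana N.+2 f y) ->
  CP N.+2 m.+1 [set y | Z y /\ (O y /\ f y = 0)].
Proof.
move=> hZ oO fa; elim: hZ => [|e W g em oW hg|F hF IH].
- by apply: CP_empty => y [].
- pose gg i u := if i == N.+1 then u e else g i u.
  have ggE u : (fun i => gg i u) = upd (fun i => g i u) N.+1 (u e).
    by apply/funext => i; rewrite /gg /upd; case: eqP.
  have oW' : eo e.+1 W by move=> u /oW; exact: nearp_sub (leqnSn e).
  have agg u i : W u -> (i < N.+2)%N -> ana e.+1 (gg i) u.
    move=> Wu; rewrite ltnS leq_eqVlt /gg; case: eqP => [_ _|_ /= iN]; first exact: ana_coord.
    by apply: ana_raise (leqnSn e) (hg u Wu i iN).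
  have oV := eo_preim oW' oO (fun u Wu i => agg u i Wu).
  have [Z1 _] := zero_set (F := fun u => f (fun i => gg i u)) oV
    (fun u Vu => ana_comp (fa _ Vu.2) (fun i id => agg u i Vu.1 id)).
  have Z2 : CP N.+2 e.+2 _ := CP_image (h := gg) Z1 (fun u Vu i id => agg u i Vu.1.1 id).
  apply: (@CP_mono _ _ e.+2 m.+1 _ em); apply: CP_ext Z2 => y; split.
    move=> [u [[Wu Ou] fu] yu].
    have Oy : O y by apply: (eo_sat oO _ Ou) => i /yu ->.
    split; last split=> //.
      by exists u => // i iN; rewrite (yu i (leqW iN)) /gg (ltn_eqF iN).
    by rewrite -[RHS]fu; apply: (ana_congr (fa y Oy)).
  move=> [[u Wu yu] [Oy fy]]; pose u' := upd u e (y N.+1).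
  have Wu' : W u' by apply: (eo_sat oW _ Wu) => i ie; rewrite /u' upd_ne // ltn_eqF.
  have yu' i : (i < N.+2)%N -> y i = gg i u'.
    rewrite ltnS leq_eqVlt /gg; case: eqP => [-> _|_ /= iN]; first by rewrite /u' updE.
    rewrite yu //; apply: (ana_congr (hg u Wu i iN)) => l le.
    by rewrite /u' upd_ne // ltn_eqF.
  have Ou' : O (fun i => gg i u') by apply: (eo_sat oO _ Oy) => i /yu'.
  exists u' => //; split; first by split.
  by rewrite -[RHS]fy; apply: esym; apply: (ana_congr (fa y Oy)).
- apply: CP_ext (CP_union IH) => y; split.
    by move=> [n [Fy H]]; split=> //; exists n.
  by move=> [[n Fy] H]; exists n.
Qed.

Lemma CP_mono_d_cl d S x y : cl d S x -> (forall i, (i < d)%N -> x i = y i) -> cl d S y.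
Proof.
move=> hx xy e /hx[z [Sz z0 hz]]; exists z; split=> // i id; rewrite -xy //; exact: hz.
Qed.

Definition coef_ana d (P : (nat -> R) -> {poly R}) x := forall i, ana d (fun y => (P y)`_i) x.

Lemma coef_ana_prod d m (P : nat -> (nat -> R) -> {poly R}) x :
  (forall i, (i < m)%N -> coef_ana d (P i) x) -> coef_ana d (fun y => \prod_(i < m) P i y) x.
Proof.
elim: m => [_|m IH h] l.
  under [X in ana d X]funext do rewrite big_ord0 coefC; exact: ana_const.
under [X in ana d X]funext do rewrite big_ord_recr coefM.
apply: (ana_sum (F := fun j y => (\prod_(i < m) P i y)`_j * (P m y)`_(l - j))) => j _.
by apply: anaM; [apply: IH => i im; apply: h; exact: leqW|exact: h].
Qed.

Lemma coef_ana_pol d k b x : (forall j, (j < k)%N -> ana d (b j) x) -> coef_ana d (pol k b) x.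
Proof.
move=> hb i; under [X in ana d X]funext do rewrite coef_pol.
by case: ltnP => h; [exact: hb|exact: ana_const].
Qed.

Lemma poly_sg_const (P : {poly R}) (a b : R) :
  (forall t, Num.min a b <= t <= Num.max a b -> P.[t] != 0) -> Num.sg P.[a] = Num.sg P.[b].
Proof.
wlog ab : a b / a <= b.
  move=> H h; have [ab|ba] := leP a b; first exact: H.
  by apply: esym; apply: H; [exact: ltW|move=> t; rewrite minC maxC; exact: h].
rewrite (min_idPl ab) (max_idPr ab) => h.
have Pa : P.[a] != 0 by apply: h; rewrite lexx.
have Pb : P.[b] != 0 by apply: h; rewrite lexx andbT.
have key (Q : {poly R}) : (forall t, a <= t <= b -> Q.[t] != 0) -> Q.[a] < 0 -> 0 < Q.[b] -> False.
  move=> hQ qa qb; have [t ht /rootP qt] : exists2 t, a <= t <= b & root Q t.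
    by apply: poly_ivt => //; rewrite (ltW qa) (ltW qb).
  by have := hQ t ht; rewrite qt eqxx.
case: (ltrgt0P P.[a]) Pa => // pa _; case: (ltrgt0P P.[b]) Pb => // pb _.
- by rewrite !gtr0_sg.
- exfalso; apply: (key (- P)); rewrite ?hornerN ?oppr_lt0 ?oppr_gt0 // => t /h.
  by rewrite hornerN oppr_eq0.
- by exfalso; exact: (key P).
- by rewrite !ltr0_sg.
Qed.

Lemma nderiv_neq0 (P : {poly R}) (w : R) : P != 0 ->
  exists j, [/\ (j < size P)%N, P^`N(j).[w] != 0 & forall i, (i < j)%N -> P^`N(i).[w] = 0].
Proof.
move=> P0; have ex : exists j, (j < size P)%N && (P^`N(j).[w] != 0).
  apply: contrapT => H.
  have z (j : 'I_(size P)) : P^`N(j).[w] = 0.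
    by apply/eqP/negPn/negP => nz; apply: H; exists j; rewrite ltn_ord.
  have rt (x : R) : root P x.
    apply/rootP; have -> : x = w + (x - w) by ring.
    by rewrite (nderiv_taylor _ (mulrC _ _)) big1 // => i _; rewrite z mul0r.
  have := max_poly_roots (rs := [seq i%:R | i <- iota 0 (size P)]) P0.
  rewrite size_map size_iota ltnn => H'; apply: notF; apply: H'.
    by apply/allP => x _.
  by rewrite map_inj_uniq ?iota_uniq // => a b /eqP; rewrite eqr_nat => /eqP.
have [j /andP[jP hj] jmin] := ex_minnP ex; exists j; split=> // i ij.
apply/eqP/negPn/negP => nz; have := jmin i; rewrite nz (ltn_trans ij jP) => /(_ isT).
by rewrite leqNgt ij.
Qed.

(** The term of order [j] dominates because every later one carries a further factor [|h|]. *)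
Lemma taylor_lower (c : nat -> R) (n j : nat) (h L : R) : (forall i, (i < j)%N -> c i = 0) ->
  (j < n)%N -> `|h| <= 1 -> \sum_(i < n) `|c i| <= L ->
  `|h| ^+ j * (`|c j| - `|h| * L) <= `|\sum_(i < n) c i * h ^+ i|.
Proof.
move=> c0 jn h1 hL; rewrite (bigD1 (Ordinal jn)) //=; set T := \sum_(_ < _ | _) _.
have hT : `|T| <= `|h| ^+ j.+1 * L.
  apply: le_trans (ler_norm_sum _ _ _) _.
  apply: (@le_trans _ _ (\sum_(i < n) `|h| ^+ j.+1 * `|c i|)).
    rewrite [X in _ <= X](bigID (fun i => i != Ordinal jn)) /=.
    rewrite -[X in X <= _]addr0; apply: lerD; last first.
      by apply: sumr_ge0 => i _; rewrite mulr_ge0 // exprn_ge0.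
    apply: ler_sum => i ij; rewrite normrM normrX mulrC.
    case: (ltnP i j) => [/c0 ->|ji]; first by rewrite normr0 !mulr0.
    apply: ler_wpM2r => //; apply: ler_wiXn2l => //.
    by rewrite ltn_neqAle ji andbT eq_sym.
  by rewrite -mulr_sumr; apply: ler_wpM2l; rewrite ?exprn_ge0.
have -> : `|h| ^+ j * (`|c j| - `|h| * L) = `|c j * h ^+ j| - `|h| ^+ j.+1 * L.
  by rewrite normrM normrX exprSr; ring.
have := ler_normB (c j * h ^+ j + T) T; rewrite addrK => hh.
by rewrite lerBlDr; apply: le_trans hh _; rewrite lerD2l.
Qed.

Section GoodForm.
Variables (N m : nat) (S : set (nat -> R)) (p lam : nat -> R) (eta : R) (k : nat -> nat)
  (b : nat -> nat -> (nat -> R) -> R).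
Hypothesis gf : good_form N S p lam eta m k b.

Let S' := [set y | S (shear N.+1 lam p y)].
(** Between two consecutive roots of the product no factor changes sign. The [q i y] are the Taylor
    coefficients of [Q y] at the last coordinate of [y], taken as divided derivatives. *)
Let Q y : {poly R} := \prod_(i < m) pol (k i) (b i) y.
Let D := (\sum_(i < m) k i)%N.
Let q i y : R := (Q y)^`N(i).[y N.+1 - p N.+1].

Lemma size_Q y : (size (Q y) <= D.+1)%N.
Proof.
rewrite /Q /D; elim: (m) => [|n IH]; first by rewrite !big_ord0 size_poly1.
rewrite !big_ord_recr /=; apply: leq_trans (size_polyMleq _ _) _.
by rewrite size_pol addnS /= -addSn leq_add2r.
Qed.

Lemma Q_neq0 y : Q y != 0.
Proof. by apply/prodf_neq0 => i _; rewrite -size_poly_eq0 size_pol. Qed.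

Lemma Q_coef_ana y : close N.+1 eta p y -> coef_ana N.+1 Q y.
Proof.
move=> hy; have [_ _ _ hb _] := gf.
by apply: (coef_ana_prod (P := fun i => pol (k i) (b i))) => i im; apply: coef_ana_pol => j jk;
  exact: hb.
Qed.

Lemma q_ana i y : close N.+2 eta p y -> ana N.+2 (q i) y.
Proof.
move=> hy; apply: (ana_horner (N := D.+1)) => [z|l _|].
- apply/leq_sizeP => l Dl; rewrite coef_nderivn nth_default ?mul0rn //.
  by apply: leq_trans (size_Q z) _; exact: leq_trans Dl (leq_addl _ _).
- under [X in ana _ X]funext do rewrite coef_nderivn -mulr_natr.
  apply: anaM; last exact: ana_const.
  apply: ana_raise (leqnSn N.+1) _; apply: Q_coef_ana.
  exact: close_sub (leqnSn _) hy.
- by apply: anaB; [exact: ana_coord|exact: ana_const].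
Qed.

Lemma Q_taylor y (v : R) :
  (Q y).[v - p N.+1] = \sum_(i < D.+1) q i y * (v - y N.+1) ^+ i.
Proof.
have -> : v - p N.+1 = (y N.+1 - p N.+1) + (v - y N.+1) by ring.
rewrite (nderiv_taylor_wide (mulrC _ _) (size_Q y)).
by [].
Qed.

Lemma Q_uniform y (c : R) : close N.+1 eta p y -> 0 < c ->
  nearp N.+1 y (fun x => forall t : R, `|t| <= 1 -> `|(Q x).[t] - (Q y).[t]| < c).
Proof.
move=> hy c0; have D1 : 0 < D.+1%:R :> R by rewrite ltr0n.
have H : nearp N.+1 y (fun x => forall i, (i < D.+1)%N -> `|(Q x)`_i - (Q y)`_i| < c / D.+1%:R).
  apply: (nearp_all (P := fun i x => `|(Q x)`_i - (Q y)`_i| < c / D.+1%:R)) => i _.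
  by apply: (ana_cont (f := fun x => (Q x)`_i)); [exact: Q_coef_ana|exact: divr_gt0].
apply: nearp_mono H => x hx t t1.
rewrite !(horner_coef_wide _ (size_Q _)) -sumrB.
apply: le_lt_trans (ler_norm_sum _ _ _) _.
have -> : c = \sum_(i < D.+1) c / D.+1%:R.
  by rewrite sumr_const card_ord -[_ *+ _]mulr_natr divfK // gt_eqF.
apply: ltr_sum => [|i _]; first by apply/hasP; exists ord0; rewrite ?mem_index_enum.
rewrite -mulrBl normrM normrX; apply: le_lt_trans (hx i (ltn_ord i)).
by rewrite ler_piMr // exprn_ile1.
Qed.

Lemma move_last x (v w : R) : close N.+2 eta p (upd x N.+1 w) -> close N.+2 eta p (upd x N.+1 v) ->
  0 < x 0%N -> (forall t, Num.min w v <= t <= Num.max w v -> (Q x).[t - p N.+1] != 0) ->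
  S' (upd x N.+1 w) -> S' (upd x N.+1 v).
Proof.
move=> cw cv x0 nz; have [_ _ _ hb hS] := gf.
have polu u i : (i < m)%N -> close N.+2 eta p (upd x N.+1 u) ->
    pol (k i) (b i) (upd x N.+1 u) = pol (k i) (b i) x.
  move=> im hu; apply/polyP => j; rewrite !coef_pol; case: ltnP => // jk.
  have hx : close N.+1 eta p x.
    by move=> l lN; have := hu l (leqW lN); rewrite upd_ne // ltn_eqF.
  apply: esym; apply: (ana_congr (hb i j im jk x hx)) => l lN.
  by rewrite upd_ne // ltn_eqF.
apply: (hS (upd x N.+1 w)) => // i im; rewrite !updE !polu //.
apply: poly_sg_const => t ht; have := nz (t + p N.+1); rewrite addrK => H.
have : (Q x).[t] != 0.
  apply: H; move: ht; rewrite /Num.min /Num.max ltrD2r.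
  by case: ltP => _ /andP[? ?]; apply/andP; split; lra.
by rewrite /Q horner_prod => /prodf_neq0 /(_ (Ordinal im) isT).
Qed.

(** The converse of [cl_slice] for a short interval. The Taylor bound leaves no root of [Q y] in it
    except possibly [y N.+1]. A point of [S'] over some [x] near [y] can therefore be slid towards
    [y N.+1] until it is within [e], without crossing a root of [Q x], hence without leaving
    [S']. *)
Lemma slice_cl y (q1 q2 : R) (j : nat) (L : R) : close N.+2 eta p y -> eta <= 1 ->
  p N.+1 - eta <= q1 -> q2 <= p N.+1 + eta -> q2 - q1 <= 1 -> q1 < y N.+1 < q2 ->
  (j < D.+1)%N -> (forall i, (i < j)%N -> q i y = 0) -> \sum_(i < D.+1) `|q i y| <= L ->
  (q2 - q1) * L < `|q j y| -> cl N.+1 (slice N S p lam q1 q2) y -> cl N.+2 S' y.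
Proof.
move=> hy eta1 hq1 hq2 q12 /andP[yq1 yq2] jD qz hL qj hcl e e0.
pose w0 := y N.+1; pose ka := `|q j y| - (q2 - q1) * L.
have ka0 : 0 < ka by rewrite subr_gt0.
have L0 : 0 <= L by apply: le_trans hL; apply: sumr_ge0.
have lower v : q1 < v < q2 -> `|v - w0| ^+ j * ka <= `|(Q y).[v - p N.+1]|.
  move=> /andP[v1 v2]; have vw : `|v - w0| <= q2 - q1.
    by rewrite /w0 ler_norml; apply/andP; split; lra.
  rewrite Q_taylor; apply: le_trans (taylor_lower qz jD _ hL); last exact: le_trans vw q12.
  by apply: ler_wpM2l; [exact: exprn_ge0|rewrite /ka lerD2l lerN2 ler_wpM2r].
pose e1 := e / 2; have e10 : 0 < e1 by rewrite divr_gt0.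
have c0 : 0 < e1 ^+ j * ka by rewrite mulr_gt0 // exprn_gt0.
have hy1 : close N.+1 eta p y by exact: close_sub (leqnSn _) hy.
(* At distance at least [e1] from [w0], [|Q y|] is at least [e1 ^+ j * ka]; for [x] this close to
   [y], [Q x] has no root there either. *)
have [s s0 hs] := Q_uniform hy1 c0.
have [t t0 ht] := eo_close hy1.
pose r := Num.min (Num.min s t) e; have r0 : 0 < r by rewrite !lt_min s0 t0.
have [x [[w /andP[w1 w2] Sw] x0 hx]] := hcl r r0.
have hxs : close N.+1 s y x by apply: close_le hx; rewrite !ge_min lexx.
have hxt : close N.+1 eta p x.
  by apply: ht; apply: close_le hx; rewrite !ge_min lexx orbT.
have hxe : close N.+1 e y x by apply: close_le hx; rewrite !ge_min lexx !orbT.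
have cup u : q1 < u < q2 -> close N.+2 eta p (upd x N.+1 u).
  move=> /andP[u1 u2] i; rewrite ltnS leq_eqVlt /upd; case: eqP => [-> _|_ /= /hxt //].
  by rewrite ltr_norml; apply/andP; split; lra.
have nzQ u : q1 < u < q2 -> e1 <= `|u - w0| -> (Q x).[u - p N.+1] != 0.
  move=> hu ue; have hl := lower u hu; have /andP[u1 u2] := hu.
  have u1' : `|u - p N.+1| <= 1 by rewrite ler_norml; apply/andP; split; lra.
  have := hs x hxs _ u1'; apply: contraTneq => ->; rewrite sub0r normrN -leNgt.
  apply: le_trans hl; rewrite ler_wpM2r ?(ltW ka0) //.
  by apply: lerXn2r; rewrite ?nnegrE // ltW.
suff [v [hv Sv ve]] : exists v, [/\ q1 < v < q2, S' (upd x N.+1 v) & `|v - w0| < e].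
  exists (upd x N.+1 v); split=> // i.
  by rewrite ltnS leq_eqVlt /upd; case: eqP => [->|_ /= /hxe].
have yq1' : q1 < w0 by [].
have yq2' : w0 < q2 by [].
have [we|we] := ltP `|w - w0| e.
  by exists w; split=> //; apply/andP.
have e1e : e1 < e by exact: half_lt.
have [ww|ww] := leP w0 w.
- rewrite ger0_norm ?subr_ge0 // in we.
  have hv : q1 < w0 + e1 < q2 by apply/andP; split; lra.
  exists (w0 + e1); split=> //; last by rewrite addrAC subrr add0r gtr0_norm.
  apply: (move_last (w := w)) => //; [by apply: cup; apply/andP|exact: cup|move=> u].
  have wv : w0 + e1 <= w by lra.
  rewrite (min_idPr wv) (max_idPl wv) => /andP[u1 u2]; apply: nzQ.
    by move: hv => /andP[? ?]; apply/andP; split; lra.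
  by rewrite ger0_norm; lra.
- rewrite ltr0_norm ?subr_lt0 // in we.
  have hv : q1 < w0 - e1 < q2 by apply/andP; split; lra.
  exists (w0 - e1); split=> //; last by rewrite addrAC subrr add0r normrN gtr0_norm.
  apply: (move_last (w := w)) => //; [by apply: cup; apply/andP|exact: cup|move=> u].
  have wv : w <= w0 - e1 by lra.
  rewrite (min_idPl wv) (max_idPr wv) => /andP[u1 u2]; apply: nzQ.
    by move: hv => /andP[? ?]; apply/andP; split; lra.
  by rewrite ler0_norm; lra.
Qed.

End GoodForm.

End ClosureSets.

(** * The closure over rho = 0 as a countable union of analytic images *)

Section ClosureCP.
Context {R : realType}.
Implicit Types (d m : nat) (p q x y z : nat -> R) (S O W Z : set (nat -> R)).

Lemma good_form_shrink N S p lam (eta eta' : R) m k b : 0 < eta' -> eta' <= eta ->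
  good_form N S p lam eta m k b -> good_form N S p lam eta' m k b.
Proof.
move=> e0 ee [h1 h2 h3 h4 h5]; split=> //.
  by move=> i j im jk x hx; apply: h4 => //; exact: close_le hx.
by move=> q q' hq hq'; apply: h5; [exact: close_le hq|exact: close_le hq'].
Qed.

Lemma small_inv (mu : R) : 0 < mu -> exists n : nat, 2 * (n.+1%:R : R)^-1 <= mu.
Proof.
move=> m0; pose n := Num.bound (2 / mu); exists n.
have h : 0 <= 2 / mu by rewrite divr_ge0 // ltW.
have hn : 2 / mu < n.+1%:R by apply: lt_le_trans (archi_boundP h) _; rewrite ler_nat.
by rewrite ler_pdivrMr ?ltr0n // mulrC -ler_pdivrMr // ltW.
Qed.

(** A point [y] of the closure is classified by the order [j] to which [Q y] vanishes at its last
    coordinate, and by a rational interval around this coordinate short enough for [slice_cl]. On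
    each class, adherence to [S] is equivalent to adherence to the slice, which is the induction
    hypothesis, cut by the equations [q i = 0] for [i < j]; [F j] packs these into one sum of
    squares. *)
Lemma closure_local N S p lam (eta : R) m k b : good_form N S p lam eta m k b -> eta <= 1 ->
  (forall q1 q2 : R, p N.+1 - eta <= q1 -> q2 <= p N.+1 + eta ->
     CP N.+1 N.+2 [set z | close N.+1 eta p z /\ (z 0%N = 0 /\ cl N.+1 (slice N S p lam q1 q2) z)]) ->
  exists2 s : R, 0 < s & forall O, eo N.+2 O -> O `<=` close N.+2 s p ->
    CP N.+2 N.+3 [set y | O y /\ (y 0%N = 0 /\ cl N.+2 (fun y => S (shear N.+1 lam p y)) y)].
Proof.
move=> gf eta1 IH; have [_ _ eta0 _ _] := gf.
pose Q y : {poly R} := \prod_(i < m) pol (k i) (b i) y.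
pose D := (\sum_(i < m) k i)%N.
pose q i y : R := (Q y)^`N(i).[y N.+1 - p N.+1].
have aq i y : close N.+2 eta p y -> ana N.+2 (q i) y by move=> hy; exact: (q_ana gf i hy).
pose L := \sum_(i < D.+1) (`|q i p| + 1).
have L0 : 0 <= L by apply: sumr_ge0 => i _; rewrite addr_ge0.
have [s s0 hs] : nearp N.+2 p (fun y => forall i, (i < D.+1)%N -> `|q i y - q i p| < 1).
  apply: (nearp_all (P := fun i y => `|q i y - q i p| < 1)) => i _.
  by apply: ana_cont ltr01; apply: aq; exact: close_refl.
have qL y : close N.+2 s p y -> \sum_(i < D.+1) `|q i y| <= L.
  move=> /hs hy; apply: ler_sum => i _; have := hy i (ltn_ord i).
  have := ler_normD (q i p) (q i y - q i p); rewrite [q i p + _]addrC subrK; lra.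
exists (Num.min s eta) => [|O oO hO]; first by rewrite lt_min s0.
have Os y : O y -> close N.+2 s p y by move=> /hO; apply: close_le; rewrite ge_min lexx.
have Oe y : O y -> close N.+2 eta p y.
  by move=> /hO; apply: close_le; rewrite ge_min lexx orbT.
pose lo (c : rat * nat) : R := ratr c.1 - c.2.+1%:R^-1.
pose hi (c : rat * nat) : R := ratr c.1 + c.2.+1%:R^-1.
pose good c := [/\ p N.+1 - eta <= lo c, hi c <= p N.+1 + eta & hi c - lo c <= 1].
pose Oc j c := [set y | O y /\ (lo c < y N.+1 < hi c /\ (hi c - lo c) * L < `|q j y|)].
pose F (j : nat) y := \sum_(i < j) q i y ^+ 2.
pose A j c := [set y |
  (close N.+1 eta p y /\ (y 0%N = 0 /\ cl N.+1 (slice N S p lam (lo c) (hi c)) y)) /\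
  (Oc j c y /\ F j y = 0)].
have oOc j c : eo N.+2 (Oc j c).
  apply: eo_near => // y Oy [/andP[y1 y2] yq]; apply: nearp_and.
    have t0 : 0 < Num.min (y N.+1 - lo c) (hi c - y N.+1) by rewrite lt_min !subr_gt0 y1.
    have := ana_cont (ana_coord y (ltnSn N.+1)) t0; apply: nearp_mono => z.
    by rewrite lt_min !ltr_norml => /andP[/andP[? ?] /andP[? ?]]; apply/andP; split; lra.
  have t0 : 0 < `|q j y| - (hi c - lo c) * L by rewrite subr_gt0.
  have := ana_cont (aq j y (Oe y Oy)) t0; apply: nearp_mono => z.
  have := ler_normD (q j z) (q j y - q j z).
  rewrite (_ : q j z + (q j y - q j z) = q j y); last by ring.
  by rewrite [`|q j y - _|]distrC => h1 h2; lra.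
have aF j c y : Oc j c y -> ana N.+2 (F j) y.
  move=> [Oy _]; apply: (ana_sum (F := fun i y => q i y ^+ 2)) => i _.
  by apply: anaX; apply: aq; exact: Oe.
have F0 j y : F j y = 0 <-> forall i, (i < j)%N -> q i y = 0.
  split=> [/eqP|h]; last by rewrite /F big1 // => i _; rewrite h // expr0n.
  rewrite psumr_eq0 => [/allP h i ij|i _]; last exact: sqr_ge0.
  by have := h (Ordinal ij) (mem_index_enum _); rewrite sqrf_eq0 => /eqP.
have CA j c : good c -> CP N.+2 N.+3 (A j c).
  by move=> [g1 g2 _]; exact: (CP_slice (IH _ _ g1 g2) (oOc j c) (@aF j c)).
pose B j (n : nat) := if @unpickle (rat * nat)%type n is Some c then
   (if `[< good c >] then A j c else set0) else set0.
have CB j n : CP N.+2 N.+3 (B j n).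
  rewrite /B; case: unpickle => [c|]; last exact: CP_none.
  by case: asboolP => [/CA //|_]; exact: CP_none.
apply: CP_ext (CP_bigU (n := D.+1) (fun j _ => CP_union (CB j))) => y; split.
  move=> [j jD [n]]; rewrite /B; case: unpickle => // c; case: asboolP => // -[g1 g2 g3].
  move=> [[hy [y0 hc]] [[Oy [yI yq]] /F0 qz]]; split=> //; split=> //.
  exact: (slice_cl gf (Oe y Oy) eta1 g1 g2 g3 yI jD qz (qL y (Os y Oy)) yq hc).
move=> [Oy [y0 hc]].
have [j [jQ nz qz]] := nderiv_neq0 (y N.+1 - p N.+1) (Q_neq0 m k b y).
have jD : (j < D.+1)%N by exact: leq_trans jQ (size_Q m k b y).
have nz0 : 0 < `|q j y| by rewrite normr_gt0.
have L1 : 0 < L + 1 by lra.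
have g0 : 0 < eta - `|y N.+1 - p N.+1| by rewrite subr_gt0; exact: Oe (ltnSn _).
(* An interval of length at most [mu] satisfies [good], and its length times [L] stays below
   [|q j y|]; with [L + 1] in the denominator this is strict and covers [L = 0]. *)
pose mu := Num.min (Num.min 1 (eta - `|y N.+1 - p N.+1|)) (`|q j y| / (L + 1)).
have mu0 : 0 < mu by rewrite !lt_min ltr01 g0 divr_gt0.
have [mu1 mu2 mu3] : [/\ mu <= 1, mu <= eta - `|y N.+1 - p N.+1| & mu <= `|q j y| / (L + 1)].
  by split; rewrite !ge_min lexx ?orbT.
have [n hn] := small_inv mu0.
have n0 : 0 < (n.+1%:R : R)^-1 by rewrite invr_gt0 ltr0n.
have [c hcy] := rat_approx (y N.+1) n0.
have hl : hi (c, n) - lo (c, n) = 2 * n.+1%:R^-1 by rewrite /hi /lo /=; ring.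
move: hcy; rewrite ltr_norml => /andP[c1 c2].
have [a1 a2] : y N.+1 - p N.+1 <= `|y N.+1 - p N.+1| /\ p N.+1 - y N.+1 <= `|y N.+1 - p N.+1|.
  by split; [exact: ler_norm|rewrite distrC; exact: ler_norm].
have gc : good (c, n).
  rewrite /good hl; split; last exact: le_trans hn mu1.
    by rewrite /lo /=; move: c1 c2 n0 hn; set r := _^-1 => c1 c2 n0 hn; lra.
  by rewrite /hi /=; move: c1 c2 n0 hn; set r := _^-1 => c1 c2 n0 hn; lra.
exists j => //; exists (pickle (c, n)); rewrite /B pickleK asboolT //.
have yI : lo (c, n) < y N.+1 < hi (c, n).
  rewrite /lo /hi /=; move: c1 c2 n0; set r := _^-1 => c1 c2 n0; apply/andP; split; lra.
split; last split.
- split; first by apply: close_sub (leqnSn _) _; exact: Oe.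
  by split=> //; exact: (cl_slice hc yI).
- split=> //; split=> //; rewrite hl.
  apply: (@le_lt_trans _ _ (mu * L)); first by rewrite ler_wpM2r.
  apply: (@lt_le_trans _ _ (mu * (L + 1))); first by rewrite ltr_pM2l // ltrDl.
  by rewrite -ler_pdivlMr.
- by apply/F0.
Qed.

(** The index [N.+2] allows every dimension up to that of the ambient space: the content is that the
    closure over [rho = 0] is a countable union of analytic images at all. For [N = 0] only the
    point [rho = 0] is left, an image of [R^0]. *)
Lemma closure_CP N O S : eo N.+1 O ->
  (forall p, O p -> p 0%N = 0 -> sa N.+1 S p) ->
  CP N.+1 N.+2 [set p | O p /\ (p 0%N = 0 /\ cl N.+1 S p)].
Proof.
elim: N O S => [|N IH] O S oO hS.
  case: (pselect (exists p, O p /\ (p 0%N = 0 /\ cl 1 S p))) => [[p [Op [p0 hp]]]|nex]; last first.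
    by apply: CP_empty => z hz; apply: nex; exists z.
  have := CP_img (d := 1) (m := 2) (g := fun _ _ => 0) (ltn0Sn 1) (@eo_setT R 0) _.
  move=> H; apply: CP_ext (H _) => [z|u _ i _]; last exact: ana_const.
  split=> [[u _ /(_ 0%N isT) z0]|[_ [z0 _]]]; last first.
    by exists z => // -[|//] _.
  have pz i : (i < 1)%N -> p i = z i by case: i => // _; rewrite p0 z0.
  by split; [exact: (eo_sat oO pz Op)|split=> //; exact: (CP_mono_d_cl hp pz)].
have PhiU (F : nat -> set (nat -> R)) : (forall n : nat, CP N.+2 N.+3 (F n)) -> CP N.+2 N.+3 [set z | exists n, F n z].
  exact: CP_union.
apply: (lindelof (Phi := CP N.+2 N.+3) oO (CP_none _ _) PhiU) => p Op.
have [p0|p0] := eqVneq (p 0%N) 0; last first.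
  have [s s0 hs] := ana_neq0 (ana_coord p (ltn0Sn N.+1)) p0.
  exists s => // O1 _ hO1 _; apply: CP_empty => z [/hO1/hs/eqP ? [? _]] //.
have [lam [eta0 [m [k [b gf0]]]]] := reduction (hS p Op p0) p0.
have e00 : 0 < eta0 by case: gf0.
have e0 : 0 < Num.min eta0 1 by rewrite lt_min e00 ltr01.
have e1 : Num.min eta0 1 <= 1 by rewrite ge_min lexx orbT.
have gf : good_form N S p lam (Num.min eta0 1) m k b.
  by apply: (good_form_shrink e0 _ gf0); rewrite ge_min lexx.
set eta := Num.min eta0 1 in e0 e1 gf.
have [lamd lam0 _ _ _] := gf.
have [s s0 hs] : exists2 s : R, 0 < s & forall O, eo N.+2 O -> O `<=` close N.+2 s p ->
    CP N.+2 N.+3 [set y | O y /\ (y 0%N = 0 /\ cl N.+2 (fun y => S (shear N.+1 lam p y)) y)].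
  apply: (closure_local gf e1) => q1 q2 h1 h2; apply: IH; first exact: eo_close.
  by move=> z hz z0; exact: (slice_sa gf h1 h2 hz).
pose Sh := shear N.+1 lam p; pose Sh' := shear N.+1 (fun i => - lam i) p.
have SK : cancel Sh Sh' by exact: shearK.
have SK' : cancel Sh' Sh.
  move=> y; have := shearK p (lam := fun i => - lam i) (d := N.+1).
  rewrite lamd oppr0 => /(_ erefl y); rewrite /Sh /Sh'; congr (_ = _).
  by congr (shear _ _ _ _); apply/funext => i; rewrite opprK.
have [t t0 ht] := shear_near (fun i => - lam i) p (ltnSn N.+1) s0.
exists t => // O1 oO1 hO1 _.
pose O' := [set y | setT y /\ O1 (fun i => Sh y i)].
have aSh i x : (i < N.+2)%N -> ana N.+2 (fun y => Sh y i) x.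
  by move=> ie; exact: ana_shear.
have oO' : eo N.+2 O' by apply: (eo_preim (@eo_setT _ _) oO1) => u _ i; exact: aSh.
have O's : O' `<=` close N.+2 s p.
  by move=> y [_ /hO1/ht]; rewrite -[fun i => Sh y i]/(Sh y) -/(Sh' _) SK.
have Z := CP_image (h := fun i y => Sh y i) (hs O' oO' O's) (fun z _ i ie => aSh i z ie).
have Sh0 y : Sh y 0%N = y 0%N by rewrite /Sh /shear lam0 mul0r addr0.
apply: CP_ext Z => x; split.
  move=> [y [[_ O1y] [y0 hc]] xy]; have yx i : (i < N.+2)%N -> Sh y i = x i by move=> /xy.
  split; first exact: (eo_sat oO1 yx O1y).
  split; first by rewrite xy // Sh0.
  apply: (CP_mono_d_cl _ yx) => e e00'.
  have [r r0 hr] : nearp N.+2 y (fun z => close N.+2 e (Sh y) (Sh z)).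
    apply: (nearp_all (P := fun i z => `|Sh z i - Sh y i| < e)) => i ie.
    exact: ana_cont (aSh i y ie) e00'.
  have [z [Sz z0 hz]] := hc r r0.
  by exists (Sh z); split=> //; [rewrite Sh0|exact: hr].
move=> [O1x [x0 hc]]; exists (Sh' x); last by move=> i _; rewrite SK'.
split; first by split=> //; rewrite -[fun i => Sh _ i]/(Sh (Sh' x)) SK'.
split; first by rewrite -Sh0 SK'.
by apply: cl_shear => //; rewrite -/(Sh _) SK'.
Qed.

End ClosureCP.

(** * Covering by thin sets *)

Section EuclideanNorm.
Context {R : realType}.
Implicit Types (n : nat).

(** Lagrange's identity: twice the gap is the double sum of the squares of
    [x i * y j - x j * y i]. *)
Lemma cauchy_schwarz n (x y : 'I_n -> R) :
  (\sum_i x i * y i) ^+ 2 <= (\sum_i x i ^+ 2) * (\sum_i y i ^+ 2).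
Proof.
have h : 0 <= \sum_i \sum_j (x i * y j - x j * y i) ^+ 2.
  by apply: sumr_ge0 => i _; apply: sumr_ge0 => j _; exact: sqr_ge0.
have E : \sum_i \sum_j (x i * y j - x j * y i) ^+ 2 =
    2 * ((\sum_i x i ^+ 2) * (\sum_i y i ^+ 2)) - 2 * (\sum_i x i * y i) ^+ 2.
  have -> : 2 * ((\sum_i x i ^+ 2) * (\sum_i y i ^+ 2)) =
      \sum_i \sum_j (x i ^+ 2 * y j ^+ 2 + x j ^+ 2 * y i ^+ 2).
    rewrite [RHS](eq_bigr (fun i => (\sum_j x i ^+ 2 * y j ^+ 2) + \sum_j x j ^+ 2 * y i ^+ 2));
      last by move=> i _; rewrite big_split.
    rewrite big_split /= [X in _ = _ + X]exchange_big /=.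
    have <- : (\sum_i x i ^+ 2) * (\sum_i y i ^+ 2) = \sum_i \sum_j x i ^+ 2 * y j ^+ 2.
      by rewrite mulr_suml; apply: eq_bigr => i _; rewrite mulr_sumr.
    by ring.
  have -> : 2 * (\sum_i x i * y i) ^+ 2 = \sum_i \sum_j 2 * ((x i * y i) * (x j * y j)).
    rewrite expr2 mulr_suml mulr_sumr; apply: eq_bigr => i _.
    by rewrite mulr_sumr mulr_sumr.
  rewrite -sumrB; apply: eq_bigr => i _; rewrite -sumrB; apply: eq_bigr => j _; ring.
by move: h; rewrite E; lra.
Qed.

Lemma enorm_sqr n (x : 'rV[R]_n) : enorm x ^+ 2 = \sum_(i < n) x ord0 i ^+ 2.
Proof. by rewrite sqr_sqrtr // sumr_ge0 // => i _; exact: sqr_ge0. Qed.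

Lemma enormZ n (a : R) (x : 'rV[R]_n) : enorm (a *: x) = `|a| * enorm x.
Proof.
rewrite /enorm -[`|a|]sqrtr_sqr -sqrtrM ?sqr_ge0 // mulr_sumr.
by congr Num.sqrt; apply: eq_bigr => i _; rewrite mxE exprMn.
Qed.

Lemma enormN n (x : 'rV[R]_n) : enorm (- x) = enorm x.
Proof. by rewrite -scaleN1r enormZ normrN1 mul1r. Qed.

Lemma enorm0 n : enorm (0 : 'rV[R]_n) = 0.
Proof. by rewrite -(scale0r 0) enormZ normr0 mul0r. Qed.

Lemma enorm_eq0 n (x : 'rV[R]_n) : enorm x = 0 -> x = 0.
Proof.
move=> x0; apply/rowP => j; rewrite mxE; apply/eqP; rewrite -normr_le0 -x0.
exact: coord_le_enorm.
Qed.

Lemma ler_enormD n (x y : 'rV[R]_n) : enorm (x + y) <= enorm x + enorm y.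
Proof.
have p : 0 <= enorm x + enorm y by rewrite addr_ge0 ?enorm_ge0.
rewrite -(ler_pXn2r (n := 2)) ?nnegrE ?enorm_ge0 // sqrrD !enorm_sqr.
have -> : \sum_(i < n) (x + y) ord0 i ^+ 2 = \sum_(i < n) x ord0 i ^+ 2 +
    (\sum_(i < n) x ord0 i * y ord0 i) *+ 2 + \sum_(i < n) y ord0 i ^+ 2.
  rewrite -sumrMnl -!big_split; apply: eq_bigr => i _; by rewrite mxE sqrrD.
rewrite lerD2r lerD2l lerMn2r /=; apply: le_trans (ler_norm _) _.
rewrite -(ler_pXn2r (n := 2)) ?nnegrE ?mulr_ge0 ?enorm_ge0 // real_normK ?num_real //.
by rewrite exprMn !enorm_sqr; exact: (cauchy_schwarz (fun i => x ord0 i) (fun i => y ord0 i)).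
Qed.

Lemma ler_enormB n (x y : 'rV[R]_n) : enorm x - enorm y <= enorm (x - y).
Proof. by rewrite lerBlDr; apply: le_trans (ler_enormD _ _); rewrite subrK. Qed.

Lemma ler_dist_enorm n (x y : 'rV[R]_n) : `|enorm x - enorm y| <= enorm (x - y).
Proof.
rewrite ler_norml ler_enormB andbT; have := ler_enormB y x.
by rewrite -[y - x]opprB enormN; lra.
Qed.

End EuclideanNorm.

Section UltraLimits.
Context {R : realType}.
Variable U : set_system nat.
Context {UU : UltraFilter U}.

Definition ulim (v : nat -> R) (l : R) := forall e : R, 0 < e -> U [set i | `|v i - l| < e].

(** The limit is the supremum of the levels [x] with [x <= v] on a set of [U]; for a level above it
    the ultrafilter contains the complementary set. *)
Lemma ulim_exists (v : nat -> R) (B : R) : U [set i | `|v i| <= B] -> exists l, ulim v l.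
Proof.
move=> hB; pose E := [set x : R | U [set i | x <= v i]].
have EB : E (- B).
  by apply: filterS hB => i /=; rewrite ler_norml => /andP[].
have Eub x : E x -> x <= B.
  move=> Ex; have [i [/= h1 h2]] := filter_ex (filterI Ex hB).
  exact: le_trans h1 (le_trans (ler_norm _) h2).
have supE : has_sup E by split; [exists (- B)|exists B].
exists (sup E) => e e0.
have [x Ex hx] := sup_adherent e0 supE.
have [F1|F1] := in_ultra_setVsetC [set i | sup E + e / 2 <= v i] UU.
  have : sup E + e / 2 <= sup E by apply: ub_le_sup; [case: supE|].
  by have := half_lt e0; have := divr_gt0 e0 (ltr0Sn R 1); lra.
apply: filterS (filterI Ex F1) => i [/= h1 /negP]; rewrite -ltNge => h2.
have := half_lt e0; rewrite ltr_norml => h3; apply/andP; split; lra.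
Qed.

Lemma filter_fin (n : nat) (P : nat -> nat -> Prop) :
  (forall j, (j < n)%N -> U [set i | P j i]) -> U [set i | forall j, (j < n)%N -> P j i].
Proof.
elim: n => [_|n IH h]; first by apply: filterS filterT => i _ j.
apply: filterS (filterI (IH (fun j jn => h j (leqW jn))) (h n (ltnSn n))) => i [/= h1 h2] j.
by rewrite ltnS leq_eqVlt => /predU1P[->|/h1].
Qed.

End UltraLimits.

Section ThinSets.
Context {R : realType}.
Implicit Types (c x y : nat -> R) (E : set (nat -> R)).

(* A Lipschitz parametrisation of E, seen in R^(K+1), by a bounded subset of R^K. *)
Definition thin K E := exists (pi : (nat -> R) -> nat -> R) (B C : R),
  [/\ 0 < B, 0 < C, forall x, E x -> forall i, (i < K)%N -> `|pi x i| <= B &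
  forall x y (e : R), E x -> E y -> 0 <= e -> (forall i, (i < K)%N -> `|pi x i - pi y i| <= e) ->
    forall i, (i < K.+1)%N -> `|x i - y i| <= C * e].

Definition cbox K c (r : R) : set (nat -> R) := [set x | forall i, (i < K)%N -> `|x i - c i| <= r].

(** If every small box met [E], one could choose a point of [E] in each of [M ^ K.+1] separated
    boxes. Two of these whose parameters fall in the same grid cell would be too close, so the boxes
    inject into the grid of only [N.+1 ^ K] cells. *)
Lemma thin_avoid K E c (r : R) : thin K E -> 0 < r -> exists c' r', [/\ 0 < r',
  forall i, (i < K.+1)%N -> `|c' i - c i| + r' <= r & forall x, cbox K.+1 c' r' x -> ~ E x].
Proof.
move=> [pi [B [C [B0 C0 hB hC]]]] r0; apply: contrapT => nex.
pose q := Num.bound (2 * B * C / r).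
have hq : 2 * B * C / r < q%:R by apply: archi_boundP; rewrite ltW // divr_gt0 // !mulr_gt0.
have q0 : 0 < q%:R :> R by apply: lt_trans hq; rewrite divr_gt0 // !mulr_gt0.
(* By the choice of [q], parameters in one cell of side [2 * B / N] give points less than [r / M]
   apart, while the boxes have radius [r / (4 * M)] and centres [2 * r / M] apart in some
   coordinate. Since [N.+1 <= q.+1 * M], the injection would give [M <= q.+1 ^ K], which [M] is
   chosen to violate. *)
pose M := ((q.+1) ^ K).+1; pose N := (q * M)%N.
have M0 : 0 < M%:R :> R by rewrite ltr0n.
have N0 : 0 < N%:R :> R by rewrite /N natrM mulr_gt0.
have /choice[X hX] : forall f : {ffun 'I_K.+1 -> 'I_M}, exists x, E x /\
    forall i (iK : (i < K.+1)%N), `|x i - (c i - r + r / M%:R * (2 * (f (Ordinal iK))%:R + 1))|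
      <= r / M%:R / 4.
  move=> f; apply: contrapT => nf; apply: nex.
  pose g i : R := if insub i is Some j then c i - r + r / M%:R * (2 * (f j)%:R + 1) else 0.
  have gE i (iK : (i < K.+1)%N) : g i = c i - r + r / M%:R * (2 * (f (Ordinal iK))%:R + 1).
    by rewrite /g insubT.
  have rM : 0 < r / M%:R by rewrite divr_gt0.
  exists g, (r / M%:R / 4); split; first by rewrite divr_gt0.
    move=> i iK; rewrite gE; set a := (f _ : nat).
    have aM : a.+1%:R <= M%:R :> R by rewrite ler_nat; exact: ltn_ord.
    have a0 : 0 <= a%:R :> R by [].
    have E1 : r = r / M%:R * M%:R by rewrite divfK // gt_eqF.
    have -> : c i - r + r / M%:R * (2 * a%:R + 1) - c i = r / M%:R * (2 * a%:R + 1 - M%:R).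
      by rewrite [in RHS]mulrBr -E1; ring.
    rewrite normrM (gtr0_norm rM) [X in _ <= X]E1 -mulrDr ler_pM2l //.
    have h : `|2 * a%:R + 1 - M%:R| <= M%:R - 1 :> R.
      rewrite -(natr1 a) in aM; rewrite ler_norml; apply/andP; split; lra.
    by apply: le_trans (lerD h (lexx _)) _; lra.
  move=> x hx Ex; apply: nf; exists x; split=> // i iK.
  by have := hx i iK; rewrite gE.
pose cell x : {ffun 'I_K -> 'I_N.+1} :=
  [ffun i : 'I_K => inord (Num.truncn ((pi x i + B) / (2 * B) * N%:R))].
have B2 : 0 < 2 * B by rewrite mulr_gt0.
have cell_near x y : E x -> E y -> cell x = cell y ->
    forall i, (i < K)%N -> `|pi x i - pi y i| <= 2 * B / N%:R.
  move=> Ex Ey /ffunP cxy i iK.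
  pose a z := (pi z i + B) / (2 * B) * N%:R.
  have ha z : E z -> 0 <= a z <= N%:R.
    move=> /hB /(_ i iK); rewrite ler_norml => /andP[h1 h2]; rewrite /a.
    have h3 : 0 <= (pi z i + B) / (2 * B) by rewrite divr_ge0 ?(ltW B2) //; lra.
    have h4 : (pi z i + B) / (2 * B) <= 1 by rewrite ler_pdivrMr // mul1r; lra.
    by rewrite mulr_ge0 // ?(ltW N0) //= ler_piMl // ltW.
  have ht z : E z -> (Num.truncn (a z) < N.+1)%N.
    move=> /ha /andP[a0 aN]; rewrite ltnS -(ler_nat R).
    by have /andP[h _] := truncn_itv a0; exact: le_trans h aN.
  have := congr1 val (cxy (Ordinal iK)); rewrite !ffunE /= -!/(a _) !inordK ?ht // => tt.
  have /andP[x1 x2] := truncn_itv (proj1 (andP (ha x Ex))).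
  have /andP[y1 y2] := truncn_itv (proj1 (andP (ha y Ey))).
  rewrite tt in x1 x2; set t := Num.truncn (a y) in x1 x2 y1 y2.
  rewrite -(natr1 t) in x2 y2.
  have h : `|a x - a y| <= 1 by rewrite ler_norml; apply/andP; split; lra.
  have -> : pi x i - pi y i = (a x - a y) * (2 * B / N%:R).
    by rewrite /a; field; rewrite !gt_eqF.
  by rewrite normrM [X in _ * X]gtr0_norm ?divr_gt0 // ler_piMl // ltW // divr_gt0.
have inj : injective (fun f => cell (X f)).
  move=> f f' cf; apply/ffunP => i; apply/eqP/negPn/negP => fi.
  have [Ef hf] := hX f; have [Ef' hf'] := hX f'.
  have e0 : 0 <= 2 * B / N%:R by rewrite ltW // divr_gt0.
  have := hC _ _ _ Ef Ef' e0 (cell_near _ _ Ef Ef' cf) i (ltn_ord i).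
  have := hf i (ltn_ord i); have := hf' i (ltn_ord i).
  have -> : Ordinal (ltn_ord i) = i by apply: val_inj.
  set u := X f i; set v := X f' i; set rM := r / M%:R => h1 h2 h3.
  have rM0 : 0 < rM by rewrite divr_gt0.
  have h4 : C * (2 * B / N%:R) < rM.
    have -> : C * (2 * B / N%:R) = (2 * B * C / r) / q%:R * rM.
      by rewrite /rM /N natrM; field; rewrite !gt_eqF.
    by rewrite gtr_pMl // ltr_pdivrMr // mul1r.
  have h5 : 2 * rM <= `|rM * (2 * (f i)%:R + 1) - rM * (2 * (f' i)%:R + 1)|.
    have -> : rM * (2 * (f i)%:R + 1) - rM * (2 * (f' i)%:R + 1) =
       2 * rM * ((f i)%:R - (f' i)%:R) by ring.
    rewrite normrM (gtr0_norm (mulr_gt0 (ltr0Sn R 1) rM0)) ler_peMr //.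
      by rewrite mulr_ge0 // ltW.
    have [lt|lt|eq] := ltngtP (f i) (f' i).
    - rewrite distrC -natrB ?(ltnW lt) // ger0_norm // (ler_nat R 1) subn_gt0 //.
    - rewrite -natrB ?(ltnW lt) // ger0_norm // (ler_nat R 1) subn_gt0 //.
    - by case/eqP: fi; apply: val_inj.
  move: h1 h2 h3 h4 h5; set g := rM * (2 * (f i)%:R + 1); set g' := rM * (2 * (f' i)%:R + 1).
  move=> h1 h2 h3 h4 h5.
  have := ler_normB (u - (c i - r + g)) (v - (c i - r + g')).
  have -> : u - (c i - r + g) - (v - (c i - r + g')) = (u - v) - (g - g') by ring.
  have := ler_normB (u - v) (u - v - (g - g')).
  have -> : u - v - (u - v - (g - g')) = g - g' by ring.
  lra.
have := leq_card _ inj; rewrite !card_ffun !card_ord => hcard.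
have h1 : (N.+1 <= q.+1 * M)%N by rewrite /N mulSn addnC -addn1 leq_add2l.
have h2 : (M ^ K.+1 <= (q.+1 * M) ^ K)%N.
  apply: leq_trans hcard _; case: (posnP K) => [->|K0]; first by rewrite !expn0.
  by rewrite leq_exp2r.
move: h2; rewrite expnS expnMn leq_pmul2r ?expn_gt0 // /M ltnn //.
Qed.

End ThinSets.

Section Baire.
Context {R : realType}.

(** The boxes are closed and nested, so taking in each coordinate the supremum of the left ends
    gives a point of all of them. *)
Lemma baire_thin K (F : nat -> set (nat -> R)) (c : nat -> R) (r : R) : 0 < r ->
  (forall l, thin K (F l)) -> exists2 x, cbox K.+1 c r x & forall l, ~ F l x.
Proof.
move=> r0 hF.
pose step (j : nat) (t t' : (nat -> R) * R) :=
  (forall i, (i < K.+1)%N -> `|t'.1 i - t.1 i| + t'.2 <= t.2) /\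
  forall x, cbox K.+1 t'.1 t'.2 x -> ~ F j x.
have [|j t t0|u [u0 hu]] := @dependent_choice _ (fun _ t => 0 < t.2) step (c, r).
- exact: r0.
- have [c' [r' [h1 h2 h3]]] := thin_avoid t.1 (hF j) t0.
  by exists (c', r').
have nest i j k : (i < K.+1)%N -> `|(u (j + k)%N).1 i - (u j).1 i| + (u (j + k)%N).2 <= (u j).2.
  move=> iK; elim: k => [|k IH]; first by rewrite addn0 subrr normr0 add0r.
  rewrite addnS; have [_ [/(_ i iK) h _]] := hu (j + k)%N.
  have := ler_normD ((u (j + k).+1).1 i - (u (j + k)%N).1 i) ((u (j + k)%N).1 i - (u j).1 i).
  by rewrite addrA subrK; lra.
have lowup i j k : (i < K.+1)%N -> (u j).1 i - (u j).2 <= (u k).1 i + (u k).2.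
  move=> iK; have hj := (hu j).1; have hk := (hu k).1.
  have [jk|/ltnW kj] := leqP j k.
    have := nest i j (k - j)%N iK; rewrite subnKC // => h.
    have := ler_norm (- ((u k).1 i - (u j).1 i)); rewrite normrN; lra.
  have := nest i k (j - k)%N iK; rewrite subnKC // => h.
  have := ler_norm ((u j).1 i - (u k).1 i); lra.
pose x i := sup [set y | exists j, y = (u j).1 i - (u j).2].
have hx j : cbox K.+1 (u j).1 (u j).2 x.
  move=> i iK; rewrite ler_distl; apply/andP; split.
    apply: ub_le_sup; last by exists j.
    by exists ((u 0%N).1 i + (u 0%N).2) => _ [k ->]; exact: lowup.
  apply: ge_sup; first by exists ((u j).1 i - (u j).2), j.
  by move=> _ [k ->]; exact: lowup.
exists x; first by have := hx 0%N; rewrite u0.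
by move=> l; apply: (hu l).2.2; exact: hx.
Qed.

End Baire.

(** * Covers by sets with few Lipschitz coordinates *)

Section SmallCover.
Context {R : realType}.
Variable n : nat.
Implicit Types (E X Y : set 'rV[R]_n).

(** The guard makes the empty set small for [k = 0] as well, where no [k' < k] exists. *)
Definition small k E := E !=set0 -> exists k' (c : 'I_k' -> 'I_n) (C : R),
  [/\ (k' < k)%N, 0 < C & forall x y (e : R), E x -> E y -> 0 <= e ->
    (forall i, `|x ord0 (c i) - y ord0 (c i)| <= e) -> forall j, `|x ord0 j - y ord0 j| <= C * e].

Definition small_cover k Y := exists2 F : nat -> set 'rV[R]_n,
  forall l, small k (F l) & forall y, Y y -> exists l, F l y.

Lemma small_cover1 k E : small k E -> small_cover k E.
Proof. by move=> hE; exists (fun=> E) => // y Ey; exists 0%N. Qed.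

Lemma small_cover0 k : small_cover k set0.
Proof. by apply: small_cover1 => -[]. Qed.

Lemma small_coverU k (F : nat -> set 'rV[R]_n) : (forall i, small_cover k (F i)) ->
  small_cover k [set a | exists i, F i a].
Proof.
move=> hF; have /choice[G hG] : forall i, exists G : nat -> set 'rV[R]_n,
    (forall l, small k (G l)) /\ forall y, F i y -> exists l, G l y.
  by move=> i; have [G h1 h2] := hF i; exists G.
exists (fun m => if unpickle m is Some (i, l) then G i l else set0).
  by move=> m; case: unpickle => [[i l]|[]] //; exact: (hG i).1.
by move=> y [i /(hG i).2[l Gy]]; exists (pickle (i, l)); rewrite pickleK.
Qed.

(** A nonempty graph inside [B] has [k' < k] by hypothesis. It is locally Lipschitz over its [k']
    coordinates, and [lindelof] cuts it into countably many parts with one constant each. *)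
Lemma PU_small_cover k B Y : PU Y -> Y `<=` B ->
  (forall k', has_analytic_piece B k' -> (k' < k)%N) -> small_cover k Y.
Proof.
move=> hY YB hB; elim: hY YB => [|X k' [c [W [phi [ic oW aphi phic ->]]]]|F _ IH] YB.
- exact: small_cover0.
- have [[w0 Ww0]|nW] := pselect (W !=set0); last first.
    rewrite (_ : phi @` W = set0); first exact: small_cover0.
    by rewrite -subset0 => a [w Ww _]; apply: nW; exists w.
  have kk : (k' < k)%N.
    apply: hB; exists c, W, phi; split=> //; first by split=> //; exists w0.
    by move=> u Wu; apply: YB; exists u.
  pose W' := [set u : nat -> R | W (torow k' u)].
  have aW u : W' u -> forall j, (j < n)%N -> ana k' (fun v => ofrow (phi (torow k' v)) j) u.
    move=> Wu j jn; have -> : (fun v => ofrow (phi (torow k' v)) j) =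
        (fun v => phi (torow k' v) ord0 (Ordinal jn)).
      by apply/funext => v; rewrite -ofrowE.
    apply: ana_sat (analytic_on_ana (aphi (Ordinal jn)) Wu) _ => i ik.
    by rewrite -[i]/(val (Ordinal ik)) ofrowE torowE.
  have oW' : eo k' W'.
    move=> u /oW[s s0 hs]; have k1 : 0 < k'%:R + 2 :> R by rewrite ltr_wpDl.
    exists (s / (k'%:R + 2)) => [|v hv]; first by rewrite divr_gt0.
    apply: hs; rewrite /eball /=.
    have t0 : 0 < s / (k'%:R + 2) by rewrite divr_gt0.
    apply: (@le_lt_trans _ _ ((k'%:R + 1) * (s / (k'%:R + 2)))).
      apply: enorm_le => [|j]; first exact: ltW.
      by rewrite !mxE ltW // hv.
    by rewrite mulrA ltr_pdivrMr // mulrC ltr_pM2l //; lra.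
  have := @lindelof _ k' (fun T => small_cover k [set phi (torow k' u) | u in T]) W' [set: nat -> R] oW'.
  have -> : [set phi (torow k' u) | u in [set z | W' z /\ [set: nat -> R] z]] = phi @` W.
    apply/seteqP; split=> a; first by move=> [u [Wu _] <-]; exists (torow k' u).
    by move=> [w Ww <-]; exists (ofrow w); [split=> //; rewrite /W' /= ofrowK|rewrite ofrowK].
  apply.
  + by rewrite image_set0; exact: small_cover0.
  + move=> F hF; have := small_coverU hF; congr small_cover.
    apply/seteqP; split=> a; first by move=> [i [u Fu <-]]; exists u => //; exists i.
    by move=> [u [i Fu] <-]; exists i, u.
  move=> u Wu.
  (* The same number gives the radius [s] and the Lipschitz constant [s^-1], so that the condition
     is monotone and [fin_common] can handle all components together. *)
  have [s s0 hs] : exists2 s : R, 0 < s & forall j, (j < n)%N -> forall q q' (e : R),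
      close k' s u q -> close k' s u q' -> (forall i, (i < k')%N -> `|q' i - q i| <= e) -> 0 <= e ->
      `|ofrow (phi (torow k' q')) j - ofrow (phi (torow k' q)) j| <= s^-1 * e.
    apply: (@fin_common _ n (fun j s => forall q q' (e : R),
      close k' s u q -> close k' s u q' -> (forall i, (i < k')%N -> `|q' i - q i| <= e) -> 0 <= e ->
      `|ofrow (phi (torow k' q')) j - ofrow (phi (torow k' q)) j| <= s^-1 * e)).
      move=> j e e' /andP[e0 ee] h q q' t hq hq' hqq t0.
      apply: le_trans (h q q' t (close_le ee hq) (close_le ee hq') hqq t0) _.
      by apply: ler_wpM2r => //; rewrite lef_pV2 ?posrE //; exact: lt_le_trans ee.
    move=> j jn; have [C [s [C0 s0 hs]]] := ana_lipschitz (aW u Wu j jn).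
    have C1 : 0 < C + 1 by rewrite ltr_wpDl.
    exists (Num.min s (C + 1)^-1); first by rewrite lt_min s0 invr_gt0.
    move=> q q' e hq hq' hqq e0.
    have ms : Num.min s (C + 1)^-1 <= s by rewrite ge_min lexx.
    apply: le_trans (hs q q' e (close_le ms hq) (close_le ms hq') hqq e0) _.
    apply: ler_wpM2r => //; apply: (@le_trans _ _ (C + 1)); first by rewrite lerDl.
    rewrite -[X in X <= _]invrK lef_pV2 ?posrE ?invr_gt0 ?lt_min ?s0 ?invr_gt0 //.
    by rewrite ge_min lexx orbT.
  exists s => // O _ Os OW; apply: small_cover1 => _; exists k', c, s^-1.
  split=> //; first by rewrite invr_gt0.
  move=> _ _ e [q [Oq _] <-] [q' [Oq' _] <-] e0 hqq j.
  have := hs j (ltn_ord j) q' q e (Os _ Oq') (Os _ Oq); rewrite !ofrowE; apply=> // i ik.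
  by have := hqq (Ordinal ik); rewrite !phic ?torowE //; exact: OW.
- by apply: small_coverU => i; apply: IH => a Fa; apply: YB; exists i.
Qed.

End SmallCover.

(** * Directions and the blow-up of a bi-Lipschitz map *)

Section Directions.
Context {R : realType}.
Variable n : nat.
Implicit Types (A : set 'rV[R]_n) (u v w x : 'rV[R]_n).

Lemma unit_dist v w : v != 0 -> w != 0 ->
  enorm ((enorm w)^-1 *: w - (enorm v)^-1 *: v) <= 2 * enorm (w - v) / enorm v.
Proof.
move=> v0 w0.
have pos x : x != 0 -> 0 < enorm x.
  by move=> x0; rewrite lt_neqAle enorm_ge0 andbT eq_sym; apply: contra x0 => /eqP/enorm_eq0 ->.
have a0 := pos _ v0; have b0 := pos _ w0.
have -> : (enorm w)^-1 *: w - (enorm v)^-1 *: v =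
    (enorm v)^-1 *: (w - v) + ((enorm w)^-1 - (enorm v)^-1) *: w.
  by apply/rowP => j; rewrite !mxE; ring.
apply: le_trans (ler_enormD _ _) _; rewrite !enormZ normfV (gtr0_norm a0).
have -> : `|(enorm w)^-1 - (enorm v)^-1| * enorm w = (enorm v)^-1 * `|enorm v - enorm w|.
  move: (enorm v) (enorm w) a0 b0 => a b a0 b0.
  have -> : b^-1 - a^-1 = a^-1 * b^-1 * (a - b) by field; rewrite !gt_eqF.
  by rewrite !normrM !normfV (gtr0_norm a0) (gtr0_norm b0) mulrAC divfK // gt_eqF.
have := ler_dist_enorm w v; rewrite distrC => h.
rewrite -mulrDr mulrAC -[X in _ <= X]mulrA [X in _ <= X]mulrC -mulrA ler_pM2l ?invr_gt0 //; lra.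
Qed.

Lemma dirset_intro A v : v != 0 ->
  (forall e : R, 0 < e -> exists u (t : R), [/\ A u, 0 < t < e &
     forall j, `|u ord0 j / t - v ord0 j| <= e]) ->
  dirset A ((enorm v)^-1 *: v).
Proof.
move=> v0 H.
have a0 : 0 < enorm v.
  by rewrite lt_neqAle enorm_ge0 andbT eq_sym; apply: contra v0 => /eqP/enorm_eq0 ->.
set a := enorm v in a0 *.
have key (eta : R) : 0 < eta -> exists u, [/\ A u, u != 0, enorm u < eta &
    enorm ((enorm u)^-1 *: u - a^-1 *: v) < eta].
  move=> eta0; have n1 : 0 < n%:R + 1 :> R by rewrite ltr_wpDl.
  (* Tolerance for the rescaled point: at most [a / 4], it keeps the point away from 0, and at most
     [eta * a / 4], it makes the bound of [unit_dist] smaller than [eta]. *)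
  pose g := Num.min a (eta * a) / 4.
  have g0 : 0 < g by rewrite divr_gt0 // lt_min a0 mulr_gt0.
  have [ga gea] : g <= a / 4 /\ g <= eta * a / 4.
    by rewrite /g !ler_pM2r ?invr_gt0 // !ge_min !lexx orbT.
  clearbody g.
  pose e := Num.min (g / (n%:R + 1)) (eta / (2 * a)).
  have a2 : 0 < 2 * a by rewrite mulr_gt0.
  have e0 : 0 < e by rewrite lt_min (divr_gt0 g0 n1) (divr_gt0 eta0 a2).
  have [e1 e2] : (n%:R + 1) * e <= g /\ e * (2 * a) <= eta.
    split; first by rewrite mulrC -ler_pdivlMr // ge_min lexx.
    by rewrite -ler_pdivlMr // ge_min lexx orbT.
  clearbody e.
  have [u [t [Au /andP[t0 te] ht]]] := H e e0.
  have hw : enorm (t^-1 *: u - v) <= g.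
    apply: le_trans e1; apply: enorm_le => [|j]; first exact: ltW.
    by rewrite !mxE mulrC; exact: ht.
  have wv := ler_enormB v (v - (v - t^-1 *: u)).
  have w0 : t^-1 *: u != 0.
    apply/eqP => w0; move: hw; rewrite w0 sub0r enormN -/a; lra.
  have u0 : u != 0 by apply: contra w0 => /eqP ->; rewrite scaler0.
  have un : enorm u = t * enorm (t^-1 *: u).
    by rewrite enormZ gtr0_norm ?invr_gt0 // mulrA divff ?mul1r // gt_eqF.
  exists u; split=> //.
    have h : enorm (t^-1 *: u) < 2 * a.
      have := ler_enormD (t^-1 *: u - v) v; rewrite subrK -/a; lra.
    rewrite un; apply: lt_le_trans e2; apply: ltr_pM => //; [exact: ltW|exact: enorm_ge0].
  have -> : (enorm u)^-1 *: u = (enorm (t^-1 *: u))^-1 *: (t^-1 *: u).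
    rewrite un invfM scalerA mulrC; congr (_ *: _); by rewrite mulrC.
  apply: le_lt_trans (unit_dist v0 w0) _; rewrite -/a ltr_pdivrMr //.
  have := mulr_gt0 eta0 a0; lra.
split; first by rewrite enormZ normfV gtr0_norm // mulVf // gt_eqF.
have pos i : 0 < 2^-1 ^+ i :> R by rewrite exprn_gt0 // invr_gt0.
have /choice[u hu] := fun i => key _ (pos i).
have small (e : R) : 0 < e -> exists M : nat, forall i, (M <= i)%N -> 2^-1 ^+ i < e.
  exact: half_pow_lt.
exists u; split.
- by move=> i; have [] := hu i.
- move=> e /small[M hM]; exists M => i /hM h; rewrite subr0; have [_ _ h' _] := hu i.
  exact: lt_trans h' h.
- move=> e /small[M hM]; exists M => i /hM h; have [_ _ _ h'] := hu i.
  exact: lt_trans h' h.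
Qed.

End Directions.

(** * The blow-up of a bi-Lipschitz map and its effect on directions *)

Section OneSide.
Context {R : realType}.
Variables (n : nat) (h : 'rV[R]_n -> 'rV[R]_n) (r K1 K2 : R).
Hypotheses (r0 : 0 < r) (K10 : 0 < K1) (K20 : 0 < K2) (h0 : h 0 = 0).
Hypothesis hlip : forall x y, eball 0 r x -> eball 0 r y ->
  K1 * enorm (x - y) <= enorm (h x - h y) /\ enorm (h x - h y) <= K2 * enorm (x - y).
Implicit Types (u v w x y : 'rV[R]_n).

Lemma eballE x : eball 0 r x = (enorm x < r) :> Prop.
Proof. by rewrite /eball /= subr0. Qed.

Lemma ball_scale v (t : R) : 0 < t < r / (enorm v + 1) -> eball 0 r (t *: v).
Proof.
move=> /andP[t0]; have v0 := enorm_ge0 v; rewrite ltr_pdivlMr ?ltr_wpDl // => ht.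
by rewrite eballE enormZ (gtr0_norm t0); apply: le_lt_trans ht; rewrite ler_pM2l // lerDl.
Qed.

(* g(v) is the limit of h(t v) / t along an ultrafilter of t -> 0; two points
   at a time are all that the Lipschitz estimates require. *)
Lemma blowup : exists g : 'rV[R]_n -> 'rV[R]_n, forall v w (e T : R), 0 < e -> 0 < T ->
  exists t : R, 0 < t < T /\ forall j,
    `|h (t *: v) ord0 j / t - g v ord0 j| < e /\ `|h (t *: w) ord0 j / t - g w ord0 j| < e.
Proof.
have [U [UU oU]] := ultraFilterLemma eventually_filter.
pose t i : R := i.+1%:R^-1.
have t0 i : 0 < t i by rewrite invr_gt0.
have tU (T : R) : 0 < T -> U [set i | t i < T].
  move=> T0; apply: oU; exists (Num.bound T^-1) => // i /= hi.
  have := archi_boundP (ltW (_ : 0 < T^-1)); rewrite invr_gt0 => /(_ T0) hT.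
  rewrite /t -[X in _ < X]invrK ltf_pV2 ?posrE ?invr_gt0 //.
  by apply: lt_le_trans hT _; rewrite ler_nat; exact: leqW.
have /choice[g hg] : forall v, exists gv : 'rV[R]_n, forall j : 'I_n,
    ulim U (fun i => h (t i *: v) ord0 j / t i) (gv ord0 j).
  move=> v; suff /choice[f hf] : forall j : 'I_n, exists l,
      ulim U (fun i => h (t i *: v) ord0 j / t i) l.
    by exists (\row_j f j) => j; rewrite mxE.
  move=> j; apply: (@ulim_exists _ _ _ _ (K2 * enorm v)).
  have rv : 0 < r / (enorm v + 1) by rewrite divr_gt0 // ltr_wpDl ?enorm_ge0.
  apply: filterS (tU _ rv) => i /= ti.
  have b0 : eball 0 r (0 : 'rV[R]_n) by rewrite eballE enorm0.
  have bv : eball 0 r (t i *: v) by apply: ball_scale; rewrite t0.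
  have [_] := hlip bv b0; rewrite h0 !subr0 enormZ (gtr0_norm (t0 i)) => hh.
  rewrite normrM normfV (gtr0_norm (t0 i)) ler_pdivrMr //.
  by apply: le_trans (coord_le_enorm _ _) (le_trans hh _); rewrite mulrCA mulrC.
exists g => v w e T e0 T0.
have near v' : U [set i | forall j, (j < n)%N ->
    `|ofrow (h (t i *: v')) j / t i - ofrow (g v') j| < e].
  apply: filter_fin => j jn; apply: filterS (hg v' (Ordinal jn) e e0) => i /=.
  by rewrite -!ofrowE.
have [i [[/= iT iv] iw]] := filter_ex (filterI (filterI (tU T T0) (near v)) (near w)).
exists (t i); split; first by rewrite t0.
by move=> j; have := iv j (ltn_ord j); have := iw j (ltn_ord j); rewrite !ofrowE.
Qed.

Variable g : 'rV[R]_n -> 'rV[R]_n.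
Hypothesis hg : forall v w (e T : R), 0 < e -> 0 < T ->
  exists t : R, 0 < t < T /\ forall j,
    `|h (t *: v) ord0 j / t - g v ord0 j| < e /\ `|h (t *: w) ord0 j / t - g w ord0 j| < e.

Lemma blowup0 : g 0 = 0.
Proof.
apply/rowP => j; rewrite mxE; apply: lt_eps_eq0 => e e0.
have [t [_ /(_ j)[]]] := hg 0 0 e0 ltr01.
by rewrite scaler0 h0 mxE mul0r sub0r normrN.
Qed.

Lemma blowup_lip v w :
  K1 * enorm (v - w) <= enorm (g v - g w) /\ enorm (g v - g w) <= K2 * enorm (v - w).
Proof.
have n1 : 0 < n%:R + 1 :> R by rewrite ltr_wpDl.
have key (e : R) : 0 < e -> exists x, [/\ enorm (x - (g v - g w)) < e,
    K1 * enorm (v - w) <= enorm x & enorm x <= K2 * enorm (v - w)].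
  move=> e0; pose e' := e / (n%:R + 1) / 4.
  have e'0 : 0 < e' by rewrite !divr_gt0.
  pose T := Num.min (r / (enorm v + 1)) (r / (enorm w + 1)).
  have T0 : 0 < T by rewrite lt_min !divr_gt0 // ltr_wpDl ?enorm_ge0.
  have [t [/andP[t0 tT] ht]] := hg v w e'0 T0.
  move: tT; rewrite lt_min => /andP[tv tw].
  have [||l1 l2] := @hlip (t *: v) (t *: w).
  - by apply: ball_scale; rewrite t0.
  - by apply: ball_scale; rewrite t0.
  have ti : 0 < t^-1 by rewrite invr_gt0.
  move: l1 l2; rewrite -scalerBr enormZ (gtr0_norm t0) => l1 l2.
  exists (t^-1 *: (h (t *: v) - h (t *: w))); split.
  - apply: (@le_lt_trans _ _ ((n%:R + 1) * (2 * e'))).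
      apply: enorm_le => [|j]; first by rewrite ltW // mulr_gt0.
      have [h1 h2] := ht j; rewrite !mxE.
      have -> : t^-1 * (h (t *: v) ord0 j - h (t *: w) ord0 j) - (g v ord0 j - g w ord0 j) =
        (h (t *: v) ord0 j / t - g v ord0 j) - (h (t *: w) ord0 j / t - g w ord0 j) by ring.
      by apply: le_trans (ler_normB _ _) _; lra.
    have -> : (n%:R + 1) * (2 * e') = e / 2 by rewrite /e'; field; rewrite gt_eqF.
    exact: half_lt.
  - by rewrite enormZ (gtr0_norm ti) [X in _ <= X]mulrC ler_pdivlMr // mulrAC -mulrA.
  - by rewrite enormZ (gtr0_norm ti) [X in X <= _]mulrC ler_pdivrMr // mulrAC -mulrA.
split; apply: le_eps => e /key[x [x1 x2 x3]].
  have := ler_enormB x (g v - g w); lra.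
have := ler_enormB (g v - g w) x; rewrite -[X in _ <= X]enormN opprB; lra.
Qed.

Definition conic (A : set 'rV[R]_n) := forall a, dirset A a -> forall e : R, 0 < e ->
  exists2 de : R, 0 < de & forall rho, 0 < rho < de ->
    exists2 x, A x & forall j, `|x ord0 j - rho * a ord0 j| <= e * rho.

Lemma blowup_neq0 v : v != 0 -> 0 < enorm (g v).
Proof.
move=> v0; have [+ _] := blowup_lip v 0; rewrite blowup0 !subr0; apply: lt_le_trans.
rewrite mulr_gt0 // lt_neqAle enorm_ge0 andbT eq_sym.
by apply: contra v0 => /eqP/enorm_eq0 ->.
Qed.

(** The times [t] at which [h (t v) / t] is close to its limit are dictated by the ultrafilter.
    [conic] supplies a point [x] of [A] near [t s a] at exactly such a time, and the upper Lipschitz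
    bound transfers the limit to [h x / t]. *)
Lemma blowup_dir (A : set 'rV[R]_n) a (s : R) : conic A -> dirset A a -> 0 < s ->
  dirset (h @` (A `&` eball 0 r)) ((enorm (g (s *: a)))^-1 *: g (s *: a)).
Proof.
move=> cA Da s0; have a1 : enorm a = 1 by case: Da.
have sa0 : s *: a != 0.
  rewrite scaler_eq0 negb_or gt_eqF //=; apply/eqP => a0.
  by move/eqP: a1; rewrite a0 enorm0 eq_sym oner_eq0.
apply: dirset_intro => [|e e0].
  by apply/eqP => g0; have := blowup_neq0 sa0; rewrite g0 enorm0 ltxx.
have n1 : 0 < n%:R + 1 :> R by rewrite ltr_wpDl.
pose L := K2 * ((n%:R + 1) * s); have L0 : 0 < L by rewrite !mulr_gt0.
have e2 : 0 < e / 2 / L by rewrite !divr_gt0.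
pose c := Num.min 1 (e / 2 / L); have c0 : 0 < c by rewrite lt_min ltr01.
have [c1 cL] : c <= 1 /\ c * L <= e / 2.
  by split; [rewrite ge_min lexx|rewrite -ler_pdivlMr // ge_min lexx orbT].
have [de de0 hde] := cA a Da c c0.
pose T := Num.min (Num.min e (de / s)) (r / (s * (n%:R + 1) + s + 1)).
have q0 : 0 < s * (n%:R + 1) + s + 1 by rewrite !addr_gt0 // mulr_gt0.
have T0 : 0 < T by rewrite !lt_min e0 !divr_gt0.
have [t [/andP[t0 tT] ht]] := hg (s *: a) (s *: a) (divr_gt0 e0 (ltr0Sn R 1)) T0.
move: tT; rewrite !lt_min ltr_pdivlMr // ltr_pdivlMr // => /andP[/andP[te td] tr].
have ts0 : 0 < t * s by rewrite mulr_gt0.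
have [|x Ax hx] := hde (t * s); first by rewrite ts0.
have xs : enorm (x - t *: (s *: a)) <= (n%:R + 1) * (c * (t * s)).
  apply: enorm_le => [|j]; first by rewrite ltW // !mulr_gt0.
  by rewrite !mxE mulrA; exact: hx.
have tsa : enorm (t *: (s *: a)) = t * s by rewrite !enormZ a1 mulr1 !gtr0_norm.
have Bt : eball 0 r (t *: (s *: a)).
  rewrite eballE tsa; apply: le_lt_trans tr; rewrite ler_pM2l // -addrA addrCA lerDl.
  by rewrite addr_ge0 // ltW // mulr_gt0.
have Bx : eball 0 r x.
  rewrite eballE; have := ler_enormB x (t *: (s *: a)); rewrite tsa => h1.
  have h2 : (n%:R + 1) * (c * (t * s)) <= (n%:R + 1) * (t * s).
    by rewrite ler_pM2l // ler_piMl // ltW.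
  have h3 : t * (s * (n%:R + 1) + s + 1) = (n%:R + 1) * (t * s) + t * s + t by ring.
  move: tr; rewrite h3; lra.
exists (h x), t; split=> [||j]; first by exists x.
  by rewrite t0.
have [_ l2] := hlip Bx Bt.
have [hj _] := ht j.
have -> : h x ord0 j / t - g (s *: a) ord0 j = (h x - h (t *: (s *: a))) ord0 j / t +
   (h (t *: (s *: a)) ord0 j / t - g (s *: a) ord0 j) by rewrite !mxE; ring.
apply: le_trans (ler_normD _ _) _.
have h4 : `|(h x - h (t *: (s *: a))) ord0 j / t| <= e / 2.
  rewrite normrM normfV (gtr0_norm t0) ler_pdivrMr //.
  apply: le_trans (coord_le_enorm _ _) (le_trans l2 _).
  apply: le_trans (_ : _ <= K2 * ((n%:R + 1) * (c * (t * s)))) _; first by rewrite ler_pM2l.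
  have -> : K2 * ((n%:R + 1) * (c * (t * s))) = c * L * t by rewrite /L; ring.
  by rewrite ler_pM2r.
lra.
Qed.

(** Otherwise the [F l] cover D(h(A)) by sets with fewer than [k] Lipschitz coordinates. Pulled back
    by the direction [y] of [g], they cover a box of polar coordinates on the cone over the given
    piece, and each pull-back is thin, which contradicts [baire_thin]. *)
Lemma piece_image (A : set 'rV[R]_n) k : conic A -> PU (dirset (h @` (A `&` eball 0 r))) ->
  has_analytic_piece (dirset A) k -> exists2 k', (k <= k')%N &
    has_analytic_piece (dirset (h @` (A `&` eball 0 r))) k'.
Proof.
move=> cA; set D' := dirset (h @` _) => pD [c [W [phi [ic [oW [w0 Ww0]] _ phic Dphi]]]].
apply: contrapT => nk.
have [||F hF cov] := @PU_small_cover R n k D' D' pD => //.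
  by move=> k' hk'; rewrite ltnNge; apply/negP => kk; apply: nk; exists k'.
have n1 : 0 < n%:R + 1 :> R by rewrite ltr_wpDl.
have k1 : 0 < k%:R + 1 :> R by rewrite ltr_wpDl.
have [r1 r10 hr1] := oW w0 Ww0.
pose rad := Num.min (r1 / (k%:R + 1) / 2) (1 / 2).
have rad0 : 0 < rad by rewrite lt_min !divr_gt0.
have radr : (k%:R + 1) * rad < r1.
  apply: (@le_lt_trans _ _ ((k%:R + 1) * (r1 / (k%:R + 1) / 2))).
    by rewrite ler_pM2l // ge_min lexx.
  by rewrite mulrA mulrCA divff ?gt_eqF // mulr1 half_lt.
(* Coordinate [k] of the box is the radius; centre 3/2 and [rad <= 1/2] keep it in [[1, 2]], away
   from the apex of the cone. *)
pose ctr i : R := if i == k then 3 / 2 else ofrow w0 i.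
pose box := cbox k.+1 ctr rad.
have boxW (v : nat -> R) : box v -> W (torow k v).
  move=> hv; apply: hr1; rewrite /eball /=; apply: le_lt_trans radr.
  apply: enorm_le => [|j]; first exact: ltW.
  have := hv j (leqW (ltn_ord j)); rewrite /ctr ltn_eqF // ofrowE.
  by rewrite !mxE.
have boxk (v : nat -> R) : box v -> 1 <= v k <= 2.
  move=> /(_ k (ltnSn k)); rewrite /ctr eqxx ler_distl => /andP[v1 v2].
  have : rad <= 1 / 2 by rewrite ge_min lexx orbT.
  by move=> hr; apply/andP; split; lra.
pose Phi (v : nat -> R) := v k *: phi (torow k v).
pose lam (v : nat -> R) := enorm (g (Phi v)).
pose y (v : nat -> R) := (lam v)^-1 *: g (Phi v).
have phi1 (v : nat -> R) : box v -> enorm (phi (torow k v)) = 1 by move=> /boxW/Dphi[].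
have PhiN (v : nat -> R) : box v -> enorm (Phi v) = v k.
  move=> hv; have /andP[v1 _] := boxk v hv.
  by rewrite /Phi enormZ phi1 // mulr1 ger0_norm // (le_trans ler01).
have Dy (v : nat -> R) : box v -> D' (y v).
  move=> hv; have /andP[v1 _] := boxk v hv; apply: blowup_dir => //.
    exact/Dphi/boxW.
  exact: lt_le_trans v1.
have y1 (v : nat -> R) : box v -> enorm (y v) = 1 by move=> /Dy[].
have lamy (v : nat -> R) : box v -> g (Phi v) = lam v *: y v.
  move=> hv; rewrite /y scalerA divff ?scale1r // gt_eqF //; apply: blowup_neq0.
  have /andP[v1 _] := boxk v hv.
  by apply/eqP => P0; move: (PhiN v hv); rewrite P0 enorm0; lra.
have lam2 (v : nat -> R) : box v -> lam v <= 2 * K2.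
  move=> hv; have [_] := blowup_lip (Phi v) 0; rewrite blowup0 !subr0 => h1.
  apply: le_trans h1 _; rewrite PhiN // mulrC ler_pM2r //; by have /andP[] := boxk v hv.
(* The norm of [Phi v] gives [v k]; as [v k >= 1], the direction is recovered with constant 2, and
   by [phic] its coordinates include the other [v i]. *)
have Phi_inj (v v' : nat -> R) : box v -> box v' -> forall i, (i < k.+1)%N ->
    `|v i - v' i| <= 2 * enorm (Phi v - Phi v').
  move=> hv hv'; set d := enorm _.
  have hk : `|v k - v' k| <= d by rewrite -(PhiN v) // -(PhiN v') //; exact: ler_dist_enorm.
  have d0 : 0 <= d by exact: enorm_ge0.
  have hd : enorm (phi (torow k v) - phi (torow k v')) <= 2 * d.
    have /andP[v1 _] := boxk v hv; have v0 : 0 <= v k by exact: le_trans v1.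
    apply: (@le_trans _ _ (v k * enorm (phi (torow k v) - phi (torow k v')))).
      by rewrite ler_peMl // enorm_ge0.
    rewrite -{1}(ger0_norm v0) -enormZ.
    have -> : v k *: (phi (torow k v) - phi (torow k v')) =
       (Phi v - Phi v') - (v k - v' k) *: phi (torow k v').
      by rewrite /Phi scalerBr scalerBl opprB addrA subrK.
    by apply: le_trans (ler_enormD _ _) _; rewrite enormN enormZ phi1 // mulr1 mulrDl mul1r lerD.
  move=> i; rewrite ltnS leq_eqVlt => /predU1P[->|ik]; first by rewrite mulrDl mul1r (le_trans hk) // lerDl.
  apply: le_trans hd; have := coord_le_enorm (phi (torow k v) - phi (torow k v')) (c (Ordinal ik)).
  by rewrite !mxE !phic ?torowE //; exact: boxW.
clearbody y.
pose G l := [set v : nat -> R | box v /\ F l (y v)].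
have thinG l : thin k (G l).
  have [[x Fx]|nF] := pselect (F l !=set0); last first.
    exists (fun _ _ => 0), 1, 1; split=> // v; first by move=> _ i _; rewrite normr0.
    by move=> v' e [_ Fv]; case: nF; exists (y v).
  have [k' [c' [C [kk C0 hC]]]] := hF l (ex_intro _ x Fx).
  (* The [k'] coordinates of the direction, then its norm factor [lam v] from slot [k'] on; this
     slot is among the [k] available ones because [k' < k]. *)
  pose pi (v : nat -> R) i := if insub i is Some j then y v ord0 (c' j) else lam v.
  pose B := 1 + 2 * K2; have B0 : 0 < B by rewrite addr_gt0 // mulr_gt0.
  pose C' := 2 / K1 * (2 * K2 * ((n%:R + 1) * C) + 1).
  have C'0 : 0 < C' by rewrite mulr_gt0 ?divr_gt0 // addr_gt0 // !mulr_gt0.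
  exists pi, B, C'; split=> //.
    move=> v [hv _] i _; rewrite /pi; case: insub => [j|].
      apply: le_trans (coord_le_enorm _ _) _; rewrite y1 // lerDl ltW // mulr_gt0 //.
    rewrite ger0_norm ?enorm_ge0 //; apply: le_trans (lam2 v hv) _; by rewrite lerDr.
  move=> v v' e [hv Fv] [hv' Fv'] e0 hpi i ik.
  apply: le_trans (Phi_inj v v' hv hv' i ik) _.
  have hl : `|lam v - lam v'| <= e.
    have := hpi k' kk; rewrite /pi insubF //; exact: ltnn.
  have hy : enorm (y v - y v') <= (n%:R + 1) * (C * e).
    apply: enorm_le => [|j]; first by rewrite mulr_ge0 // ltW.
    rewrite !mxE; apply: hC => // i'.
    by have := hpi i' (ltn_trans (ltn_ord i') kk); rewrite /pi valK.
  have [l1 _] := blowup_lip (Phi v) (Phi v').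
  have l2 : enorm (g (Phi v) - g (Phi v')) <= (2 * K2 * ((n%:R + 1) * C) + 1) * e.
    have -> : g (Phi v) - g (Phi v') = lam v *: (y v - y v') + (lam v - lam v') *: y v'.
      by rewrite !lamy // scalerBr scalerBl addrA subrK.
    apply: le_trans (ler_enormD _ _) _; rewrite !enormZ y1 // mulr1 mulrDl mul1r lerD //.
    rewrite ger0_norm ?enorm_ge0 //.
    apply: le_trans (_ : _ <= 2 * K2 * ((n%:R + 1) * (C * e))) _; last by rewrite !mulrA.
    by apply: ler_pM => //; rewrite ?enorm_ge0 // lam2.
  have -> : C' * e = 2 * ((2 * K2 * ((n%:R + 1) * C) + 1) * e / K1).
    by rewrite /C'; field; rewrite gt_eqF.
  by rewrite ler_pM2l // ler_pdivlMr // [X in X <= _]mulrC; exact: le_trans l1 l2.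
have [v hv nv] := baire_thin ctr rad0 thinG.
by have [l Fl] := cov _ (Dy v hv); apply: (nv l).
Qed.

End OneSide.

(** * Directions of a subanalytic germ *)

Section SemianalyticStreams.
Context {R : realType}.
Implicit Types (d : nat) (p q : nat -> R) (S T : set (nat -> R)).

Lemma sa_and d S T p : sa d S p -> sa d T p -> sa d [set x | S x /\ T x] p.
Proof.
move=> [m1 [f1 [e1 [e10 a1 h1]]]] [m2 [f2 [e2 [e20 a2 h2]]]].
exists (m1 + m2)%N, (fun i => if (i < m1)%N then f1 i else f2 (i - m1)%N), (Num.min e1 e2).
have [l1 l2] : Num.min e1 e2 <= e1 /\ Num.min e1 e2 <= e2 by rewrite !ge_min !lexx orbT.
split; first by rewrite lt_min e10.
  move=> i im; case: (ltnP i m1) => [/a1 //|mi]; apply: a2; by rewrite ltn_subLR.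
move=> q q' hq hq' q0 q'0 sg [Sq Tq]; split.
  apply: h1 Sq => //; [exact: close_le hq|exact: close_le hq'|].
  by move=> i im; have := sg i (ltn_addr _ im); rewrite im.
apply: h2 Tq => //; [exact: close_le hq|exact: close_le hq'|].
by move=> i im; have := sg (m1 + i)%N; rewrite ltn_add2l (ltnNge (m1 + i)) leq_addr /= addKn; apply.
Qed.

Lemma sa_eq0 d (F : (nat -> R) -> R) p : ana d F p -> sa d [set x | F x = 0] p.
Proof.
move=> aF; exists 1%N, (fun=> F), 1; split=> // q q' _ _ _ _ /(_ 0%N isT) /esym/eqP E /= F0.
by apply/eqP; rewrite -sgr_eq0; move: E; rewrite F0 sgr0.
Qed.

(** The pairs [(i, j)] of the local description are numbered [i * Jm + j] with [Jm] above every
    [J i]; numbers that stand for no pair get the function 0. *)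
Lemma sa_preim d N (S : set 'rV[R]_N) (f : (nat -> R) -> 'rV[R]_N) p : semianalytic S ->
  (forall j, ana d (fun x => f x ord0 j) p) -> sa d [set x | S (f x)] p.
Proof.
move=> hS af; have [s s0 [I [J [F [eq0 [aF SE]]]]]] := hS (f p).
have N1 : 0 < N%:R + 2 :> R by rewrite ltr_wpDl.
have [e e0 he] : nearp d p (fun x => eball (f p) s (f x)).
  have s'0 : 0 < s / (N%:R + 2) by rewrite divr_gt0.
  have [e e0 he] : nearp d p (fun x => forall j, (j < N)%N ->
      `|ofrow (f x) j - ofrow (f p) j| < s / (N%:R + 2)).
    apply: nearp_all => j jN.
    have [e e0 he] := ana_cont (af (Ordinal jN)) s'0.
    by exists e => // q /he; rewrite -!ofrowE.
  exists e => // q /he hq; rewrite /eball /=.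
  apply: (@le_lt_trans _ _ ((N%:R + 1) * (s / (N%:R + 2)))).
    apply: enorm_le => [|j]; first exact: ltW.
    by have := hq j (ltn_ord j); rewrite !mxE !ofrowE => /ltW.
  by rewrite mulrA ltr_pdivrMr // mulrC ltr_pM2l //; lra.
pose Jm := (\sum_(i < I) J i).+1.
have JJm i : (i < I)%N -> (J i < Jm)%N.
  by move=> iI; rewrite ltnS (bigD1 (Ordinal iI)) //= leq_addr.
pose G l x : R :=
  if (l %/ Jm < I)%N && (l %% Jm < J (l %/ Jm))%N then F (l %/ Jm)%N (l %% Jm)%N (f x) else 0.
exists (I * Jm)%N, G, e; split=> //.
  move=> l _; rewrite /G; case: andP => [[lI lJ]|_]; last exact: ana_const.
  have Bp : eball (f p) s (f p) by rewrite /eball /= subrr enorm0.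
  have := analytic_on_ana (aF _ _ lI lJ) Bp.
  set H := F _ _ => aH.
  have -> : (fun x => H (f x)) = (fun x => H (torow N (fun j => ofrow (f x) j))).
    by apply/funext => x; rewrite (_ : (fun j => _) = ofrow (f x)) ?ofrowK.
  apply: (ana_comp (d := N) (f := fun u => H (torow N u)) (g := fun j x => ofrow (f x) j)) => // j jN.
  have -> : (fun x => ofrow (f x) j) = (fun x => f x ord0 (Ordinal jN)); last exact: af.
  by apply/funext => x; rewrite -ofrowE.
move=> q q' hq hq' _ _ sg /= Sq.
have : (S `&` eball (f p) s) (f q) by split=> //; exact: he.
rewrite SE => -[_ [i iI hi]].
suff : (S `&` eball (f p) s) (f q') by case.
rewrite SE; split; first exact: he.
exists i => // j jJ.
have := sg (i * Jm + j)%N; rewrite /G.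
have jm : (j < Jm)%N by exact: ltn_trans jJ (JJm i iI).
rewrite divnMDl // divn_small // addn0 modnMDl modn_small // iI jJ /=.
have -> : (i * Jm + j < I * Jm)%N.
  by apply: (@leq_trans (i.+1 * Jm)); [rewrite mulSn addnC ltn_add2r|rewrite leq_pmul2r].
move=> /(_ isT) E; have := hi j jJ; case: (eq0 i j) => H.
  by apply/eqP; rewrite -sgr_eq0 -E H sgr0.
by rewrite -sgr_gt0 -E sgr_gt0.
Qed.

End SemianalyticStreams.

Section DirectionsOfGerms.
Context {R : realType}.
Variables (n m : nat) (A : set 'rV[R]_n) (r M : R) (S : set 'rV[R]_(n + m)).
Hypotheses (r0 : 0 < r) (hS : semianalytic S) (hM : forall y, S y -> enorm y <= M).
Hypothesis AS : A `&` eball 0 r = proj_first S `&` eball 0 r.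

(* Polar coordinates in the first n coordinates: p 0 is the radius, p 1, ..,
   p n the direction, and the remaining coordinates are those of R^m. *)
Definition polar (x : nat -> R) : 'rV[R]_(n + m) :=
  \row_l (if (l < n)%N then x 0%N * x l.+1 else x l.+1).

Definition polar_set : set (nat -> R) :=
  [set x | S (polar x) /\ \sum_(i < n) x i.+1 ^+ 2 - 1 = 0].

Lemma sa_polar_set p : sa (n + m).+1 polar_set p.
Proof.
apply: sa_and; last first.
  apply: sa_eq0; apply: anaB; last exact: ana_const.
  apply: (@ana_sum _ _ n (fun i x => x i.+1 ^+ 2)) => i iN.
  by apply: anaX; apply: ana_coord; rewrite ltnS; exact: ltn_addr.
apply: sa_preim hS _ => j.
have -> : (fun x => polar x ord0 j) = (fun x => if (j < n)%N then x 0%N * x j.+1 else x j.+1).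
  by apply/funext => x; rewrite mxE.
case: (j < n)%N; last by apply: ana_coord; rewrite ltnS.
by apply: anaM; apply: ana_coord; rewrite ?ltnS.
Qed.

Lemma lsubmx_polar x : lsubmx (polar x) = x 0%N *: \row_(j < n) x j.+1.
Proof. by apply/rowP => j; rewrite !mxE /= ltn_ord. Qed.

Lemma polar_set_norm x : polar_set x -> enorm (\row_(j < n) x j.+1) = 1.
Proof.
move=> [_ /eqP]; rewrite subr_eq0 => /eqP E; rewrite /enorm -[RHS]sqrtr1 -E.
by congr Num.sqrt; apply: eq_bigr => i _; rewrite mxE.
Qed.

Lemma polar_set_sub x : polar_set x -> 0 < x 0%N < r -> A (x 0%N *: \row_(j < n) x j.+1).
Proof.
move=> Tx /andP[x0 xr].
suff : (A `&` eball 0 r) (x 0%N *: \row_(j < n) x j.+1) by case.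
rewrite AS; split; first by exists (polar x); [case: Tx|rewrite lsubmx_polar].
by rewrite eballE enormZ polar_set_norm // mulr1 gtr0_norm.
Qed.

(** From left to right, the boundedness of [S] lets the hidden coordinates of a lifted sequence
    converge along an ultrafilter, so a limit direction lifts to a point of the closure over radius
    0. From right to left, [polar_set_sub] brings points of [polar_set] back into [A]. *)
Lemma dirset_polar a : dirset A a <-> exists p, [/\ p 0%N = 0,
  forall j : 'I_n, a ord0 j = p j.+1 & cl (n + m).+1 polar_set p].
Proof.
have n1 : 0 < n%:R + 1 :> R by rewrite ltr_wpDl.
split; last first.
  move=> [p [p0 pa hp]].
  have a1 : enorm a = 1.
    apply/eqP; rewrite -subr_eq0; apply/eqP; apply: lt_eps_eq0 => e e0.
    have e'0 : 0 < e / (n%:R + 1) / 2 by rewrite !divr_gt0.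
    have [x [Tx _ hx]] := hp _ e'0; rewrite -(polar_set_norm Tx).
    apply: le_lt_trans (ler_dist_enorm _ _) _.
    apply: (@le_lt_trans _ _ ((n%:R + 1) * (e / (n%:R + 1) / 2))).
      apply: enorm_le => [|j]; first exact: ltW.
      rewrite !mxE pa distrC ltW // hx // ltnS; exact: ltn_addr.
    by rewrite mulrA mulrCA divff ?gt_eqF // mulr1 half_lt.
  have a0 : a != 0 by apply/eqP => a0; move/eqP: a1; rewrite a0 enorm0 eq_sym oner_eq0.
  rewrite -[a]scale1r -invr1 -a1; apply: dirset_intro => // e e0.
  have m0 : 0 < Num.min e r by rewrite lt_min e0.
  have [x [Tx x0 hx]] := hp _ m0.
  have := hx 0%N isT; rewrite p0 subr0 gtr0_norm // lt_min => /andP[xe xr].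
  exists (x 0%N *: \row_(j < n) x j.+1), (x 0%N); split.
  - by apply: polar_set_sub => //; rewrite x0.
  - by rewrite x0.
  - move=> j; rewrite !mxE mulrAC divff ?gt_eqF // mul1r pa ltW //.
    have := hx j.+1; rewrite lt_min ltnS => /(_ _)/andP[] //; exact: ltn_addr.
move=> [a1 [u [Au u0 ua]]].
have /choice[s hs] : forall i, exists s, eball 0 r (u i) -> S s /\ lsubmx s = u i.
  move=> i; have [B|nB] := pselect (eball 0 r (u i)); last by exists 0.
  have : (A `&` eball 0 r) (u i) by split=> //; case: (Au i).
  by rewrite AS => -[[s Ss E] _]; exists s.
have [U [UU oU]] := ultraFilterLemma eventually_filter.
have evU (P : set nat) M0 : (forall i, (M0 <= i)%N -> P i) -> U P.
  by move=> h; apply: oU; exists M0.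
have small (e : R) : 0 < e -> U [set i | enorm (u i) < e].
  by move=> /u0[M0 hM0]; apply: (evU _ M0) => i /hM0; rewrite subr0.
have ball : U [set i | eball 0 r (u i)].
  by apply: filterS (small r r0) => i; rewrite /= eballE.
(* Slot 0 holds the radius, the next [n] the unit vector, and the rest are the last [m] coordinates
   of the lift [s i]. *)
pose X i l : R := if l is l'.+1 then
  (if (l' < n)%N then ofrow ((enorm (u i))^-1 *: u i) l' else ofrow (s i) l') else enorm (u i).
have /choice[p hp] : forall l, exists v, (l < (n + m).+1)%N -> ulim U (fun i => X i l) v /\
    (l = 0%N -> v = 0) /\ (forall j : 'I_n, l = j.+1 -> v = a ord0 j).
  move=> [|l].
    exists 0 => _; split=> //; move=> e /small; apply: filterS => i /=.
    by rewrite subr0 ger0_norm ?enorm_ge0.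
  case: (boolP (l < (n + m))%N) => lnm; last by exists 0; rewrite ltnS (negPf lnm).
  case: (boolP (l < n)%N) => ln.
    exists (a ord0 (Ordinal ln)) => _; split; last first.
      by split=> // j [lj]; congr (a _ _); apply: val_inj.
    move=> e /ua[M0 hM0]; apply: (evU _ M0) => i /hM0 h; rewrite /= ln.
    rewrite -[l]/(val (Ordinal ln)) ofrowE; apply: le_lt_trans h.
    by have := coord_le_enorm ((enorm (u i))^-1 *: u i - a) (Ordinal ln); rewrite !mxE.
  have [|v hv] := @ulim_exists _ U _ (fun i => X i l.+1) M.
    apply: filterS ball => i /hs[Ss _] /=; rewrite (negPf ln).
    rewrite -[l]/(val (Ordinal lnm)) ofrowE.
    exact: le_trans (coord_le_enorm _ _) (hM Ss).
  exists v => _; split=> //; split=> // j [lj]; by move: ln; rewrite lj ltn_ord.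
exists p; split.
- exact: (hp 0%N isT).2.1.
- by move=> j; rewrite ((hp j.+1 _).2.2 j) // ltnS ltn_addr.
move=> e e0.
have Ucl : U [set i | forall l, (l < (n + m).+1)%N -> `|X i l - p l| < e].
  by apply: filter_fin => l ld; exact: (hp l ld).1.
have [i [/= Bi ci]] := filter_ex (filterI ball Ucl).
have [Ss sE] := hs i Bi; have [Ai ui] := Au i.
have un : 0 < enorm (u i).
  by rewrite lt_neqAle enorm_ge0 andbT eq_sym; apply: contra ui => /eqP/enorm_eq0 ->.
have polX : polar (X i) = s i.
  apply/rowP => l; rewrite mxE /X /=; case: (boolP (l < n)%N) => ln; last by rewrite ofrowE.
  rewrite -[nat_of_ord l]/(val (Ordinal ln)) ofrowE mxE mulrA divff ?gt_eqF // mul1r -sE mxE.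
  by congr (s i _ _); apply: val_inj.
exists (X i); split=> //; split; first by rewrite polX.
have -> : \sum_(j < n) X i j.+1 ^+ 2 = enorm ((enorm (u i))^-1 *: u i) ^+ 2.
  by rewrite enorm_sqr; apply: eq_bigr => j _; rewrite /= ltn_ord ofrowE.
by rewrite enormZ normfV gtr0_norm // mulVf ?gt_eqF // expr1n subrr.
Qed.

Lemma subanalytic_conic : conic A.
Proof.
move=> a /dirset_polar[p [p0 pa hp]] e e0.
have [de de0 hde] := cl_all_rho (sa_polar_set p) p0 hp e0.
exists (Num.min de r) => [|rho]; first by rewrite lt_min de0.
rewrite lt_min => /and3P[rho0 rhod rhor].
have [|x [Tx xr hx]] := hde rho; first by rewrite rho0.
exists (x 0%N *: \row_(j < n) x j.+1).
  by apply: polar_set_sub => //; rewrite xr rho0.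
move=> j; rewrite !mxE xr -mulrBr normrM gtr0_norm // mulrC ler_pM2r // pa ltW //.
by apply: hx; rewrite ltnS ltn_addr.
Qed.

(** The directions are the projection of the closure over radius 0, a countable union of analytic
    images; [image_PU] turns such images into graphs. *)
Lemma subanalytic_PU : PU (dirset A).
Proof.
pose Z := [set p | [set: nat -> R] p /\ (p 0%N = 0 /\ cl (n + m).+1 polar_set p)].
have CZ : CP (n + m).+1 (n + m).+2 Z.
  apply: closure_CP => [u _|p _ _]; last exact: sa_polar_set.
  by exists 1.
have -> : dirset A = img n (fun i u => u i.+1) Z.
  apply/seteqP; split=> a.
    by move=> /dirset_polar[p [p0 pa hp]]; exists p.
  by move=> [p [_ [p0 hp]] pa]; apply/dirset_polar; exists p.
apply: (PU_of_CP (m := (n + m).+2) _ CZ) => [d' _|u _ i iN]; first exact: image_PU.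
by apply: ana_coord; rewrite ltnS ltn_addr.
Qed.

End DirectionsOfGerms.

(** * Comparison of dimensions *)

Section Germs.
Context {R : realType}.
Variable n : nat.
Implicit Types (A B X Y : set 'rV[R]_n).

Lemma has_analytic_piece_le X k : has_analytic_piece X k -> (k <= n)%N.
Proof. by move=> [c [W [phi [/leq_card]]]]; rewrite !card_ord. Qed.

Lemma sdim_le X Y : (forall k, has_analytic_piece X k ->
  exists2 k', (k <= k')%N & has_analytic_piece Y k') -> sdim X <= sdim Y.
Proof.
move=> XY; rewrite /sdim; apply: bigmax_le => [|k /asboolP /XY[k' kk' Yk']].
  exact: bigmax_ge_id.
have k'n : (k' < n.+1)%N by exact: has_analytic_piece_le Yk'.
apply: (@le_trans _ _ (k'%:Z)); first by rewrite lez_nat.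
by apply: (@le_bigmax_cond _ _ _ _ (Ordinal k'n)); apply/asboolP.
Qed.

Lemma eball_le (s t : R) x : s <= t -> eball (0 : 'rV[R]_n) s x -> eball 0 t x.
Proof. by move=> st /lt_le_trans; apply. Qed.

Lemma germ_sub (s t : R) A B : s <= t -> A `&` eball 0 t = B `&` eball 0 t ->
  A `&` eball 0 s = B `&` eball 0 s.
Proof.
move=> st AB; have -> : eball (0 : 'rV[R]_n) s = eball 0 t `&` eball 0 s.
  by apply/seteqP; split=> x; [move=> h; split=> //; exact: eball_le h|case].
by rewrite !setIA AB.
Qed.

Lemma dirset_germ (s : R) A B : 0 < s -> A `&` eball 0 s = B `&` eball 0 s ->
  dirset A = dirset B.
Proof.
suff H A' B' : 0 < s -> A' `&` eball 0 s = B' `&` eball 0 s -> dirset A' `<=` dirset B'.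
  by move=> s0 AB; apply/seteqP; split; exact: H.
move=> s0 AB a [a1 [u [Au u0 ua]]]; split=> //.
have [N hN] := u0 s s0.
exists (fun i => u (N + i)%N); split.
- move=> i; have [Ai ui] := Au (N + i)%N; split=> //.
  suff : (B' `&` eball 0 s) (u (N + i)%N) by case.
  by rewrite -AB; split=> //; apply: hN; exact: leq_addr.
- move=> e /u0[M hM]; exists M => i Mi; apply: hM; exact: leq_trans (leq_addl _ _).
- move=> e /ua[M hM]; exists M => i Mi; apply: hM; exact: leq_trans (leq_addl _ _).
Qed.

Lemma subanalytic_germ_eq (s : R) A B : 0 < s -> A `&` eball 0 s = B `&` eball 0 s ->
  subanalytic_germ A -> subanalytic_germ B.
Proof.
move=> s0 AB [r r0 [m [S [hS bS AS]]]]; exists (Num.min r s); first by rewrite lt_min r0.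
exists m, S; split=> //.
rewrite -(germ_sub _ AB); last by rewrite ge_min lexx orbT.
by apply: (germ_sub _ AS); rewrite ge_min lexx.
Qed.

(** Stated so that it applies to the given germ and to its inverse alike. *)
Lemma sdim_dirset_le (h : 'rV[R]_n -> 'rV[R]_n) (r K1 K2 : R) A :
  0 < r -> 0 < K1 -> 0 < K2 -> h 0 = 0 ->
  (forall x y, eball 0 r x -> eball 0 r y ->
    K1 * enorm (x - y) <= enorm (h x - h y) /\ enorm (h x - h y) <= K2 * enorm (x - y)) ->
  subanalytic_germ A -> subanalytic_germ (h @` (A `&` eball 0 r)) ->
  sdim (dirset A) <= sdim (dirset (h @` (A `&` eball 0 r))).
Proof.
move=> r0 K10 K20 h0 hlip [s s0 [m [S [hS [M hM] AS]]]] [s' s'0 [m' [S' [hS' [M' hM'] AS']]]].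
have [g hg] := blowup r0 h0 hlip.
apply: sdim_le => k; apply: (piece_image r0 K10 K20 h0 hlip hg).
  exact: (subanalytic_conic s0 hS hM AS).
exact: (subanalytic_PU s'0 hS' hM' AS').
Qed.

End Germs.

Theorem theorem1p1 (R : realType) (n : nat) (h : 'rV[R]_n -> 'rV[R]_n)
  (r K1 K2 : R) (A : set 'rV[R]_n) :
  bilipschitz_germ h r K1 K2 ->
  adherent0 A ->
  subanalytic_germ A ->
  subanalytic_germ (h @` (A `&` eball 0 r)) ->
  sdim (dirset (h @` (A `&` eball 0 r))) = sdim (dirset A).
Proof.
move=> [[r0 K10] K12 h0 oh hlip] _ sA shA.
have K20 : 0 < K2 by exact: lt_le_trans K12.
set A2 := h @` _ in shA *.
apply/le_anti/andP; split; last exact: (sdim_dirset_le r0 K10 K20 h0 hlip).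
have B0 : eball (0 : 'rV[R]_n) r 0 by rewrite eballE enorm0.
have [|r' r'0 hr'] := oh 0; first by exists 0.
have hinj x y : eball 0 r x -> eball 0 r y -> h x = h y -> x = y.
  move=> Bx By E; have [h1 _] := hlip x y Bx By.
  apply/eqP; rewrite -subr_eq0; apply/eqP/enorm_eq0/eqP; rewrite eq_le enorm_ge0 andbT.
  by rewrite -(ler_pM2l K10) mulr0; apply: le_trans h1 _; rewrite E subrr enorm0.
have /choice[g hg] : forall y, exists x, eball 0 r' y -> eball 0 r x /\ h x = y.
  move=> y; have [/hr'[x Bx E]|nB] := pselect (eball 0 r' y); first by exists x.
  by exists 0.
have gh x : eball 0 r x -> eball 0 r' (h x) -> g (h x) = x.
  by move=> Bx /hg[Bg E]; apply: hinj.
have g0 : g 0 = 0 by rewrite -[X in g X]h0 gh // h0 eballE enorm0.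
have glip x y : eball 0 r' x -> eball 0 r' y -> K2^-1 * enorm (x - y) <= enorm (g x - g y) /\
    enorm (g x - g y) <= K1^-1 * enorm (x - y).
  move=> /hg[Bx Ex] /hg[By Ey]; have [h1 h2] := hlip _ _ Bx By.
  rewrite Ex Ey in h1 h2; rewrite mulrC ler_pdivrMr // [X in _ <= X]mulrC; split=> //.
  by rewrite [X in _ <= X]mulrC ler_pdivlMr // mulrC.
(* The local inverse, applied to the part of [A2] in the ball of radius [r'], gives back only the
   germ of [A]. On the ball of radius [s] the image under [h] stays within radius [r'], so there
   both sets agree. *)
pose A3 := g @` (A2 `&` eball 0 r').
pose s := Num.min r (r' / K2); have s0 : 0 < s by rewrite lt_min r0 divr_gt0.
have AA3 : A `&` eball 0 s = A3 `&` eball 0 s.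
  apply/seteqP; split=> x [Ax Bs]; split=> //.
    have Bx : eball 0 r x by apply: eball_le Bs; rewrite ge_min lexx.
    have Bh : eball 0 r' (h x).
      have [_] := hlip x 0 Bx B0; rewrite h0 !subr0 eballE => hx.
      apply: le_lt_trans hx _; rewrite mulrC -ltr_pdivlMr //.
      by move: Bs; rewrite eballE lt_min => /andP[].
    by exists (h x); [split=> //; exists x|exact: gh].
  by case: Ax => _ [[a [Aa Ba] <-] Bh] <-; rewrite gh.
rewrite (dirset_germ s0 AA3); apply: (sdim_dirset_le (K1 := K2^-1) (K2 := K1^-1)) => //.
- by rewrite invr_gt0.
- by rewrite invr_gt0.
- exact: subanalytic_germ_eq AA3 sA.
Qed.
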